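(* Let $f\in\mathbb R[x]$ be a non-linear real polynomial and $k\in\mathbb R[x]$ with primitive $K=\int k$. Let $\{\gamma(t)\}$ be a family of real ovals $$\gamma(t)\subset\{(x,y)\in\mathbb R^2:y^2-f(x)=t\},$$ depending continuously on the real parameter $t$ in an interval. Each oval is parametrized as $y=\pm\sqrt{f(x)+t}$, $x_1(t)\le x\le x_2(t)$, where $x_1(t)<x_2(t)$ are two real roots of $f(x)+t$ depending continuously on $t$. Let $$I(t)=\int_{\gamma(t)}k(x)\,y\,dx.$$ Then $I(t)\equiv0$ if and only if there exists a polynomial $r\in\mathbb R[x]$ such that $f$ and $K$ are both polynomials in $r$ (i.e. $f=\tilde f\circ r$ and $K=\tilde K\circ r$ for some polynomials $\tilde f,\tilde K$) and $r(x_1(t))\equiv r(x_2(t))$. *)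

(* Defs.v *)
From Stdlib Require Import Reals List.
Open Scope R_scope.

Fixpoint peval (p : list R) (x : R) : R :=
  match p with
  | nil => 0
  | a :: q => a + x * peval q x
  end.

Definition nonlinear (f : list R) : Prop :=
  ~ (exists a b : R, forall x, peval f x = a * x + b).

Definition is_interval (J : R -> Prop) : Prop :=
  forall a b c, J a -> J c -> a <= b <= c -> J b.
Definition nondegenerate (J : R -> Prop) : Prop :=
  exists a b, J a /\ J b /\ a < b.

Definition continuous_on (g : R -> R) (J : R -> Prop) : Prop :=
  forall t, J t -> limit1_in g J (g t) t.

(* The line integral of k(x) y dx over the oval
   gamma(t) = { y = +- sqrt(f(x)+t), x1(t) <= x <= x2(t) } equals
   -+ 2 * int_{x1(t)}^{x2(t)} k(x) sqrt(f(x)+t) dx (sign = orientation);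
   it vanishes iff this Riemann integral is 0. *)
Definition oval_integral_vanishes (k f : list R) (x1 x2 : R -> R) (t : R) : Prop :=
  exists pr : Riemann_integrable (fun x => peval k x * sqrt (peval f x + t))
                                 (x1 t) (x2 t),
    RiemannInt pr = 0.

(* Main.v *)
(* Put u = -t, so that f(x1) = f(x2) = u, and let G be a primitive of K f'. Then
   Psi(u) = G(x1) - G(x2) is the integral of k (f - u) over [x1, x2].

   Analysis. For A(w) = int k sqrt (f - w), Fubini gives that int_u^M A(w) / (2 sqrt (w - u)) dw is
   a constant multiple of Psi(u). If the oval integrals vanish then so does A near u, and expanding
   the kernel in s = 1/(M - u) yields Psi^2 = s E(s)^2 with E a convergent power series.

   Algebra. Psi^2 is a root of the product of the V - (G(X_i) - G(X_j))^2, where the X_i are the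
   roots of f - z in the field of Puiseux series at z = infinity. Hence the formal series s E^2 equals
   some (G(X_i) - G(X_j))^2. It is a series in 1/z without constant term, so the monodromy theta at
   infinity preserves G(X_i) - G(X_j) up to sign. If the difference is fixed, summing over the cycle
   shows that it is 0. If theta changes its sign, counting multiplicities shows that its square is
   rational over R(z); being integral over R[z] and vanishing at infinity, it is 0. So Psi = 0.

   Finally f and G are polynomials in some r generating R(f, G), and (f, G) determines r outside a
   finite set, so r(x1) = r(x2) along the family; differentiating G shows that K is also a
   polynomial in r. The converse is a change of variables. *)

(* The ovals exist only for [u] in a segment [[v0, v1]], yet everything is decided at infinity. The
   reason is that [A] vanishes on [[v0, v1]]: the Abel integral then runs over [[v1, M]] alone, its
   kernel is regular there, and the expansion in [s] converges from the ovals down to [s = 0], that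
   is, to [u = -infinity]. Near infinity the branches of the inverse of [f] are explicit: one
   Puiseux series and its rescalings by roots of unity, permuted cyclically, so no other monodromy
   has to be known. The kernel contributes a factor [sqrt s]; squaring removes it, at the price that
   [theta] may change the sign of the difference, which is the hard case.

   No function is continued analytically: an algebraic relation between convergent series that holds
   on a real interval of [s] passes to the coefficients by the identity theorem, and the rest is
   formal. Complex coefficients serve to have roots of unity.

   [G] takes the place of [K] because it is what the integration by parts of [k (f - u)] produces;
   [K] is recovered from [G' = K f']. *)
From Stdlib Require Import Reals Lra Lia List.
From Coquelicot Require Import Coquelicot.

(** * Abel inversion *)

Section AbelInversion.

Local Open Scope R_scope.

(** * Continuity of parametric integrals, and Fubini's theorem for continuous integrands *)

Section ParametricIntegral.

Variable h : R -> R -> R.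
Hypothesis h_cont : forall x y, continuity_2d_pt h x y.

Lemma continuous_section_l y x : continuous (fun t => h t y) x.
Proof.
  apply continuity_pt_filterlim. intros eps Heps.
  destruct (h_cont x y (mkposreal eps Heps)) as [d Hd].
  exists d. split; [apply cond_pos|].
  intros z [_ Hz]. apply (Hd z y Hz).
  rewrite Rminus_diag, Rabs_R0. apply cond_pos.
Qed.

Lemma continuous_section_r x y : continuous (fun t => h x t) y.
Proof.
  apply continuity_pt_filterlim. intros eps Heps.
  destruct (h_cont x y (mkposreal eps Heps)) as [d Hd].
  exists d. split; [apply cond_pos|].
  intros z [_ Hz]. apply (Hd x z); [|exact Hz].
  rewrite Rminus_diag, Rabs_R0. apply cond_pos.
Qed.

Lemma ex_RInt_section_l y a b : ex_RInt (fun t => h t y) a b.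
Proof. apply (ex_RInt_continuous (V := R_CompleteNormedModule)). intros; apply continuous_section_l. Qed.

Lemma ex_RInt_section_r x a b : ex_RInt (fun t => h x t) a b.
Proof. apply (ex_RInt_continuous (V := R_CompleteNormedModule)). intros; apply continuous_section_r. Qed.

Lemma continuous_RInt_section x0 c d : c <= d -> continuous (fun x => RInt (h x) c d) x0.
Proof.
  intros Hcd. apply continuity_pt_filterlim. intros eps Heps.
  set (e := eps / (d - c + 1)).
  assert (He : 0 < e) by (apply Rdiv_lt_0_compat; lra).
  destruct (uniform_continuity_2d_1d' h c d x0 (fun x _ => h_cont x0 x) (mkposreal e He))
    as [del Hdel].
  exists del. split; [apply cond_pos|].
  intros z [_ Hz]. simpl in Hz |- *. unfold R_dist in *.
  assert (Hz' : x0 - del <= z <= x0 + del).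
  { apply Rabs_def2 in Hz. lra. }
  pose proof (cond_pos del).
  rewrite <- (RInt_minus (V := R_CompleteNormedModule)); try apply ex_RInt_section_r.
  apply Rle_lt_trans with ((d - c) * e).
  - apply abs_RInt_le_const; [exact Hcd| |].
    + apply (ex_RInt_minus (V := R_CompleteNormedModule)); apply ex_RInt_section_r.
    + intros t Ht. apply Rlt_le. apply (Hdel t x0 t z); try lra.
      rewrite Rminus_diag, Rabs_R0. lra.
  - unfold e.
    replace ((d - c) * (eps / (d - c + 1))) with (eps * ((d - c) / (d - c + 1))) by (field; lra).
    rewrite <- (Rmult_1_r eps) at 2. apply Rmult_lt_compat_l; [lra|].
    apply Rlt_div_l; lra.
Qed.

End ParametricIntegral.

Lemma is_derive_0_const (F : R -> R) a b :
  (forall x, is_derive F x 0) -> F b = F a.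
Proof.
  intros HF.
  destruct (MVT_gen F a b (fun _ => 0)) as [c [_ Hc]].
  - intros; apply HF.
  - intros x _. apply continuity_pt_filterlim, (ex_derive_continuous F).
    exists 0. apply HF.
  - lra.
Qed.

(** Both iterated integrals, as functions of the upper limit of [x], have the derivative
    [RInt (h s) c d], and both are 0 at [a]. *)
Lemma RInt_swap (h : R -> R -> R) a b c d :
  (forall x y, continuity_2d_pt h x y) -> a <= b -> c <= d ->
  RInt (fun x => RInt (h x) c d) a b = RInt (fun y => RInt (fun x => h x y) a b) c d.
Proof.
  intros Hh Hab Hcd.
  set (F := fun s => RInt (fun x => RInt (h x) c d) a s
                     - RInt (fun y => RInt (fun x => h x y) a s) c d).
  assert (Hh' : forall y x, continuity_2d_pt (fun y x => h x y) y x).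
  { intros y x eps. destruct (Hh x y eps) as [del Hdel].
    exists del. intros u v Hu Hv. apply (Hdel v u); assumption. }
  assert (Hex : forall t u, ex_RInt (fun x => RInt (h x) c d) t u).
  { intros t u. apply (ex_RInt_continuous (V := R_CompleteNormedModule)).
    intros z _. apply continuous_RInt_section; assumption. }
  assert (HF : forall s, is_derive F s 0).
  { intros s. unfold F.
    replace 0 with (minus (RInt (h s) c d) (RInt (h s) c d))
      by (unfold minus, plus, opp; simpl; ring).
    apply (is_derive_minus (V := R_NormedModule)).
    - apply (is_derive_RInt (V := R_CompleteNormedModule)
        (fun x => RInt (h x) c d) (fun s => RInt (fun x => RInt (h x) c d) a s) a s).
      + exists (mkposreal 1 Rlt_0_1). intros y _. apply (RInt_correct (V := R_CompleteNormedModule)), Hex.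
      + apply continuous_RInt_section; assumption.
    - assert (HD : forall u v, is_derive (fun z => RInt (fun x => h x v) a z) u (h u v)).
      { intros u v. apply (is_derive_RInt (V := R_CompleteNormedModule) (fun x => h x v)
          (fun z => RInt (fun x => h x v) a z) a u).
        + exists (mkposreal 1 Rlt_0_1). intros y _.
          apply (RInt_correct (V := R_CompleteNormedModule)), ex_RInt_section_l, Hh.
        + apply continuous_section_l, Hh. }
      replace (RInt (h s) c d)
        with (RInt (fun y => Derive (fun u => RInt (fun x => h x y) a u) s) c d).
      2:{ apply RInt_ext. intros y _. apply is_derive_unique, HD. }
      apply (is_derive_RInt_param (fun u y => RInt (fun x => h x y) a u)).
      + exists (mkposreal 1 Rlt_0_1). intros u _ y _. exists (h u y). apply HD.
      + intros y _. apply continuity_2d_pt_ext with (f := h); [|apply Hh].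
        intros u v. symmetry. apply is_derive_unique, HD.
      + exists (mkposreal 1 Rlt_0_1). intros u _.
        apply (ex_RInt_continuous (V := R_CompleteNormedModule)).
        intros y _.
        destruct (Rle_dec a u) as [Hau|Hau].
        * apply (continuous_RInt_section (fun y x => h x y) Hh' y a u Hau).
        * apply continuous_ext with (fun y => opp (RInt (fun x => h x y) u a)).
          -- intros z. apply opp_RInt_swap, ex_RInt_section_l, Hh.
          -- apply (continuous_opp (V := R_NormedModule)).
             apply (continuous_RInt_section (fun y x => h x y) Hh' y u a); lra. }
  assert (E : F b = F a) by (apply is_derive_0_const, HF).
  unfold F in E. rewrite RInt_point in E.
  replace (RInt (fun y => RInt (fun x => h x y) a a) c d) with 0 in E.
  2:{ rewrite (RInt_ext _ (fun _ => 0)).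
      - rewrite RInt_const. unfold scal; simpl; unfold mult; simpl; ring.
      - intros x _; exact (RInt_point a (fun t => h t x)). }
  unfold zero in E; simpl in E. lra.
Qed.

(** [sqrt] is 0 on the negative numbers, hence continuous on the whole line. Thanks to this default
    value [k sqrt (f - w)] is 0 where [f <= w], and moving domains of integration can be replaced by
    a fixed one. *)
Lemma continuous_sqrt_pt x : continuity_pt sqrt x.
Proof.
  destruct (Rle_dec 0 x) as [Hx|Hx]; [apply continuity_pt_sqrt, Hx|].
  apply continuity_pt_filterlim.
  apply (continuous_ext_loc sqrt (fun _ => 0) x).
  - exists (mkposreal (- x) ltac:(lra)). intros y Hy.
    unfold ball in Hy; simpl in Hy; unfold AbsRing_ball, abs, minus, plus, opp in Hy; simpl in Hy.
    apply Rabs_def2 in Hy. rewrite sqrt_neg_0; lra.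
  - apply continuous_const.
Qed.

Lemma continuous_sqrt_comp (g : R -> R) x : continuous g x -> continuous (fun y => sqrt (g y)) x.
Proof.
  intros Hg. apply (continuous_comp g sqrt); [exact Hg|].
  apply continuity_pt_filterlim, continuous_sqrt_pt.
Qed.

Lemma ex_RInt_continuous_all (g : R -> R) a b : (forall x, continuous g x) -> ex_RInt g a b.
Proof. intros Hg. apply (ex_RInt_continuous (V := R_CompleteNormedModule)). intros; apply Hg. Qed.

Lemma RInt_zero (g : R -> R) a b :
  (forall x, Rmin a b < x < Rmax a b -> g x = 0) -> RInt g a b = 0.
Proof.
  intros Hg. rewrite (RInt_ext g (fun _ => 0)) by exact Hg.
  rewrite RInt_const. unfold scal; simpl; unfold mult; simpl; ring.
Qed.

(* Clamping the argument makes [g] continuous everywhere. *)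
Lemma IVT_limit1_in (g : R -> R) a b y :
  a <= b -> (forall u, a <= u <= b -> limit1_in g (fun v => a <= v <= b) (g u) u) ->
  Rmin (g a) (g b) <= y <= Rmax (g a) (g b) ->
  exists u, a <= u <= b /\ g u = y.
Proof.
  intros Hab Hg Hy.
  set (c := fun u => Rmax a (Rmin u b)).
  assert (Hc : forall u, a <= c u <= b).
  { intros u. unfold c, Rmax, Rmin. repeat destruct Rle_dec; lra. }
  assert (Hcl : forall u v, Rabs (c v - c u) <= Rabs (v - u)).
  { intros u v. unfold c, Rmax, Rmin.
    repeat destruct Rle_dec; unfold Rabs; repeat destruct Rcase_abs; lra. }
  assert (Hid : forall u, a <= u <= b -> c u = u).
  { intros u Hu. unfold c, Rmax, Rmin. repeat destruct Rle_dec; lra. }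
  destruct (IVT_gen (fun u => g (c u)) a b y) as [u [Hu1 Hu2]].
  - intros u eps Heps. destruct (Hg (c u) (Hc u) eps Heps) as [d [Hd Hlim]].
    exists d. split; [exact Hd|]. intros v [_ Hv]. apply Hlim.
    split; [apply Hc|]. simpl in *. unfold R_dist in *.
    eapply Rle_lt_trans; [apply Hcl|exact Hv].
  - rewrite !Hid by lra. exact Hy.
  - exists (c u). split; [apply Hc|exact Hu2].
Qed.

Lemma continuous_parabola u x : continuous (fun q => u + q * q) x.
Proof.
  apply (continuous_plus (V := R_NormedModule)); [apply continuous_const|].
  apply (continuous_mult (K := R_AbsRing)); apply continuous_id.
Qed.

Lemma continuous_minus_sqr c x : continuous (fun q => c - q * q) x.
Proof.
  apply (continuous_minus (V := R_NormedModule)); [apply continuous_const|].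
  apply (continuous_mult (K := R_AbsRing)); apply continuous_id.
Qed.

Lemma continuous_Abel_kernel (g : R -> R) u w : continuous g w -> u < w ->
  continuous (fun w => g w / (2 * sqrt (w - u))) w.
Proof.
  intros Hg Hu. apply (continuous_mult (K := R_AbsRing)); [exact Hg|].
  apply continuity_pt_filterlim.
  apply (continuity_pt_inv (fun w => 2 * sqrt (w - u))).
  - apply continuity_pt_filterlim, (continuous_mult (K := R_AbsRing) (fun _ => 2) (fun w => sqrt (w - u))); [apply continuous_const|].
    apply (continuous_sqrt_comp (fun w => w - u)).
    apply (continuous_minus (V := R_NormedModule)); [apply continuous_id|apply continuous_const].
  - assert (0 < sqrt (w - u)) by (apply sqrt_lt_R0; lra). lra.
Qed.

(** The value is [pi / 4]; what matters is that it is positive. *)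
Definition quarter_disk := RInt (fun y => sqrt (1 - y * y)) 0 1.

Lemma quarter_disk_pos : 0 < quarter_disk.
Proof.
  apply RInt_gt_0; [lra| |].
  - intros x Hx. apply sqrt_lt_R0. nra.
  - intros x _. apply continuous_sqrt_comp, continuous_minus_sqr.
Qed.

(** For [c > 0] rescale by [q = sqrt c * y]. Where [q^2 > c] the default value of [sqrt] makes the
    integrand 0, which accounts for the maximum with 0. *)
Lemma RInt_sqrt_minus_sqr c Q : 0 <= Q -> c <= Q * Q ->
  RInt (fun q => sqrt (c - q * q)) 0 Q = quarter_disk * Rmax 0 c.
Proof.
  intros HQ Hc.
  assert (Hcont : forall x, continuous (fun q => sqrt (c - q * q)) x).
  { intros x. apply continuous_sqrt_comp, continuous_minus_sqr. }
  destruct (Rle_dec c 0) as [Hc0|Hc0].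
  - rewrite Rmax_left by exact Hc0. rewrite Rmult_0_r. apply RInt_zero.
    intros x _. apply sqrt_neg_0. nra.
  - rewrite Rmax_right by lra.
    assert (Hs : 0 < sqrt c) by (apply sqrt_lt_R0; lra).
    assert (Hss : sqrt c * sqrt c = c) by (apply sqrt_sqrt; lra).
    assert (HsQ : sqrt c <= Q) by nra.
    rewrite <- (RInt_Chasles (V := R_CompleteNormedModule) _ 0 (sqrt c) Q)
      by (apply ex_RInt_continuous_all, Hcont).
    rewrite (RInt_zero _ (sqrt c) Q).
    2:{ intros x Hx. rewrite Rmin_left, Rmax_right in Hx by lra. apply sqrt_neg_0. nra. }
    pose proof (RInt_comp_lin (V := R_CompleteNormedModule) (fun q => sqrt (c - q * q))
                  (sqrt c) 0 0 1 (ex_RInt_continuous_all _ _ _ Hcont)) as HL.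
    replace (sqrt c * 0 + 0) with 0 in HL by ring.
    replace (sqrt c * 1 + 0) with (sqrt c) in HL by ring.
    rewrite <- HL.
    rewrite (RInt_ext _ (fun y => scal c (sqrt (1 - y * y)))).
    + rewrite (RInt_scal (V := R_CompleteNormedModule)).
      * unfold scal, plus, quarter_disk; simpl; unfold mult; simpl; ring.
      * apply ex_RInt_continuous_all. intros x. apply continuous_sqrt_comp, continuous_minus_sqr.
    + intros y Hy. rewrite Rmin_left, Rmax_right in Hy by lra.
      unfold scal; simpl; unfold mult; simpl.
      replace (c - (sqrt c * y + 0) * (sqrt c * y + 0)) with (c * (1 - y * y))
        by (rewrite <- Hss at 1 2; ring_simplify; rewrite <- Hss; ring).
      rewrite sqrt_mult by nra. rewrite <- Rmult_assoc, Hss. reflexivity.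
Qed.

(** * Abel transform of the oval integrals *)

Section OvalFamily.

Variables (f df k K G x1 x2 : R -> R) (v0 v1 : R).
Hypothesis f_deriv : forall x, is_derive f x (df x).
Hypothesis K_deriv : forall x, is_derive K x (k x).
Hypothesis G_deriv : forall x, is_derive G x (K x * df x).
Hypothesis k_cont : forall x, continuous k x.
Hypothesis v01 : v0 < v1.
Hypothesis x1_cont : forall u, v0 <= u <= v1 -> limit1_in x1 (fun v => v0 <= v <= v1) (x1 u) u.
Hypothesis x2_cont : forall u, v0 <= u <= v1 -> limit1_in x2 (fun v => v0 <= v <= v1) (x2 u) u.
Hypothesis x12 : forall u, v0 <= u <= v1 -> x1 u < x2 u.
Hypothesis f_x1 : forall u, v0 <= u <= v1 -> f (x1 u) = u.
Hypothesis f_x2 : forall u, v0 <= u <= v1 -> f (x2 u) = u.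
Hypothesis f_gt : forall u, v0 <= u <= v1 -> forall x, x1 u < x < x2 u -> u < f x.
Hypothesis oval_zero : forall u, v0 <= u <= v1 ->
  RInt (fun x => k x * sqrt (f x - u)) (x1 u) (x2 u) = 0.

(** The lowest level has the widest oval, so [[a, b]] contains all the others and serves as fixed
    domain of integration. *)
Let a := x1 v0.
Let b := x2 v0.

Lemma level_function_continuous x : continuous f x.
Proof. apply (ex_derive_continuous f). exists (df x). apply f_deriv. Qed.

Lemma limit1_in_shrink (g : R -> R) u :
  v0 <= u <= v1 ->
  (forall u, v0 <= u <= v1 -> limit1_in g (fun v => v0 <= v <= v1) (g u) u) ->
  forall w, v0 <= w <= u -> limit1_in g (fun v => v0 <= v <= u) (g w) w.
Proof.
  intros Hu Hg w Hw eps Heps. destruct (Hg w ltac:(lra) eps Heps) as [d [Hd Hl]].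
  exists d. split; [exact Hd|]. intros v [Hv1 Hv2]. apply Hl. split; [lra|exact Hv2].
Qed.

(** By the intermediate value theorem such an [x] is [x1 w] for some level [w <= u], and there [f]
    equals [w]. *)
Lemma below_between_x1 u x : v0 <= u <= v1 -> Rmin a (x1 u) <= x <= Rmax a (x1 u) -> f x <= u.
Proof.
  intros Hu Hx.
  destruct (IVT_limit1_in x1 v0 u x) as [w [Hw <-]]; [lra| |exact Hx|].
  - apply limit1_in_shrink; [exact Hu|exact x1_cont].
  - rewrite f_x1; lra.
Qed.

Lemma below_between_x2 u x : v0 <= u <= v1 -> Rmin b (x2 u) <= x <= Rmax b (x2 u) -> f x <= u.
Proof.
  intros Hu Hx.
  destruct (IVT_limit1_in x2 v0 u x) as [w [Hw <-]]; [lra| |exact Hx|].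
  - apply limit1_in_shrink; [exact Hu|exact x2_cont].
  - rewrite f_x2; lra.
Qed.

(** If [x1 u < a], a point slightly to the right of [x1 u] would lie inside the oval at level [u],
    where [f > u], and also between [x1 u] and [a], where [f <= u]. *)
Lemma base_le_x1 u : v0 <= u <= v1 -> a <= x1 u.
Proof.
  intros Hu. destruct (Rle_dec a (x1 u)) as [H|H]; [exact H|exfalso].
  pose proof (x12 u Hu).
  assert (Hm : x1 u < Rmin a (x2 u)) by (apply Rmin_glb_lt; lra).
  pose proof (Rmin_l a (x2 u)). pose proof (Rmin_r a (x2 u)).
  set (y := (x1 u + Rmin a (x2 u)) / 2).
  assert (f y <= u). { apply below_between_x1; [exact Hu|]. rewrite Rmin_right, Rmax_left; unfold y; lra. }
  assert (u < f y). { apply f_gt; [exact Hu|]. unfold y; lra. }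
  lra.
Qed.

Lemma x2_le_base u : v0 <= u <= v1 -> x2 u <= b.
Proof.
  intros Hu. destruct (Rle_dec (x2 u) b) as [H|H]; [exact H|exfalso].
  pose proof (x12 u Hu).
  assert (Hm : Rmax b (x1 u) < x2 u) by (apply Rmax_lub_lt; lra).
  pose proof (Rmax_l b (x1 u)). pose proof (Rmax_r b (x1 u)).
  set (y := (x2 u + Rmax b (x1 u)) / 2).
  assert (f y <= u). { apply below_between_x2; [exact Hu|]. rewrite Rmin_left, Rmax_right; unfold y; lra. }
  assert (u < f y). { apply f_gt; [exact Hu|]. unfold y; lra. }
  lra.
Qed.

Lemma RInt_superlevel (g : R -> R) u : v0 <= u <= v1 ->
  (forall x, continuous g x) -> (forall x, f x <= u -> g x = 0) ->
  RInt g a b = RInt g (x1 u) (x2 u).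
Proof.
  intros Hu Hg H0. pose proof (base_le_x1 u Hu). pose proof (x2_le_base u Hu). pose proof (x12 u Hu).
  rewrite <- (RInt_Chasles (V := R_CompleteNormedModule) g a (x1 u) b)
    by (apply ex_RInt_continuous_all, Hg).
  rewrite <- (RInt_Chasles (V := R_CompleteNormedModule) g (x1 u) (x2 u) b)
    by (apply ex_RInt_continuous_all, Hg).
  rewrite (RInt_zero g a), (RInt_zero g _ b).
  - unfold plus; simpl; ring.
  - intros x Hx. apply H0, (below_between_x2 u); [exact Hu|]. rewrite Rmin_comm, Rmax_comm; lra.
  - intros x Hx. apply H0, (below_between_x1 u); [exact Hu|]. lra.
Qed.

Let A (w : R) : R := RInt (fun x => k x * sqrt (f x - w)) a b.

Lemma integrand_continuous_2d (g : R -> R) : (forall x, continuity_pt g x) ->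
  forall x y, continuity_2d_pt (fun x q => k x * sqrt (f x - g q)) x y.
Proof.
  intros Hg x y. apply continuity_2d_pt_mult.
  - apply (continuity_1d_2d_pt_comp k (fun x _ => x)); [apply continuity_pt_filterlim, k_cont|].
    apply continuity_2d_pt_id1.
  - apply (continuity_1d_2d_pt_comp sqrt (fun x q => f x - g q)); [apply continuous_sqrt_pt|].
    apply continuity_2d_pt_minus.
    + apply (continuity_1d_2d_pt_comp f (fun x _ => x)); [apply continuity_pt_filterlim, level_function_continuous|].
      apply continuity_2d_pt_id1.
    + apply (continuity_1d_2d_pt_comp g (fun _ q => q)); [apply Hg|].
      apply continuity_2d_pt_id2.
Qed.

Lemma oval_base_lt : a < b.
Proof. apply x12. lra. Qed.

Lemma sqrt_integral_continuous w : continuous A w.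
Proof.
  pose proof oval_base_lt. unfold A.
  apply (continuous_RInt_section (fun w x => k x * sqrt (f x - w))); [|lra].
  intros w' x eps. destruct (integrand_continuous_2d (fun q => q)) with (x := x) (y := w') (eps := eps)
    as [d Hd].
  - intros z. apply continuity_pt_filterlim, continuous_id.
  - exists d. intros u v Hu Hv. apply (Hd v u); assumption.
Qed.

Lemma sqrt_integral_zero w : v0 <= w <= v1 -> A w = 0.
Proof.
  intros Hw. unfold A. rewrite (RInt_superlevel _ w Hw).
  - apply oval_zero, Hw.
  - intros x. apply (continuous_mult (K := R_AbsRing)); [apply k_cont|].
    apply continuous_sqrt_comp. apply (continuous_minus (V := R_NormedModule));
      [apply level_function_continuous|apply continuous_const].
  - intros x Hx. rewrite sqrt_neg_0; lra.
Qed.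

Variable M : R.
Hypothesis f_le_M : forall x, a <= x <= b -> f x <= M.

(* By Fubini, since [int_0^Q sqrt (c - q^2) dq] is proportional to [max 0 c]; then integrate by parts. *)
Lemma RInt_sqrt_integral_parabola u : v0 <= u < v1 -> v1 < M ->
  RInt (fun q => A (u + q * q)) 0 (sqrt (M - u)) = quarter_disk * (G (x1 u) - G (x2 u)).
Proof.
  intros Hu HvM. pose proof oval_base_lt as Hab.
  assert (HQ : 0 <= sqrt (M - u)) by apply sqrt_pos.
  assert (HQQ : sqrt (M - u) * sqrt (M - u) = M - u) by (apply sqrt_sqrt; lra).
  unfold A.
  rewrite <- (RInt_swap (fun x q => k x * sqrt (f x - (u + q * q)))); [|apply (integrand_continuous_2d (fun q => u + q * q))|lra|exact HQ].
  2:{ intros x. apply continuity_pt_filterlim, continuous_parabola. }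
  rewrite (RInt_ext _ (fun x => scal quarter_disk (k x * Rmax 0 (f x - u)))).
  2:{ intros x Hx. rewrite Rmin_left, Rmax_right in Hx by lra.
      rewrite (RInt_ext _ (fun q => scal (k x) (sqrt ((f x - u) - q * q)))).
      - rewrite (RInt_scal (V := R_CompleteNormedModule)).
        (* The upper limit [sqrt (M - u)] is large enough because [f x <= M]. *)
        + rewrite RInt_sqrt_minus_sqr; [|exact HQ|].
          * unfold scal; simpl; unfold mult; simpl; ring.
          * specialize (f_le_M x). lra.
        + apply ex_RInt_continuous_all. intros q. apply continuous_sqrt_comp, continuous_minus_sqr.
      - intros q _. unfold scal; simpl; unfold mult; simpl. f_equal. f_equal. ring. }
  assert (Hmax : forall x, continuous (fun x => k x * Rmax 0 (f x - u)) x).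
  { intros x. apply (continuous_mult (K := R_AbsRing)); [apply k_cont|].
    apply (continuous_ext (fun x => (f x - u + Rabs (f x - u)) / 2)).
    - intros y. unfold Rmax, Rabs. destruct Rle_dec, Rcase_abs; lra.
    - apply (continuous_mult (K := R_AbsRing)); [|apply continuous_const].
      assert (continuous (fun y => f y - u) x)
        by (apply (continuous_minus (V := R_NormedModule)); [apply level_function_continuous|apply continuous_const]).
      apply (continuous_plus (V := R_NormedModule)); [assumption|].
      apply (continuous_comp (fun y => f y - u) Rabs); [assumption|apply continuous_Rabs]. }
  rewrite (RInt_scal (V := R_CompleteNormedModule)) by (apply ex_RInt_continuous_all, Hmax).
  unfold scal; simpl; unfold mult; simpl. f_equal.
  rewrite (RInt_superlevel _ u); [|lra|exact Hmax|].
  2:{ intros x Hx. rewrite Rmax_left by lra. ring. }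
  assert (H12 : x1 u < x2 u) by (apply x12; lra).
  rewrite (RInt_ext _ (fun x => k x * (f x - u))).
  2:{ intros x Hx. rewrite Rmin_left, Rmax_right in Hx by lra.
      assert (u < f x) by (apply f_gt; lra). rewrite Rmax_right; lra. }
  apply is_RInt_unique.
  (* [K (f - u) - G] is a primitive of [k (f - u)], and [f = u] at both ends. *)
  replace (G (x1 u) - G (x2 u))
    with (minus (K (x2 u) * (f (x2 u) - u) - G (x2 u)) (K (x1 u) * (f (x1 u) - u) - G (x1 u))).
  2:{ rewrite f_x1, f_x2 by lra. unfold minus, plus, opp; simpl; ring. }
  apply (is_RInt_derive (fun x => K x * (f x - u) - G x)).
  - intros x _. auto_derive.
    + repeat split; eexists; [apply K_deriv|apply f_deriv|apply G_deriv].
    + replace (Derive (fun x => K x) x) with (k x) by (symmetry; apply is_derive_unique, K_deriv).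
      replace (Derive (fun x => f x) x) with (df x) by (symmetry; apply is_derive_unique, f_deriv).
      replace (Derive (fun x => G x) x) with (K x * df x) by (symmetry; apply is_derive_unique, G_deriv).
      ring.
  - intros x _. apply (continuous_mult (K := R_AbsRing)); [apply k_cont|].
    apply (continuous_minus (V := R_NormedModule)); [apply level_function_continuous|apply continuous_const].
Qed.

(** The substitution is [w = u + q^2]. Its kernel is singular at [w = u], but [A] vanishes on
    [[u, v1]], so the part of the integral near the singularity is dropped before substituting. *)
Lemma RInt_sqrt_integral_Abel u : v0 <= u < v1 -> v1 < M ->
  RInt (fun q => A (u + q * q)) 0 (sqrt (M - u)) = RInt (fun w => A w / (2 * sqrt (w - u))) v1 M.
Proof.
  intros Hu HvM.
  assert (Hcont : forall x, continuous (fun q => A (u + q * q)) x).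
  { intros x. apply (continuous_comp (fun q => u + q * q) A); [apply continuous_parabola|apply sqrt_integral_continuous]. }
  set (p := sqrt (v1 - u)). set (Q := sqrt (M - u)).
  assert (Hp : 0 < p) by (apply sqrt_lt_R0; lra).
  assert (HpQ : p < Q) by (apply sqrt_lt_1; lra).
  assert (Hpp : p * p = v1 - u) by (apply sqrt_sqrt; lra).
  assert (HQQ : Q * Q = M - u) by (apply sqrt_sqrt; lra).
  rewrite <- (RInt_Chasles (V := R_CompleteNormedModule) _ 0 p Q)
    by (apply ex_RInt_continuous_all, Hcont).
  rewrite (RInt_zero _ 0 p).
  2:{ intros x Hx. rewrite Rmin_left, Rmax_right in Hx by lra. apply sqrt_integral_zero. nra. }
  replace v1 with (u + p * p) at 1 by lra. replace M with (u + Q * Q) by lra.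
  rewrite <- (RInt_comp (V := R_CompleteNormedModule) (fun w => A w / (2 * sqrt (w - u)))
                (fun q => u + q * q) (fun q => 2 * q) p Q).
  - unfold plus; simpl. rewrite Rplus_0_l. apply RInt_ext.
    intros q Hq. rewrite Rmin_left, Rmax_right in Hq by lra.
    unfold scal; simpl; unfold mult; simpl.
    replace (u + q * q - u) with (q * q) by ring. rewrite sqrt_square by lra. field. lra.
  - intros q Hq. rewrite Rmin_left, Rmax_right in Hq by lra.
    apply continuous_Abel_kernel; [apply sqrt_integral_continuous|nra].
  - intros q _. split; [auto_derive; [trivial|ring]|].
    apply (continuous_mult (K := R_AbsRing)); [apply continuous_const|apply continuous_id].
Qed.

End OvalFamily.

(** * Identity theorem for real power series *)

Lemma CV_radius_ge_of_bounded (b : nat -> R) r C :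
  (forall n, Rabs (b n) * r ^ n <= C) -> 0 <= r -> Rbar_le r (CV_radius b).
Proof.
  intros Hb Hr. apply (proj1 (CV_radius_bounded b)). exists C. intros n.
  rewrite Rabs_mult, (Rabs_pos_eq (r ^ n)); [apply Hb|apply pow_le, Hr].
Qed.

Lemma bounded_of_CV_radius (b : nat -> R) r :
  0 <= r -> Rbar_lt r (CV_radius b) -> exists C, forall n, Rabs (b n) * r ^ n <= C.
Proof.
  intros Hr Hlt.
  destruct (filterlim_bounded (K := R_AbsRing) (V := R_NormedModule) (fun n => Rabs (b n * r ^ n)))
    as [C HC].
  - exists 0. apply ex_series_lim_0, CV_disk_inside. rewrite Rabs_pos_eq; assumption.
  - exists C. intros n. specialize (HC n). unfold norm in HC; simpl in HC; unfold abs in HC; simpl in HC.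
    rewrite Rabs_Rabsolu, Rabs_mult, (Rabs_pos_eq (r ^ n)) in HC; [exact HC|apply pow_le, Hr].
Qed.

Section IdentityTheorem.

Variables (b : nat -> R) (r C : R).
Hypothesis b_bound : forall n, Rabs (b n) * r ^ n <= C.

Lemma radius_lt x : Rabs x < r -> Rbar_lt (Rabs x) (CV_radius b).
Proof.
  intros Hx. apply Rbar_lt_le_trans with r; [exact Hx|].
  apply (CV_radius_ge_of_bounded b r C b_bound). pose proof (Rabs_pos x); lra.
Qed.

(* The [k]-th derivative is compared with the [k]-th term of the binomial expansion of [(|x| + h)^(j+k)]. *)
Lemma Derive_n_PSeries_bound r1 x h k : Rabs x + h <= r1 -> 0 < h -> r1 < r ->
  Rabs (Derive_n (PSeries b) k x) * h ^ k <= INR (Factorial.fact k) * (C / (1 - r1 / r)).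
Proof.
  intros Hx Hh Hr1. pose proof (Rabs_pos x) as Hx0.
  set (q := r1 / r).
  assert (Hq : 0 < q < 1). { unfold q. split; [apply Rdiv_lt_0_compat; lra|apply Rlt_div_l; lra]. }
  assert (HC : 0 <= C). { specialize (b_bound 0%nat). pose proof (Rabs_pos (b 0%nat)). simpl in *; lra. }
  assert (Hterm : forall j, Rabs (PS_derive_n k b j * x ^ j) * h ^ k <= INR (Factorial.fact k) * (C * q ^ j)).
  { intros j. unfold PS_derive_n.
    pose proof (INR_fact_lt_0 j). pose proof (INR_fact_lt_0 k). pose proof (INR_fact_lt_0 (j + k)).
    rewrite !Rabs_mult, <- RPow_abs. rewrite (Rabs_pos_eq (INR _ / INR _)).
    2:{ apply Rlt_le, Rdiv_lt_0_compat; assumption. }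
    assert (Hbin : Binomial.C (j + k) j * Rabs x ^ j * h ^ k <= (Rabs x + h) ^ (j + k)).
    { rewrite binomial.
      assert (Hpos : forall i, 0 <= Binomial.C (j + k) i * Rabs x ^ i * h ^ (j + k - i)).
      { intros i. apply Rmult_le_pos; [apply Rmult_le_pos|]; try (apply pow_le; lra).
        unfold Binomial.C. apply Rlt_le, Rdiv_lt_0_compat; [apply INR_fact_lt_0|].
        apply Rmult_lt_0_compat; apply INR_fact_lt_0. }
      replace (h ^ k) with (h ^ (j + k - j)) by (f_equal; lia).
      clear -Hpos. assert (H : forall n, (j <= n)%nat ->
        Binomial.C (j + k) j * Rabs x ^ j * h ^ (j + k - j) <=
        sum_f_R0 (fun i => Binomial.C (j + k) i * Rabs x ^ i * h ^ (j + k - i)) n).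
      { induction n as [|n IH]; intros Hn.
        - replace j with 0%nat by lia. simpl. lra.
        - rewrite tech5. destruct (Nat.eq_dec j (S n)) as [->|Hj].
          + pose proof (cond_pos_sum (fun i => Binomial.C (S n + k) i * Rabs x ^ i * h ^ (S n + k - i)) n Hpos).
            cbv beta in *; lra.
          + specialize (IH ltac:(lia)). specialize (Hpos (S n)). lra. }
      apply H. lia. }
    assert (Hpow : (Rabs x + h) ^ (j + k) <= r1 ^ (j + k)) by (apply pow_incr; lra).
    assert (Hq' : r1 ^ (j + k) = q ^ (j + k) * r ^ (j + k)).
    { rewrite <- Rpow_mult_distr. f_equal. unfold q. field. lra. }
    assert (Hqk : q ^ (j + k) <= q ^ j).
    { rewrite pow_add. rewrite <- (Rmult_1_r (q ^ j)) at 2.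
      apply Rmult_le_compat_l; [apply pow_le; lra|].
      rewrite <- (pow1 k). apply pow_incr. lra. }
    apply Rle_trans with (INR (Factorial.fact k) * (Rabs (b (j + k)%nat) * (Binomial.C (j + k) j * Rabs x ^ j * h ^ k))).
    { right. unfold Binomial.C. replace (j + k - j)%nat with k by lia. field. lra. }
    apply Rmult_le_compat_l; [lra|].
    apply Rle_trans with (Rabs (b (j + k)%nat) * r1 ^ (j + k)).
    { apply Rmult_le_compat_l; [apply Rabs_pos|lra]. }
    rewrite Hq'. specialize (b_bound (j + k)%nat).
    apply Rle_trans with (C * q ^ (j + k)).
    - replace (Rabs (b (j + k)%nat) * (q ^ (j + k) * r ^ (j + k)))
        with (Rabs (b (j + k)%nat) * r ^ (j + k) * q ^ (j + k)) by ring.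
      apply Rmult_le_compat_r; [apply pow_le; lra|exact b_bound].
    - apply Rmult_le_compat_l; assumption. }
  assert (Hgeom : is_series (fun j => / h ^ k * (INR (Factorial.fact k) * (C * q ^ j)))
                    (/ h ^ k * (INR (Factorial.fact k) * (C * / (1 - q))))).
  { do 3 apply (is_series_scal_l (K := R_AbsRing) (V := R_NormedModule)). apply is_series_geom.
    rewrite Rabs_pos_eq; lra. }
  assert (Hhk : 0 < h ^ k) by (apply pow_lt; lra).
  assert (Hle : forall j, 0 <= Rabs (PS_derive_n k b j * x ^ j) <= / h ^ k * (INR (Factorial.fact k) * (C * q ^ j))).
  { intros j. split; [apply Rabs_pos|]. apply Rmult_le_reg_r with (h ^ k); [exact Hhk|].
    eapply Rle_trans; [apply Hterm|]. right. field. lra. }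
  rewrite Derive_n_PSeries by (apply radius_lt; lra).
  apply Rle_trans with (/ h ^ k * (INR (Factorial.fact k) * (C * / (1 - q))) * h ^ k).
  2:{ right. unfold q. field. unfold q in Hq. split; [lra|]. split; [|lra].
      intros Hc. assert (r1 / r = 1) by (apply Rmult_eq_reg_r with r; [|lra]; unfold Rdiv; rewrite Rmult_assoc, Rinv_l; lra). lra. }
  apply Rmult_le_compat_r; [lra|].
  unfold PSeries. eapply Rle_trans; [apply Series_Rabs|].
  - apply (ex_series_le (K := R_AbsRing) (V := R_CompleteNormedModule) _ (fun j => / h ^ k * (INR (Factorial.fact k) * (C * q ^ j)))).
    + intros j. unfold norm; simpl; unfold abs; simpl. rewrite Rabs_Rabsolu. apply Hle.
    + eexists. exact Hgeom.
  - rewrite <- (is_series_unique _ _ Hgeom). apply Series_le; [apply Hle|]. eexists. exact Hgeom.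
Qed.

(* A zero of infinite order at [p] propagates over a distance bounded below independently of [p]. *)
Lemma PSeries_zero_right r1 p x h : r1 < r -> 0 < h ->
  (forall y, p <= y <= x -> Rabs y + h <= r1) -> p <= x <= p + h / 2 ->
  locally p (fun y => PSeries b y = 0) -> PSeries b x = 0.
Proof.
  intros Hr1 Hh Hr Hx Hp.
  destruct (Req_dec p x) as [<-|Hpx]; [exact (locally_singleton _ _ Hp)|].
  assert (Hpr : Rabs p < r) by (specialize (Hr p); lra).
  set (B := C / (1 - r1 / r)).
  assert (Hbound : forall n, Rabs (PSeries b x) <= B * (1 / 2) ^ n).
  { intros n.
    (* All Taylor coefficients at [p] vanish, so only the Lagrange remainder is left. Comparing
       [x - p <= h / 2] with the derivative bound in terms of [h] gives the factor [(1 / 2)^n]. *)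
    destruct (Taylor_Lagrange (PSeries b) n p x) as [z [Hz ->]]; [lra| |].
    - intros t Ht k _. apply ex_derive_n_PSeries, radius_lt. specialize (Hr t); lra.
    - rewrite (sum_eq _ (fun _ => 0)).
      2:{ intros i _. replace (Derive_n (PSeries b) i p) with 0; [ring|].
          rewrite (Derive_n_ext_loc _ (fun _ => 0)) by exact Hp.
          destruct i as [|i]; [reflexivity|]. symmetry. apply Derive_n_const. }
      rewrite sum_cte. rewrite Rmult_0_l, Rplus_0_l.
      pose proof (Derive_n_PSeries_bound r1 z h (S n) (Hr z ltac:(lra)) Hh Hr1) as HD.
      fold B in HD. pose proof (INR_fact_lt_0 (S n)) as Hf.
      rewrite Rabs_mult. unfold Rdiv at 1. rewrite Rabs_mult.
      rewrite (Rabs_pos_eq ((x - p) ^ S n)) by (apply pow_le; lra).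
      rewrite (Rabs_pos_eq (/ _)) by (apply Rlt_le, Rinv_0_lt_compat, Hf).
      set (D := Rabs (Derive_n (PSeries b) (S n) z)) in *.
      assert (HD0 : 0 <= D) by apply Rabs_pos.
      assert (Hpow : (x - p) ^ S n <= h ^ S n * (1 / 2) ^ S n).
      { rewrite <- Rpow_mult_distr. apply pow_incr. lra. }
      assert (HB : 0 <= B).
      { apply Rmult_le_reg_l with (INR (Factorial.fact (S n))); [exact Hf|]. rewrite Rmult_0_r.
        eapply Rle_trans; [|exact HD]. apply Rmult_le_pos; [exact HD0|apply pow_le; lra]. }
      assert (H2 : 0 <= (1 / 2) ^ n) by (apply pow_le; lra).
      assert (H3 : 0 <= (1 / 2) ^ S n) by (apply pow_le; lra).
      apply Rle_trans with (h ^ S n * (1 / 2) ^ S n * / INR (Factorial.fact (S n)) * D).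
      { apply Rmult_le_compat_r; [exact HD0|]. apply Rmult_le_compat_r; [|exact Hpow].
        apply Rlt_le, Rinv_0_lt_compat, Hf. }
      replace (h ^ S n * (1 / 2) ^ S n * / INR (Factorial.fact (S n)) * D)
        with ((1 / 2) ^ S n * (/ INR (Factorial.fact (S n)) * (D * h ^ S n))) by ring.
      apply Rle_trans with ((1 / 2) ^ S n * B).
      { apply Rmult_le_compat_l; [exact H3|].
        apply Rmult_le_reg_l with (INR (Factorial.fact (S n))); [exact Hf|].
        rewrite <- Rmult_assoc, Rinv_r, Rmult_1_l by lra. exact HD. }
      simpl. pose proof (Rmult_le_pos _ _ HB H2). lra. }
  assert (Hlim : is_lim_seq (fun n => B * (1 / 2) ^ n) 0).
  { replace (Finite 0) with (Rbar_mult B 0) by (simpl; f_equal; ring).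
    apply is_lim_seq_scal_l, is_lim_seq_geom. rewrite Rabs_pos_eq; lra. }
  assert (H0 : Rbar_le (Rabs (PSeries b x)) 0).
  { apply (is_lim_seq_le (fun _ => Rabs (PSeries b x)) (fun n => B * (1 / 2) ^ n));
    [exact Hbound|apply is_lim_seq_const|exact Hlim]. }
  simpl in H0. pose proof (Rabs_pos (PSeries b x)).
  destruct (Req_dec (PSeries b x) 0) as [E|E]; [exact E|].
  apply Rabs_pos_lt in E. lra.
Qed.

(** [PSeries_zero_right] only moves to the right, so the zero interval starts on the left of 0; it
    is prolonged in steps of [h / 4] until it covers a neighbourhood of 0, which determines the
    coefficients. *)
Lemma PSeries_zero_from_left al be : - r < al < be -> be <= 0 ->
  (forall x, al <= x <= be -> PSeries b x = 0) -> forall n, b n = 0.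
Proof.
  intros Hal Hbe Hz.
  (* [r1] is the midpoint of [- al] and [r]; [h] is chosen so that [Rabs y + h <= r1] whenever
     [Rabs y <= - al]. *)
  set (r1 := (r - al) / 2). set (h := Rmin (r1 + al) (- al)).
  assert (Hh : 0 < h) by (apply Rmin_glb_lt; unfold r1; lra).
  assert (Hh1 : h <= r1 + al) by apply Rmin_l.
  assert (Hh2 : h <= - al) by apply Rmin_r.
  assert (Hstep : forall n x, al <= x -> x <= - al -> x <= be + INR n * (h / 4) ->
            x <= h / 4 -> PSeries b x = 0).
  { induction n as [|n IH]; intros x Hx1 Hx2 Hx3 Hx4.
    - apply Hz. simpl in Hx3. lra.
    - rewrite S_INR in Hx3.
      destruct (Rle_dec x (be + INR n * (h / 4))) as [Hle|Hgt]; [apply IH; assumption|].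
      (* [c] is the end of the interval already covered, capped at 0. The base point [p] lies
         strictly inside that interval, since a whole neighbourhood of zeros is required, and within
         [h / 4] of [c], so that [x - p <= h / 2]. *)
      set (c := Rmin 0 (be + INR n * (h / 4))).
      assert (Hc1 : c <= 0) by apply Rmin_l.
      assert (Hc2 : c <= be + INR n * (h / 4)) by apply Rmin_r.
      assert (Hbc : be <= c).
      { apply Rmin_glb; [lra|]. pose proof (pos_INR n). nra. }
      assert (Hxc : x <= c + h / 4).
      { unfold c, Rmin. destruct Rle_dec; lra. }
      set (p := Rmax ((al + c) / 2) (c - h / 4)).
      assert (Hp1 : (al + c) / 2 <= p) by apply Rmax_l.
      assert (Hp2 : c - h / 4 <= p) by apply Rmax_r.
      assert (Hp3 : p < c) by (apply Rmax_lub_lt; lra).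
      apply (PSeries_zero_right r1 p x h); [unfold r1; lra|exact Hh| |lra|].
      + intros y Hy. assert (Rabs y <= - al) by (apply Rabs_le; lra). lra.
      + assert (Hpos : 0 < Rmin (p - al) (c - p)) by (apply Rmin_glb_lt; lra).
        exists (mkposreal _ Hpos).
        intros y Hy. unfold ball in Hy; simpl in Hy; unfold AbsRing_ball, abs, minus, plus, opp in Hy.
        simpl in Hy. apply Rabs_def2 in Hy.
        pose proof (Rmin_l (p - al) (c - p)). pose proof (Rmin_r (p - al) (c - p)).
        apply IH; lra. }
  destruct (archimed_cor1 (h / 4 / (- be + h / 4))) as [N [HN HN0]].
  { apply Rdiv_lt_0_compat; lra. }
  assert (HN' : 0 <= be + INR N * (h / 4) - h / 4).
  { assert (HNp : 0 < INR N) by (apply lt_0_INR, HN0).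
    apply Rlt_div_r in HN; [|lra].
    assert (/ INR N * (- be + h / 4) * INR N < h / 4 * INR N) by (apply Rmult_lt_compat_r; assumption).
    replace (/ INR N * (- be + h / 4) * INR N) with (- be + h / 4) in H by (field; lra). lra. }
  intros n.
  assert (Hr0 : Rbar_lt 0 (CV_radius b)).
  { rewrite <- Rabs_R0. apply radius_lt. rewrite Rabs_R0. lra. }
  assert (E : forall x, PSeries (fun _ => 0) x = 0).
  { intros x.
    change (Series (fun n => 0 * x ^ n) = 0).
    rewrite Series_scal_l. ring. }
  apply (PSeries_ext_recip b (fun _ => 0) n); [exact Hr0| |].
  - apply Rbar_lt_le_trans with 1; [simpl; lra|].
    apply (CV_radius_ge_of_bounded _ 1 0); [|lra]. intros m. rewrite Rabs_R0. lra.
  - exists (mkposreal (h / 4) ltac:(lra)). intros y Hy.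
    unfold ball in Hy; simpl in Hy; unfold AbsRing_ball, abs, minus, plus, opp in Hy.
    simpl in Hy. apply Rabs_def2 in Hy. rewrite E. apply (Hstep N); lra.
Qed.

End IdentityTheorem.

(** The reflection [x -> - x] moves the interval to the left of 0. *)
Lemma PSeries_identity (b : nat -> R) al be r : 0 <= al < be -> be < r -> Rbar_lt r (CV_radius b) ->
  (forall x, al <= x <= be -> PSeries b x = 0) -> forall n, b n = 0.
Proof.
  intros Hab Hr HR Hz n.
  destruct (bounded_of_CV_radius b r ltac:(lra) HR) as [C HC].
  assert (Hn : (-1) ^ n * b n = 0).
  { apply (PSeries_zero_from_left (fun n => (-1) ^ n * b n) r C) with (al := - be) (be := - al); try lra.
    - intros m. rewrite Rabs_mult, pow_1_abs, Rmult_1_l. apply HC.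
    - intros x Hx. rewrite <- (Hz (- x)) by lra. unfold PSeries. apply Series_ext. intros m.
      replace (- x) with (-1 * x) by ring. rewrite Rpow_mult_distr. ring. }
  apply Rmult_integral in Hn. destruct Hn as [Hn|Hn]; [|exact Hn].
  exfalso. revert Hn. apply pow_nonzero. lra.
Qed.

(** These are the Taylor coefficients [binom(2n, n) / 4^n] of [(1 - y)^(-1/2)]. *)
Fixpoint inv_sqrt_coef (n : nat) : R :=
  match n with
  | O => 1
  | S m => inv_sqrt_coef m * (2 * INR m + 1) / (2 * INR m + 2)
  end.

Lemma inv_sqrt_coef_S n :
  inv_sqrt_coef (S n) = inv_sqrt_coef n * (2 * INR n + 1) / (2 * INR n + 2).
Proof. reflexivity. Qed.

Lemma inv_sqrt_coef_bound n : 0 < inv_sqrt_coef n <= 1.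
Proof.
  induction n as [|n IH]; [simpl; lra|].
  simpl inv_sqrt_coef. pose proof (pos_INR n). split.
  - apply Rdiv_lt_0_compat; [apply Rmult_lt_0_compat|]; lra.
  - apply Rle_div_l; nra.
Qed.

Lemma inv_sqrt_coef_radius y : Rabs y < 1 -> Rbar_lt (Rabs y) (CV_radius inv_sqrt_coef).
Proof.
  intros Hy. apply Rbar_lt_le_trans with 1; [exact Hy|].
  apply (CV_radius_ge_of_bounded _ 1 1); [|lra]. intros n.
  pose proof (inv_sqrt_coef_bound n). rewrite pow1, Rabs_pos_eq; lra.
Qed.

(* The recursion for the coefficients says [2 (1 - y) B' = B], hence [(1 - y) B^2] is constant. *)
Lemma PSeries_inv_sqrt y : 0 <= y < 1 -> PSeries inv_sqrt_coef y = / sqrt (1 - y).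
Proof.
  intros Hy. set (B := PSeries inv_sqrt_coef).
  assert (HB : forall x, Rabs x < 1 -> is_derive B x (PSeries (PS_derive inv_sqrt_coef) x)).
  { intros x Hx. apply is_derive_PSeries, inv_sqrt_coef_radius, Hx. }
  assert (HD : forall x, Rabs x < 1 -> 2 * (1 - x) * PSeries (PS_derive inv_sqrt_coef) x = B x).
  { intros x Hx. set (D := PS_derive inv_sqrt_coef).
    assert (HexD : ex_pseries D x) by (apply ex_pseries_derive, inv_sqrt_coef_radius, Hx).
    assert (HexB : ex_pseries inv_sqrt_coef x)
      by (apply CV_radius_inside, inv_sqrt_coef_radius, Hx).
    assert (E : PSeries D x = PSeries (PS_plus (PS_incr_1 D) (PS_scal (1 / 2) inv_sqrt_coef)) x).
    { apply PSeries_ext. intros n. unfold D, PS_derive, PS_plus, PS_incr_1, PS_scal, plus, scal, mult, zero.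
      cbn -[INR inv_sqrt_coef]. rewrite inv_sqrt_coef_S, S_INR.
      destruct n as [|n]; [simpl; field|]. cbn -[INR inv_sqrt_coef].
      pose proof (pos_INR (S n)). field. lra. }
    rewrite PSeries_plus, PSeries_incr_1, PSeries_scal in E.
    - fold B in E. lra.
    - apply ex_pseries_incr_1, HexD.
    - apply ex_pseries_scal; [apply Rmult_comm|exact HexB]. }
  assert (HBc : B y ^ 2 * (1 - y) = 1).
  { destruct (MVT_gen (fun x => B x ^ 2 * (1 - x)) 0 y (fun _ => 0)) as [c [_ Hc]].
    - intros x Hx. rewrite Rmin_left, Rmax_right in Hx by lra.
      assert (Hx1 : Rabs x < 1) by (rewrite Rabs_pos_eq; lra).
      pose proof (HB x Hx1) as HBx. specialize (HD x Hx1).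
      auto_derive; [eexists; exact HBx|].
      replace (Derive (fun x => B x) x) with (PSeries (PS_derive inv_sqrt_coef) x)
        by (symmetry; apply is_derive_unique, HBx).
      rewrite <- HD. ring.
    - intros x Hx. rewrite Rmin_left, Rmax_right in Hx by lra.
      assert (Hx1 : Rabs x < 1) by (rewrite Rabs_pos_eq; lra).
      apply continuity_pt_filterlim, (ex_derive_continuous (fun x => B x ^ 2 * (1 - x))).
        pose proof (HB x Hx1) as HBx. auto_derive. eexists; exact HBx.
    - unfold B in Hc at 2. rewrite PSeries_0 in Hc. simpl in Hc. simpl. lra. }
  (* Positivity of the coefficients selects the positive one of the two square roots of
     [1 / (1 - y)]. *)
  assert (HB0 : 0 <= B y).
  { unfold B, PSeries. replace 0 with (Series (fun _ : nat => 0 * 1)).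
    - apply Series_le.
      + intros n. pose proof (inv_sqrt_coef_bound n). split; [lra|].
        rewrite Rmult_0_l. apply Rmult_le_pos; [lra|apply pow_le; lra].
      + destruct (CV_radius_inside inv_sqrt_coef y) as [l Hl].
        * apply inv_sqrt_coef_radius. rewrite Rabs_pos_eq; lra.
        * exists l. apply is_pseries_R in Hl. exact Hl.
    - rewrite Series_scal_l. ring. }
  assert (Hs : 0 < sqrt (1 - y)) by (apply sqrt_lt_R0; lra).
  assert (Hss : sqrt (1 - y) * sqrt (1 - y) = 1 - y) by (apply sqrt_sqrt; lra).
  assert (E : B y * sqrt (1 - y) = 1).
  { assert (H : (B y * sqrt (1 - y)) * (B y * sqrt (1 - y)) = 1).
    { transitivity (B y ^ 2 * (sqrt (1 - y) * sqrt (1 - y))); [ring|]. rewrite Hss. exact HBc. }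
    assert (0 <= B y * sqrt (1 - y)) by (apply Rmult_le_pos; lra). nra. }
  apply Rmult_eq_reg_r with (sqrt (1 - y)); [|lra]. rewrite E. field. lra.
Qed.

(** All coefficients lie in [(0, 1]], so a geometric series dominates the tail, uniformly for
    [y <= q]. *)
Lemma inv_sqrt_tail N q y : 0 <= y <= q -> q < 1 ->
  Rabs (/ sqrt (1 - y) - sum_f_R0 (fun j => inv_sqrt_coef j * y ^ j) N) <= q ^ S N / (1 - q).
Proof.
  intros Hy Hq. rewrite <- PSeries_inv_sqrt by lra.
  assert (Hy1 : Rabs y < 1) by (rewrite Rabs_pos_eq; lra).
  rewrite (PSeries_decr_n inv_sqrt_coef N y)
    by (apply CV_radius_inside, inv_sqrt_coef_radius, Hy1).
  match goal with |- Rabs (?a + ?b - ?a) <= _ => replace (a + b - a) with b by ring end.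
  rewrite Rabs_mult, (Rabs_pos_eq (y ^ S N)) by (apply pow_le; lra).
  assert (Hg : is_series (fun j => q ^ j) (/ (1 - q))) by (apply is_series_geom; rewrite Rabs_pos_eq; lra).
  assert (Hle : forall j, 0 <= Rabs (PS_decr_n inv_sqrt_coef (S N) j * y ^ j) <= q ^ j).
  { intros j. split; [apply Rabs_pos|]. unfold PS_decr_n.
    pose proof (inv_sqrt_coef_bound (S N + j)).
    rewrite Rabs_pos_eq by (apply Rmult_le_pos; [lra|apply pow_le; lra]).
    assert (y ^ j <= q ^ j) by (apply pow_incr; lra).
    assert (0 <= y ^ j) by (apply pow_le; lra). nra. }
  apply Rmult_le_compat; [apply pow_le; lra|apply Rabs_pos|apply pow_incr; lra|].
  rewrite <- (is_series_unique _ _ Hg). unfold PSeries.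
  eapply Rle_trans; [apply Series_Rabs|apply Series_le; [exact Hle|eexists; exact Hg]].
  apply (ex_series_le (K := R_AbsRing) (V := R_CompleteNormedModule) _ (fun j => q ^ j)).
  - intros j. unfold norm; simpl; unfold abs; simpl. rewrite Rabs_Rabsolu. apply Hle.
  - eexists; exact Hg.
Qed.

(** * Expansion of the Abel integral in powers of [1 / (M - u)] *)

Section AbelKernelExpansion.

Variables (A : R -> R) (v1 M : R).
Hypothesis A_cont : forall x, continuous A x.
Hypothesis v1M : v1 < M.

(** With [s = 1 / (M - u)] one has [w - u = (1 - (M - w) s) / s], so the kernel
    [1 / (2 sqrt (w - u))] is [sqrt s / 2] times the binomial series at [(M - w) s]; this is the
    coefficient of [s^j] after integration. *)
Definition Abel_coef (j : nat) : R :=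
  inv_sqrt_coef j / 2 * RInt (fun w => A w * (M - w) ^ j) v1 M.

Lemma moment_cont j x : continuous (fun w => A w * (M - w) ^ j) x.
Proof.
  apply (continuous_mult (K := R_AbsRing)); [apply A_cont|].
  apply (ex_derive_continuous (fun w => (M - w) ^ j)). auto_derive. trivial.
Qed.

Lemma A_bounded : exists C, 0 <= C /\ forall w, v1 <= w <= M -> Rabs (A w) <= C.
Proof.
  destruct (continuity_ab_maj (fun w => Rabs (A w)) v1 M) as [m [Hm _]]; [lra| |].
  - intros c _. apply continuity_pt_filterlim, (continuous_comp A Rabs); [apply A_cont|apply continuous_Rabs].
  - exists (Rabs (A m)). split; [apply Rabs_pos|exact Hm].
Qed.

(** On the domain of integration [M - w <= M - v1], so the moments grow at most like [(M - v1)^n].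
    The disk therefore contains every [s = 1 / (M - u)] with [u < v1]: this is the gain from
    starting the integral at [v1]. *)
Lemma Abel_coef_radius : Rbar_le (/ (M - v1)) (CV_radius Abel_coef).
Proof.
  destruct A_bounded as [C [HC HA]].
  apply (CV_radius_ge_of_bounded _ _ ((M - v1) * C)).
  2:{ apply Rlt_le, Rinv_0_lt_compat; lra. }
  intros n. unfold Abel_coef. rewrite Rabs_mult.
  pose proof (inv_sqrt_coef_bound n).
  rewrite (Rabs_pos_eq (_ / 2)) by lra.
  assert (HI : Rabs (RInt (fun w => A w * (M - w) ^ n) v1 M) <= (M - v1) * (C * (M - v1) ^ n)).
  { apply abs_RInt_le_const; [lra|apply ex_RInt_continuous_all, moment_cont|].
    intros t Ht. rewrite Rabs_mult. apply Rmult_le_compat; [apply Rabs_pos|apply Rabs_pos|apply HA, Ht|].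
    rewrite Rabs_pos_eq by (apply pow_le; lra). apply pow_incr; lra. }
  rewrite pow_inv.
  assert (Hp : 0 < (M - v1) ^ n) by (apply pow_lt; lra).
  apply Rle_div_l; [exact Hp|].
  set (I := Rabs (RInt _ _ _)) in *. assert (0 <= I) by apply Rabs_pos. nra.
Qed.

(** Sum and integral are exchanged for partial sums only; the continuity statement is carried along
    because the induction needs integrability. *)
Lemma sum_Abel_coef N s :
  sum_f_R0 (fun j => Abel_coef j * s ^ j) N =
  RInt (fun w => A w / 2 * sum_f_R0 (fun j => inv_sqrt_coef j * ((M - w) * s) ^ j) N) v1 M
  /\ forall x, continuous (fun w => A w / 2 * sum_f_R0 (fun j => inv_sqrt_coef j * ((M - w) * s) ^ j) N) x.
Proof.
  assert (Hc : forall j x, continuous (fun w => A w / 2 * (inv_sqrt_coef j * ((M - w) * s) ^ j)) x).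
  { intros j x. apply (continuous_mult (K := R_AbsRing) (fun w => A w / 2)).
    - apply (continuous_mult (K := R_AbsRing) A); [apply A_cont|apply continuous_const].
    - apply (ex_derive_continuous (fun w => inv_sqrt_coef j * ((M - w) * s) ^ j)). auto_derive. trivial. }
  assert (Hterm : forall j, Abel_coef j * s ^ j =
            RInt (fun w => A w / 2 * (inv_sqrt_coef j * ((M - w) * s) ^ j)) v1 M).
  { intros j. unfold Abel_coef.
    rewrite (RInt_ext (fun w => A w / 2 * _)
               (fun w => scal (inv_sqrt_coef j / 2 * s ^ j) (A w * (M - w) ^ j))).
    - rewrite (RInt_scal (V := R_CompleteNormedModule)) by (apply ex_RInt_continuous_all, moment_cont).
      unfold scal; simpl; unfold mult; simpl. ring.
    - intros w _. rewrite Rpow_mult_distr. unfold scal; simpl; unfold mult; simpl. field. }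
  induction N as [|N [IH1 IH2]].
  - simpl sum_f_R0. split; [apply (Hterm 0%nat)|apply (Hc 0%nat)].
  - split.
    + rewrite tech5, IH1, Hterm.
      rewrite <- (RInt_plus (V := R_CompleteNormedModule))
        by (apply ex_RInt_continuous_all; intros; first [apply IH2|apply Hc]).
      apply RInt_ext. intros w _. rewrite tech5. unfold plus; simpl. ring.
    + intros x. apply (continuous_ext (fun w => plus
        (A w / 2 * sum_f_R0 (fun j => inv_sqrt_coef j * ((M - w) * s) ^ j) N)
        (A w / 2 * (inv_sqrt_coef (S N) * ((M - w) * s) ^ S N)))).
      * intros w. rewrite tech5. unfold plus; simpl. ring.
      * apply (continuous_plus (V := R_NormedModule)); [apply IH2|apply Hc].
Qed.

(** For [w] in [[v1, M]] one has [(M - w) s <= q < 1], so the kernel series converges uniformly and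
    the partial sums of [sum_Abel_coef] converge to the integral. *)
Lemma RInt_Abel_kernel u : u < v1 ->
  RInt (fun w => A w / (2 * sqrt (w - u))) v1 M = sqrt (/ (M - u)) * PSeries Abel_coef (/ (M - u)).
Proof.
  intros Hu. set (s := / (M - u)). set (q := (M - v1) * s).
  assert (Hs : 0 < s) by (apply Rinv_0_lt_compat; lra).
  assert (Hq : 0 < q < 1).
  { unfold q, s. split; [apply Rmult_lt_0_compat; [lra|exact Hs]|]. apply Rlt_div_l; lra. }
  assert (Hrs : 0 < sqrt s) by (apply sqrt_lt_R0, Hs).
  assert (Hker : forall w, v1 <= w <= M -> / sqrt (w - u) = sqrt s * / sqrt (1 - (M - w) * s)).
  { intros w Hw.
    assert (Hw1 : 0 <= 1 - (M - w) * s).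
    { assert ((M - w) * s <= q) by (apply Rmult_le_compat_r; lra). lra. }
    assert (Hus : 0 < M - u) by lra.
    replace (w - u) with (/ s * (1 - (M - w) * s)) by (unfold s; field; lra).
    rewrite sqrt_mult; [|apply Rlt_le, Rinv_0_lt_compat, Hs|exact Hw1].
    rewrite sqrt_inv, Rinv_mult, Rinv_inv. reflexivity. }
  set (I := RInt (fun w => A w / (2 * sqrt (w - u))) v1 M : R).
  assert (HexI : ex_RInt (fun w => A w / (2 * sqrt (w - u))) v1 M).
  { apply (ex_RInt_continuous (V := R_CompleteNormedModule)). intros z Hz.
    rewrite Rmin_left, Rmax_right in Hz by lra. apply continuous_Abel_kernel; [apply A_cont|lra]. }
  destruct A_bounded as [C [HC HA]].
  assert (Hdiff : forall N, Rabs (sum_f_R0 (fun j => Abel_coef j * s ^ j) N - I / sqrt s)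
                   <= (M - v1) * C / (1 - q) * q ^ S N).
  { intros N. destruct (sum_Abel_coef N s) as [E Hc]. rewrite E.
    replace (I / sqrt s) with (RInt (fun w => scal (/ sqrt s) (A w / (2 * sqrt (w - u)))) v1 M).
    2:{ rewrite (RInt_scal (V := R_CompleteNormedModule)) by exact HexI.
        unfold scal; simpl; unfold mult; simpl. unfold I. field. lra. }
    rewrite <- (RInt_minus (V := R_CompleteNormedModule));
      [|apply ex_RInt_continuous_all, Hc|apply (ex_RInt_scal (V := R_CompleteNormedModule)), HexI].
    replace ((M - v1) * C / (1 - q) * q ^ S N) with ((M - v1) * (C * (q ^ S N / (1 - q)))) by (field; lra).
    apply abs_RInt_le_const; [lra| |].
    - apply (ex_RInt_minus (V := R_CompleteNormedModule));
      [apply ex_RInt_continuous_all, Hc|apply (ex_RInt_scal (V := R_CompleteNormedModule)), HexI].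
    - intros w Hw.
      assert (Hy : 0 <= (M - w) * s <= q).
      { split; [apply Rmult_le_pos; lra|apply Rmult_le_compat_r; lra]. }
      pose proof (inv_sqrt_tail N q _ Hy ltac:(lra)) as HT.
      set (S1 := sum_f_R0 (fun j => inv_sqrt_coef j * ((M - w) * s) ^ j) N) in *.
      change (Rabs (A w / 2 * S1 - / sqrt s * (A w / (2 * sqrt (w - u)))) <= C * (q ^ S N / (1 - q))).
      assert (Hwu : 0 < sqrt (w - u)) by (apply sqrt_lt_R0; lra).
      replace (/ sqrt s * (A w / (2 * sqrt (w - u)))) with (A w / 2 * / sqrt (1 - (M - w) * s)).
      2:{ assert (E2 : / sqrt (1 - (M - w) * s) = / sqrt s * / sqrt (w - u)).
          { rewrite (Hker w Hw). field. split; [|lra].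
            assert (0 < sqrt (1 - (M - w) * s)) by (apply sqrt_lt_R0; lra). lra. }
          rewrite E2. field. lra. }
      rewrite <- Rmult_minus_distr_l, Rabs_mult, (Rabs_minus_sym S1).
      apply Rmult_le_compat; [apply Rabs_pos|apply Rabs_pos| |exact HT].
      unfold Rdiv. rewrite Rabs_mult, (Rabs_pos_eq (/ 2)) by lra.
      specialize (HA w Hw). pose proof (Rabs_pos (A w)). lra. }
  assert (HP : is_pseries Abel_coef s (I / sqrt s)).
  { apply is_pseries_R. apply is_series_Reals. intros eps Heps.
    assert (Hlim : is_lim_seq (fun n => (M - v1) * C / (1 - q) * q ^ S n) 0).
    { replace (Finite 0) with (Rbar_mult ((M - v1) * C / (1 - q)) 0) by (simpl; f_equal; ring).
      apply is_lim_seq_scal_l. apply (is_lim_seq_incr_1 (fun n => q ^ n)), is_lim_seq_geom.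
      rewrite Rabs_pos_eq; lra. }
    apply is_lim_seq_spec in Hlim. destruct (Hlim (mkposreal eps Heps)) as [N HN].
    exists N. intros n Hn. unfold R_dist. eapply Rle_lt_trans; [apply Hdiff|].
    specialize (HN n Hn). simpl in HN. rewrite Rminus_0_r in HN.
    eapply Rle_lt_trans; [apply Rle_abs|exact HN]. }
  rewrite (is_pseries_unique _ _ _ HP). change (I = sqrt s * (I / sqrt s) :> R). field. lra.
Qed.

End AbelKernelExpansion.

(** Squaring turns the factor [sqrt s] of [RInt_Abel_kernel] into [s], so the right-hand side is a
    convergent power series in [s] without constant term. *)
Lemma oval_family_expansion (f df k K G x1 x2 : R -> R) (v0 v1 : R) :
  (forall x, is_derive f x (df x)) -> (forall x, is_derive K x (k x)) ->
  (forall x, is_derive G x (K x * df x)) -> (forall x, continuous k x) ->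
  v0 < v1 ->
  (forall u, v0 <= u <= v1 -> limit1_in x1 (fun v => v0 <= v <= v1) (x1 u) u) ->
  (forall u, v0 <= u <= v1 -> limit1_in x2 (fun v => v0 <= v <= v1) (x2 u) u) ->
  (forall u, v0 <= u <= v1 -> x1 u < x2 u) ->
  (forall u, v0 <= u <= v1 -> f (x1 u) = u) ->
  (forall u, v0 <= u <= v1 -> f (x2 u) = u) ->
  (forall u, v0 <= u <= v1 -> forall x, x1 u < x < x2 u -> u < f x) ->
  (forall u, v0 <= u <= v1 -> RInt (fun x => k x * sqrt (f x - u)) (x1 u) (x2 u) = 0) ->
  exists (M : R) (e : nat -> R), v1 < M /\ Rbar_le (/ (M - v1)) (CV_radius e) /\
    forall u, v0 <= u < v1 ->
      (G (x1 u) - G (x2 u)) ^ 2 = / (M - u) * PSeries e (/ (M - u)) ^ 2.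
Proof.
  intros Hf HK HG Hk Hv Hc1 Hc2 H12 Hf1 Hf2 Hgt HI.
  assert (Hab : x1 v0 < x2 v0) by (apply H12; lra).
  destruct (continuity_ab_maj f (x1 v0) (x2 v0)) as [m [Hm _]]; [lra| |].
  { intros c _. apply continuity_pt_filterlim, (ex_derive_continuous f). exists (df c). apply Hf. }
  (* [f m] is the maximum of [f] on the widest oval; [v1 + 1] makes [v1 < M] immediate. *)
  set (M := Rmax (f m) (v1 + 1)).
  assert (HM : v1 < M) by (unfold M; pose proof (Rmax_r (f m) (v1 + 1)); lra).
  assert (HfM : forall x, x1 v0 <= x <= x2 v0 -> f x <= M).
  { intros x Hx. eapply Rle_trans; [apply Hm, Hx|apply Rmax_l]. }
  set (A := fun w : R => RInt (fun x => k x * sqrt (f x - w)) (x1 v0) (x2 v0) : R).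
  assert (HA : forall w, continuous A w) by (intros w; eapply sqrt_integral_continuous; eassumption).
  pose proof quarter_disk_pos as Hqd.
  exists M, (PS_scal (/ quarter_disk) (Abel_coef A v1 M)).
  assert (Hrad : Rbar_le (/ (M - v1)) (CV_radius (Abel_coef A v1 M)))
    by (apply Abel_coef_radius; assumption).
  split; [exact HM|]. split.
  - rewrite CV_radius_scal; [exact Hrad|]. apply Rinv_neq_0_compat; lra.
  - intros u Hu.
    assert (E : quarter_disk * (G (x1 u) - G (x2 u))
                = sqrt (/ (M - u)) * PSeries (Abel_coef A v1 M) (/ (M - u))).
    { rewrite <- RInt_Abel_kernel by (assumption || lra).
      rewrite <- (RInt_sqrt_integral_parabola f df k K G x1 x2 v0 v1) with (M := M) by assumption.
      eapply RInt_sqrt_integral_Abel; eassumption. }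
    rewrite PSeries_scal.
    assert (Hs : sqrt (/ (M - u)) * sqrt (/ (M - u)) = / (M - u)).
    { apply sqrt_sqrt, Rlt_le, Rinv_0_lt_compat; lra. }
    replace (G (x1 u) - G (x2 u)) with (/ quarter_disk * (quarter_disk * (G (x1 u) - G (x2 u)))) by (field; lra).
    rewrite E. set (P := PSeries _ _). set (c := sqrt _) in *. clearbody P c.
    transitivity (c * c * (/ quarter_disk * P) ^ 2); [ring|]. rewrite Hs. reflexivity.
Qed.

End AbelInversion.

From HB Require Import structures.
From mathcomp Require Import all_boot all_order all_algebra all_solvable.
From mathcomp Require Import generic_quotient fraction separable cyclotomic.
From mathcomp Require Import boolp Rstruct complex ring zify.
Require Import Defs.

Set Implicit Arguments.
Unset Strict Implicit.
Unset Printing Implicit Defensive.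

Import Order.TTheory GRing.Theory Num.Theory.
Local Open Scope ring_scope.

Local Notation "x %:F" := (FracField.tofrac x).

(** * Formal power series *)

Definition fps (F : fieldType) := nat -> F.

Section FpsRing.

Variable F : fieldType.
Implicit Types a b c : fps F.

HB.instance Definition _ := gen_eqMixin (fps F).
HB.instance Definition _ := gen_choiceMixin (fps F).

Definition fps_add a b : fps F := fun n => a n + b n.
Definition fps_opp a : fps F := fun n => - a n.
Definition fps_zero : fps F := fun _ => 0.
Definition fps_mul a b : fps F := fun n => \sum_(i < n.+1) a i * b (n - i)%N.
Definition fps_C (x : F) : fps F := fun n => x *+ (n == 0)%N.

Let fps_addA : associative fps_add.
Proof. by move=> a b c; apply/funext => n; rewrite /fps_add addrA. Qed.
Let fps_addC : commutative fps_add.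
Proof. by move=> a b; apply/funext => n; rewrite /fps_add addrC. Qed.
Let fps_add0 : left_id fps_zero fps_add.
Proof. by move=> a; apply/funext => n; rewrite /fps_add add0r. Qed.
Let fps_addN : left_inverse fps_zero fps_opp fps_add.
Proof. by move=> a; apply/funext => n; rewrite /fps_add addNr. Qed.

HB.instance Definition _ := GRing.isZmodule.Build (fps F) fps_addA fps_addC fps_add0 fps_addN.

Definition fps_trunc N a := \poly_(i < N) a i.

Lemma coef_mul_agree (p p' q q' : {poly F}) N :
  (forall i, (i < N)%N -> p`_i = p'`_i) -> (forall i, (i < N)%N -> q`_i = q'`_i) ->
  forall i, (i < N)%N -> (p * q)`_i = (p' * q')`_i.
Proof.
move=> Ep Eq i iN; rewrite !coefM; apply: eq_bigr => j _.
by rewrite Ep ?Eq // (leq_ltn_trans _ iN) // ?leq_subr // -ltnS.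
Qed.

(** Coefficients of a product below [N] only depend on the truncations at [N], so commutativity and
    associativity are inherited from polynomials. *)
Lemma fps_mul_trunc N a b n : (n < N)%N -> fps_mul a b n = (fps_trunc N a * fps_trunc N b)`_n.
Proof.
move=> nN; rewrite coefM; apply: eq_bigr => i _; rewrite !coef_poly.
by rewrite !(leq_ltn_trans _ nN) // ?leq_subr // -ltnS.
Qed.

Lemma fps_trunc_mul N a b i : (i < N)%N ->
  (fps_trunc N (fps_mul a b))`_i = (fps_trunc N a * fps_trunc N b)`_i.
Proof. by move=> iN; rewrite coef_poly iN (fps_mul_trunc _ _ iN). Qed.

Let fps_mulC : commutative fps_mul.
Proof. by move=> a b; apply/funext => n; rewrite !(fps_mul_trunc _ _ (ltnSn n)) mulrC. Qed.

Let fps_mulA : associative fps_mul.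
Proof.
move=> a b c; apply/funext => n; rewrite !(fps_mul_trunc _ _ (ltnSn n)).
transitivity (fps_trunc n.+1 a * (fps_trunc n.+1 b * fps_trunc n.+1 c))`_n.
  by apply: (@coef_mul_agree _ _ _ _ n.+1) => // i; apply: fps_trunc_mul.
rewrite mulrA; apply: (@coef_mul_agree _ _ _ _ n.+1) => // i iN.
by rewrite fps_trunc_mul.
Qed.

Let fps_mul1 : left_id (fps_C 1) fps_mul.
Proof.
move=> a; apply/funext => n; rewrite /fps_mul big_ord_recl /= subn0 mul1r.
by rewrite big1 ?addr0 // => i _; rewrite /fps_C /= mul0r.
Qed.

Let fps_mulDl : left_distributive fps_mul fps_add.
Proof.
move=> a b c; apply/funext => n; rewrite /fps_mul /fps_add -big_split /=.
by apply: eq_bigr => i _; rewrite mulrDl.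
Qed.

Let fps_1_neq0 : fps_C 1 != fps_zero.
Proof. by apply/eqP => /(congr1 (@^~ 0%N)) /eqP; rewrite /fps_C /= mulr1n oner_eq0. Qed.

HB.instance Definition _ :=
  GRing.Zmodule_isComNzRing.Build (fps F) fps_mulA fps_mulC fps_mul1 fps_mulDl fps_1_neq0.

Lemma fps_addE a b n : (a + b) n = a n + b n. Proof. by []. Qed.
Lemma fps_oppE a n : (- a) n = - a n. Proof. by []. Qed.
Lemma fps_zeroE n : (0 : fps F) n = 0. Proof. by []. Qed.
Lemma fps_mulE a b n : (a * b) n = \sum_(i < n.+1) a i * b (n - i)%N. Proof. by []. Qed.
Lemma fps_sumE (I : Type) (r : seq I) (P : pred I) (G : I -> fps F) n :
  (\sum_(i <- r | P i) G i) n = \sum_(i <- r | P i) G i n.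
Proof. by apply: (big_morph (fun a : fps F => a n)). Qed.

(** Units and inverses are taken by classical choice, to supply the unit ring structure on which
    that of an integral domain is built. *)
Definition fps_unit : pred (fps F) := fun a => `[< exists b, b * a = 1 >].
Definition fps_inv a : fps F := if pselect (exists b, b * a = 1) is left h then sval (cid h) else a.

Let fps_mulV : {in fps_unit, left_inverse 1 fps_inv *%R}.
Proof.
move=> a; rewrite unfold_in => /asboolP ha; rewrite /fps_inv.
by case: pselect => // h; case: cid.
Qed.

Let fps_unitP a b : b * a = 1 -> fps_unit a.
Proof. by move=> ba; apply/asboolP; exists b. Qed.

Let fps_inv_out : {in [predC fps_unit], fps_inv =1 id}.
Proof.
move=> a; rewrite inE => /asboolPn ha; rewrite /fps_inv.
by case: pselect.
Qed.

HB.instance Definition _ :=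
  GRing.ComNzRing_hasMulInverse.Build (fps F) fps_mulV fps_unitP fps_inv_out.

Definition fps_Xn k : fps F := fun n => (n == k)%:R.

Lemma fps_XnME k a n : (fps_Xn k * a) n = if (n < k)%N then 0 else a (n - k)%N.
Proof.
rewrite fps_mulE; case: ltnP => nk.
  by rewrite big1 // => i _; rewrite /fps_Xn ltn_eqF ?mul0r // (leq_trans _ nk).
rewrite (bigD1 (Ordinal (nk : (k < n.+1)%N))) //= /fps_Xn eqxx mul1r.
by rewrite big1 ?addr0 // => i; rewrite -val_eqE => /negPf /= ->; rewrite mul0r.
Qed.

Lemma fps_XnD k l : fps_Xn k * fps_Xn l = fps_Xn (k + l)%N.
Proof.
apply/funext => n; rewrite fps_XnME /fps_Xn; case: ltnP => nk.
  by rewrite ltn_eqF // (leq_trans nk) // leq_addr.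
by rewrite -(eqn_add2l k) subnKC.
Qed.

Lemma fps_Xn_exp k m : fps_Xn k ^+ m = fps_Xn (k * m)%N.
Proof.
elim: m => [|m IH]; last by rewrite exprS IH fps_XnD mulnS.
by rewrite muln0; apply/funext => -[|n].
Qed.

Lemma fps_Xn_neq0 k : fps_Xn k != 0.
Proof. by apply/eqP => /(congr1 (@^~ k)) /eqP; rewrite /fps_Xn eqxx oner_eq0. Qed.

Lemma fps_factor a : a != 0 -> exists k b, a = fps_Xn k * b /\ b 0%N != 0.
Proof.
move=> a0; have ex : exists n, a n != 0.
  apply: contrapT => h; case/eqP: a0; apply/funext => n.
  by apply/eqP; apply: contrapT => hn; apply: h; exists n; apply/negP.
case: (ex_minnP ex) => k ak kmin; exists k, (fun n => a (k + n)%N); split; last by rewrite addn0.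
apply/funext => n; rewrite fps_XnME; case: ltnP => [nk|kn]; last by rewrite subnKC.
by apply/eqP; apply: contraLR nk => /kmin; rewrite -leqNgt.
Qed.

Lemma fps_mul0E a b : (a * b) 0%N = a 0%N * b 0%N.
Proof. by rewrite fps_mulE big_ord1 subn0. Qed.

(** The lowest nonzero coefficients of the two factors multiply to a nonzero coefficient of the
    product. *)
Let fps_integral a b : a * b = 0 -> (a == 0) || (b == 0).
Proof.
move=> ab; apply/orP; case: (eqVneq a 0) => [_|/fps_factor[k [a' [Ea a0]]]]; first by left.
right; apply: contraT => /fps_factor[l [b' [Eb b0]]].
move/(congr1 (@^~ (k + l)%N)): ab; rewrite Ea Eb mulrACA fps_XnD fps_XnME ltnn subnn.
by rewrite fps_mul0E => /eqP; rewrite mulf_eq0 (negPf a0) (negPf b0).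
Qed.

HB.instance Definition _ := GRing.ComUnitRing_isIntegral.Build (fps F) fps_integral.

Let fps_C_zmod : zmod_morphism fps_C.
Proof. by move=> x y; apply/funext => n; rewrite /fps_C mulrnBl. Qed.
Let fps_C_monoid : monoid_morphism fps_C.
Proof.
split => // x y; apply/funext => n; rewrite fps_mulE /fps_C big_ord_recl /= subn0.
rewrite big1 => [|i _]; last by rewrite mulr0n mul0r.
by rewrite addr0 mulr1n mulrnAr.
Qed.
HB.instance Definition _ := GRing.isZmodMorphism.Build F (fps F) fps_C fps_C_zmod.
HB.instance Definition _ := GRing.isMonoidMorphism.Build F (fps F) fps_C fps_C_monoid.

Lemma fps_CME x a n : (fps_C x * a) n = x * a n.
Proof.
rewrite fps_mulE big_ord_recl /= subn0 big1 ?addr0 // => i _.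
by rewrite /fps_C mulr0n mul0r.
Qed.

Definition fps_coef0 (a : fps F) : F := a 0%N.
Let coef0_zmod : zmod_morphism fps_coef0. Proof. by []. Qed.
Let coef0_monoid : monoid_morphism fps_coef0.
Proof. by split => // a b; apply: fps_mul0E. Qed.
HB.instance Definition _ := GRing.isZmodMorphism.Build (fps F) F fps_coef0 coef0_zmod.
HB.instance Definition _ := GRing.isMonoidMorphism.Build (fps F) F fps_coef0 coef0_monoid.

End FpsRing.

(** * Hensel's lemma for power series *)

Section Hensel.

Variable F : fieldType.
Implicit Types (a b : fps F) (p : {poly fps F}).

Definition fps_agree l a b := forall i, (i <= l)%N -> a i = b i.

Lemma fps_agree_horner l p a b : fps_agree l a b -> fps_agree l p.[a] p.[b].
Proof.
move=> ab; elim/poly_ind: p => [|p c IH] i il; first by rewrite !horner0.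
rewrite !hornerMXaddC !fps_addE; congr (_ + _); rewrite !fps_mulE.
apply: eq_bigr => j _; congr (_ * _); [apply: IH|apply: ab].
  by rewrite (leq_trans _ il) // -ltnS.
by rewrite (leq_trans (leq_subr _ _)).
Qed.

Lemma horner_Taylor2 (R : comNzRingType) (p : {poly R}) x h :
  exists q, p.[x + h] = p.[x] + p^`().[x] * h + q * h ^+ 2.
Proof.
elim/poly_ind: p => [|p c [q Eq]]; first by exists 0; rewrite deriv0 !horner0 !mul0r !addr0.
exists (q * (x + h) + p^`().[x]).
rewrite derivMXaddC !hornerMXaddC Eq hornerD hornerMX.
by ring.
Qed.

Lemma hensel p (y0 : F) :
  p.[fps_C y0] 0%N = 0 -> p^`().[fps_C y0] 0%N != 0 ->
  exists y : fps F, root p y /\ y 0%N = y0.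
Proof.
set d := p^`().[_] 0%N => p0 d0.
(* Newton's iteration with one new coefficient per step. The derivative is replaced by its constant
   term [d], since the other terms are multiplied by a power beyond the coefficient being
   corrected. *)
pose fix y l : fps F := if l is l'.+1
  then y l' - fps_Xn F l * fps_C (p.[y l'] l / d) else fps_C y0.
have yS l i : (i <= l)%N -> y l.+1 i = y l i.
  by move=> il; rewrite /= fps_addE fps_oppE fps_XnME ltnS il oppr0 addr0.
have yge k l i : (i <= l)%N -> y (k + l)%N i = y l i.
  by elim: k => [//|k IH] il; rewrite addSn yS ?IH // (leq_trans il) ?leq_addl.
have coef0_horner q a : q.[a] 0%N = (map_poly (@fps_coef0 F) q).[a 0%N].
  exact: (esym (horner_map (@fps_coef0 F) q a)).
have y0E l : y l 0%N = y0 by rewrite -[l]addn0 yge.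
have py l : fps_agree l p.[y l] 0.
  elim: l => [|l IH] i; first by rewrite leqn0 => /eqP ->.
  rewrite leq_eqVlt => /predU1P[-> | il].
    set e := p.[y l] l.+1 / d; set h := fps_Xn F l.+1 * fps_C e.
    have [q] := horner_Taylor2 p (y l) (- h); rewrite -[y l - h]/(y l.+1) => ->.
    have -> : q * (- h) ^+ 2 = fps_Xn F (l.+1 * 2)%N * (q * fps_C e ^+ 2).
      by rewrite sqrrN exprMn fps_Xn_exp mulrCA.
    rewrite !fps_addE mulrN fps_oppE mulrCA !fps_XnME ltnn subnn fps_mul0E.
    have -> : (l.+1 < l.+1 * 2)%N by rewrite muln2 -addnn -addn1 leq_add2l.
    rewrite addr0 coef0_horner y0E.
    rewrite -[y0]/(fps_C y0 0%N) -coef0_horner -/d /fps_C /= mulr1n.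
    by rewrite /e mulrCA divff // mulr1 subrr.
  rewrite (fps_agree_horner _ (yS l) il); exact: IH.
(* The limit is the diagonal: from step [n] on, coefficient [n] no longer changes. *)
exists (fun n => y n n); split; last by [].
apply/eqP/funext => l; transitivity (p.[y l] l); last exact: py.
apply: fps_agree_horner (leqnn l) => i il.
by rewrite -[in RHS](subnK il) yge.
Qed.

End Hensel.

(** * Extension of an injective morphism to the field of fractions *)

Section FractionLift.

Variables (A : idomainType) (L : fieldType).

Lemma fraction_repr (x : {fraction A}) : x = (frac (repr x)).1%:F / (frac (repr x)).2%:F.
Proof.
have d0 := denom_ratioP (repr x).
apply: (canRL (mulfK _)); first by rewrite tofrac_eq0.
rewrite -{1}[x]reprK; unlock FracField.tofrac.
rewrite -[LHS]FracField.pi_mul; apply/eqmodP => /=.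
by rewrite FracField.equivfE /FracField.mulf !numden_Ratio ?mulf_neq0 ?oner_neq0 // !mulr1 mulrC.
Qed.

Lemma fractionP (x : {fraction A}) : exists n d : A, d != 0 /\ x = n%:F / d%:F.
Proof.
by exists (frac (repr x)).1, (frac (repr x)).2; split; [apply: denom_ratioP|apply: fraction_repr].
Qed.

Variable h : {rmorphism A -> L}.

Definition frac_lift_fun (x : {fraction A}) : L := h (frac (repr x)).1 / h (frac (repr x)).2.

Hypothesis h_inj : injective h.

Lemma frac_lift_neq0 d : d != 0 -> h d != 0.
Proof. by apply: contra_neq => hd; apply: h_inj; rewrite hd rmorph0. Qed.

Lemma frac_lift_frac n d : d != 0 -> frac_lift_fun (n%:F / d%:F) = h n / h d.
Proof.
move=> d0; rewrite /frac_lift_fun; set x := (n%:F / d%:F).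
have dx0 := denom_ratioP (repr x).
have Ex := fraction_repr x.
move: Ex; rewrite {1}/x => /eqP; rewrite eqr_div ?tofrac_eq0 // -!tofracM tofrac_eq => /eqP E.
by apply/eqP; rewrite eqr_div ?frac_lift_neq0 // -!rmorphM E.
Qed.

Lemma frac_lift_zmod : zmod_morphism frac_lift_fun.
Proof.
move=> x y; have [n [d [d0 ->]]] := fractionP x; have [m [e [e0 ->]]] := fractionP y.
have -> : n%:F / d%:F - m%:F / e%:F = (n * e - m * d)%:F / (d * e)%:F.
  by rewrite -mulNr addf_div ?tofrac_eq0 // mulNr tofracB !tofracM.
by rewrite !frac_lift_frac ?mulf_neq0 // rmorphB !rmorphM -[- (h m / _)]mulNr addf_div ?frac_lift_neq0 // mulNr.
Qed.

Lemma frac_lift_monoid : monoid_morphism frac_lift_fun.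
Proof.
split; first by rewrite -[1](divr1 1) -tofrac1 frac_lift_frac ?oner_neq0 // rmorph1 divr1.
move=> x y; have [n [d [d0 ->]]] := fractionP x; have [m [e [e0 ->]]] := fractionP y.
have -> : (n%:F / d%:F) * (m%:F / e%:F) = (n * m)%:F / (d * e)%:F.
  by rewrite !tofracM mulf_div.
by rewrite !frac_lift_frac ?mulf_neq0 // !rmorphM mulf_div.
Qed.

(** The proof of injectivity is an argument so that the morphism structures can be attached to this
    term. *)
Definition frac_lift & injective h := frac_lift_fun.
HB.instance Definition _ :=
  GRing.isZmodMorphism.Build {fraction A} L (frac_lift h_inj) frac_lift_zmod.
HB.instance Definition _ :=
  GRing.isMonoidMorphism.Build {fraction A} L (frac_lift h_inj) frac_lift_monoid.

Lemma frac_liftE a : frac_lift h_inj a%:F = h a.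
Proof.
by rewrite /frac_lift -[a%:F]divr1 -tofrac1 frac_lift_frac ?oner_neq0 // rmorph1 divr1.
Qed.

End FractionLift.

(** * Norms of polynomials and the product over pairs of roots *)

Section Norm.

Definition companion (R : nzRingType) n (p : {poly R}) : 'M[R]_n.+1 :=
  \matrix_(i, j) if i == ord_max then - p`_j else (i.+1 == j)%:R.

(** For [p] monic of degree [n + 1] this is the norm of [g] from [R[T] / (p)], the resultant of [p]
    and [g]. As a determinant it makes sense without roots and commutes with all ring morphisms, so
    the same object can be specialised to real points and to Puiseux series. *)
Definition poly_norm (R : comNzRingType) n (p g : {poly R}) : R :=
  \det (horner_mx (companion n p) g).

Lemma poly_norm_map (R S : comNzRingType) (phi : {rmorphism R -> S}) n p g :
  phi (poly_norm n p g) = poly_norm n (map_poly phi p) (map_poly phi g).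
Proof.
rewrite /poly_norm -det_map_mx map_horner_mx; congr (\det (horner_mx _ _)).
apply/matrixP => i j; rewrite !mxE coef_map; case: ifP => _; first by rewrite rmorphN.
by rewrite rmorph_nat.
Qed.

Section Eigen.

Variables (R : comNzRingType) (n : nat) (p : {poly R}).
Hypotheses (p_monic : p \is monic) (p_size : size p = n.+2).

(** All rows but the last shift [1, x, x^2, ...] by one place; the last row expresses [p(x) = 0]. *)
Lemma companion_eigen x : root p x ->
  companion n p *m (\col_i x ^+ i) = x *: (\col_i x ^+ i).
Proof.
move=> /rootP px; apply/colP => i; rewrite !mxE.
case: (eqVneq i ord_max) => [->|i_max]; last first.
  have iS : (i.+1 < n.+1)%N.
    by rewrite ltnS ltn_neqAle -ltnS ltn_ord andbT; apply: contra i_max => /eqP E; apply/eqP/val_inj.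
  rewrite (bigD1 (Ordinal iS)) //= !mxE (negPf i_max) eqxx mul1r big1 ?addr0 ?exprS //.
  move=> j; rewrite -val_eqE /= eq_sym => /negPf ji.
  by rewrite !mxE (negPf i_max) ji mul0r.
move: px; rewrite horner_coef p_size big_ord_recr /=.
have -> : p`_n.+1 = 1 by move/eqP: p_monic; rewrite lead_coefE p_size.
rewrite mul1r => /eqP; rewrite addr_eq0 => /eqP E.
rewrite -exprS -[RHS]opprK -E -sumrN; apply: eq_bigr => j _.
by rewrite !mxE eqxx mulNr.
Qed.

Lemma horner_companion_eigen g x : root p x ->
  horner_mx (companion n p) g *m (\col_i x ^+ i) = g.[x] *: (\col_i x ^+ i).
Proof.
move=> px; elim/poly_ind: g => [|g c IH]; first by rewrite rmorph0 mul0mx horner0 scale0r.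
rewrite rmorphD rmorphM /= horner_mx_X horner_mx_C mulmxDl -mulmxA.
rewrite companion_eigen // -scalemxAr IH mul_scalar_mx scalerA -scalerDl.
by rewrite hornerMXaddC mulrC.
Qed.

(** The vector of powers of [x] lies in the kernel, so the adjugate shows that the determinant
    annihilates it. Its first entry is 1, hence the determinant is 0 even in the presence of zero
    divisors. *)
Lemma poly_norm_root g x : root p x -> root g x -> poly_norm n p g = 0.
Proof.
move=> px /rootP gx; have := horner_companion_eigen g px; rewrite gx scale0r.
move/(congr1 (mulmx (\adj (horner_mx (companion n p) g)))); rewrite mulmxA mul_adj_mx mulmx0.
by rewrite mul_scalar_mx => /colP /(_ ord0); rewrite !mxE expr0 mulr1.
Qed.

End Eigen.

(** The Vandermonde matrix of the roots diagonalises [g] of the companion matrix; its determinant is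
    nonzero because the roots are distinct, and cancels. *)
Lemma poly_norm_prod (R : idomainType) n (p g : {poly R}) (x : 'I_n.+1 -> R) :
  p = \prod_i ('X - (x i)%:P) -> injective x -> poly_norm n p g = \prod_i g.[x i].
Proof.
move=> Ep x_inj.
have p_monic : p \is monic by rewrite Ep monic_prod_XsubC.
have p_size : size p = n.+2 by rewrite Ep size_prod_XsubC /index_enum -enumT size_enum_ord.
have px i : root p (x i).
  by rewrite Ep rootE horner_prod (bigD1 i) //= hornerXsubC subrr mul0r.
pose V := Vandermonde n.+1 (\row_i x i).
have E : horner_mx (companion n p) g *m V = V *m diag_mx (\row_i g.[x i]).
  apply/matrixP => i j; rewrite mul_mx_diag !mxE.
  have /colP /(_ i) := horner_companion_eigen p_monic p_size g (px j); rewrite !mxE mulrC => <-.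
  by apply: eq_bigr => k _; rewrite !mxE.
have V0 : \det V != 0.
  rewrite det_Vandermonde; apply/prodf_neq0 => i _; apply/prodf_neq0 => j ij.
  by rewrite !mxE subr_eq0 (inj_eq x_inj) -val_eqE /= gtn_eqF.
have := congr1 determinant E; rewrite !det_mulmx det_diag mulrC => /(mulfI V0) E2; rewrite /poly_norm E2.
by apply: eq_bigr => i _; rewrite mxE.
Qed.

End Norm.

Section DiffNorm.

(** A polynomial in two variables: [g%:P] is [g] at the inner variable, [map_poly polyC g] is [g] at
    the outer one. *)
Definition sq_diff_poly (R : comNzRingType) (g : {poly R}) (v : R) : {poly {poly R}} :=
  (v%:P)%:P - (g%:P - map_poly polyC g) ^+ 2.

(* In the inner norm the variable of the coefficient ring [{poly R}] is the first root. *)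
Definition diff_norm (R : comNzRingType) n (f g : {poly R}) (v : R) : R :=
  poly_norm n f (poly_norm n (map_poly polyC f) (sq_diff_poly g v)).

Lemma map_sq_diff_poly (R S : comNzRingType) (phi : {rmorphism R -> S}) g v :
  map_poly (map_poly phi) (sq_diff_poly g v) = sq_diff_poly (map_poly phi g) (phi v).
Proof.
rewrite /sq_diff_poly rmorphB rmorphXn rmorphB /= !map_polyC /= map_polyC.
congr (_ - (_ - _) ^+ 2).
by rewrite -!map_poly_comp; apply: eq_map_poly => a /=; rewrite map_polyC.
Qed.

Lemma diff_norm_map (R S : comNzRingType) (phi : {rmorphism R -> S}) n f g v :
  phi (diff_norm n f g v) = diff_norm n (map_poly phi f) (map_poly phi g) (phi v).
Proof.
rewrite /diff_norm poly_norm_map; congr (poly_norm _ _ _).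
rewrite (poly_norm_map (map_poly phi)) map_sq_diff_poly; congr (poly_norm _ _ _).
by rewrite -!map_poly_comp; apply: eq_map_poly => a /=; rewrite map_polyC.
Qed.

Lemma horner_inner_norm (R : comNzRingType) n (f g : {poly R}) v x :
  (poly_norm n (map_poly polyC f) (sq_diff_poly g v)).[x] =
  poly_norm n f (v%:P - (g.[x]%:P - g) ^+ 2).
Proof.
have E p : map_poly (horner_eval x) (map_poly polyC p) = p :> {poly R}.
  by rewrite -map_poly_comp map_poly_id // => a _ /=; rewrite /horner_eval hornerC.
rewrite -[LHS]/(horner_eval x _) poly_norm_map E; congr (poly_norm _ _ _).
by rewrite rmorphB rmorphXn rmorphB /= !map_polyC /= E /horner_eval hornerC.
Qed.

(** Two roots in [R] are enough here, without a splitting of [f]: this is the form used at the real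
    endpoints of an oval. *)
Lemma diff_norm_root (R : comNzRingType) n (f g : {poly R}) x y :
  f \is monic -> size f = n.+2 -> root f x -> root f y ->
  diff_norm n f g ((g.[x] - g.[y]) ^+ 2) = 0.
Proof.
move=> f_monic f_size fx fy; apply: (poly_norm_root f_monic f_size fx).
apply/rootP; rewrite horner_inner_norm; apply: (poly_norm_root f_monic f_size fy).
by apply/rootP; rewrite !(hornerD, hornerN, hornerC, horner_exp) subrr.
Qed.

Lemma diff_norm_prod (R : idomainType) n (f g : {poly R}) v (x : 'I_n.+1 -> R) :
  f = \prod_i ('X - (x i)%:P) -> injective x ->
  diff_norm n f g v = \prod_i \prod_j (v - (g.[x i] - g.[x j]) ^+ 2).
Proof.
move=> Ef x_inj; rewrite /diff_norm (poly_norm_prod _ Ef x_inj); apply: eq_bigr => i _.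
rewrite horner_inner_norm (poly_norm_prod _ Ef x_inj); apply: eq_bigr => j _.
by rewrite !(hornerD, hornerN, hornerC, horner_exp).
Qed.

End DiffNorm.

(** * Rationality of squared differences *)

Lemma exists_minimal_size (R : nzRingType) (A : {poly R} -> Prop) p :
  A p -> exists2 q, A q & forall r, A r -> (size q <= size r)%N.
Proof.
elim: {p}(size p).+1 {-2}p (ltnSn (size p)) => // k IH p pk Ap.
have [[q Aq qp]|h] := EM (exists2 q, A q & (size q < size p)%N).
  by apply: IH Aq; apply: leq_trans qp _.
exists p => // r Ar; rewrite leqNgt; apply/negP => rp; apply: h; by exists r.
Qed.

Lemma exists_multiplicity (F : fieldType) (N P : {poly F}) : (1 < size N)%N -> P != 0 ->
  exists q R, P = N ^+ q * R /\ ~~ (N %| R).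
Proof.
move=> N1; elim: {P}(size P).+1 {-2}P (ltnSn (size P)) => // k IH P Pk P0.
case: (boolP (N %| P)) => [/dvdpP[Q EP]|NP]; last by exists 0%N, P; rewrite mul1r.
have Q0 : Q != 0 by apply: contraNneq P0 => Q0; rewrite EP Q0 mul0r.
have N0 : N != 0 by rewrite -size_poly_gt0 ltnW.
case: (IH Q _ Q0) => [|q [R [EQ NR]]]; last first.
  by exists q.+1, R; split=> //; rewrite exprS -mulrA -EQ EP mulrC.
move: N1 Pk; rewrite EP size_mul //; move: (size _) (size _) => a b; lia.
Qed.

Section ConjugateMultiplicity.

Variables (F L : fieldType) (iota : {rmorphism F -> L}).
Hypothesis char0 : forall k, k.+1%:R != 0 :> F.

Local Notation "p ^i" := (map_poly iota p) (at level 2, format "p ^i").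

Variables (P : {poly F}) (s : seq L) (v : L).
Hypotheses (P_split : P^i = \prod_(x <- s) ('X - x%:P)) (v_s : v \in s) (v0 : v != 0).
Hypothesis count_v :
  forall x, x \in s -> count_mem x s = count_mem v s -> x = v \/ x = 0.

(* All roots of the minimal polynomial of [v] over [F] occur in [P] with the multiplicity of [v]. *)
Lemma rational_of_multiplicity : exists c, v = iota c.
Proof.
have P0 : P != 0 by rewrite -(map_poly_eq0 iota) P_split monic_neq0 // monic_prod_XsubC.
have Pv : root P^i v by rewrite P_split root_prod_XsubC.
have [|N [N0 Nv] Nmin] := @exists_minimal_size _ (fun N => N != 0 /\ root N^i v) P; first by [].
have cop Q : ~~ root Q^i v -> coprimep N Q.
  move=> Qv; rewrite -(coprimep_map iota) /coprimep -gcdp_map size_map_poly.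
  have /dvdpP[E EN] := dvdp_gcdl N Q; have /dvdpP[E' EQ] := dvdp_gcdr N Q.
  have gv : ~~ root (gcdp N Q)^i v.
    by apply: contra Qv => gv; rewrite EQ rmorphM rootM gv orbT.
  have Ev : root E^i v by move: Nv; rewrite {1}EN rmorphM rootM (negPf gv) orbF.
  have E0 : E != 0 by apply: contraNneq N0 => E0; rewrite EN E0 mul0r.
  have g0 : gcdp N Q != 0 by rewrite gcdp_eq0 negb_and N0.
  have := Nmin E (conj E0 Ev); rewrite {1}EN size_mul //.
  have := size_poly_gt0 E; have := size_poly_gt0 (gcdp N Q); rewrite E0 g0; move: (size _) (size _) => a b; lia.
have Nmin' Q : root Q^i v -> N %| Q.
  move=> Qv; apply: contraT => NQ; have m0 : Q %% N != 0 by [].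
  have Rv : root (Q %% N)^i v.
    have := Qv; rewrite {1}(divp_eq Q N) rmorphD rmorphM !rootE hornerD hornerM.
    by move/rootP: Nv => ->; rewrite mulr0 add0r.
  by have := Nmin _ (conj m0 Rv); rewrite leqNgt ltn_modp N0.
have N1 : (1 < size N)%N.
  rewrite ltnNge; apply/negP => /size1_polyC EN; move: Nv N0.
  by rewrite EN map_polyC rootC fmorph_eq0 polyC_eq0 => ->.
(* In characteristic 0 the derivative of [N] is nonzero, and it is smaller than the minimal [N], so
   [v] is a simple root of [N]. *)
have N'v : ~~ root (N^`())^i v.
  apply/negP => N'v; have N'0 : N^`() != 0.
    apply/eqP => /(congr1 (fun q : {poly F} => q`_(size N).-2)).
    rewrite coef_deriv coef0 (_ : (size N).-2.+1 = (size N).-1) -?lead_coefE; last by lia.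
    move/eqP; rewrite -mulr_natr mulf_eq0 lead_coef_eq0 (negPf N0) /=.
    by rewrite (_ : (size N).-1 = (size N).-2.+1) ?(negPf (char0 _)) //; lia.
  by have := Nmin _ (conj N'0 N'v); rewrite leqNgt lt_size_deriv.
have [q [R [EP NR]]] := exists_multiplicity N1 P0.
have Rv : ~~ root R^i v by apply: contra NR; apply: Nmin'.
have coprime_root Q x : coprimep N Q -> root N^i x -> ~~ root Q^i x.
  by rewrite -(coprimep_map iota) => /coprimep_root h Nx; apply: h.
have mult x : root N^i x -> exists2 E, N^i = E * ('X - x%:P) & ~~ root E x.
  move=> Nx; have /factor_theorem[E EN] := Nx; exists E => //.
  have := coprime_root _ _ (cop _ N'v) Nx; apply: contra => Ex.
  by rewrite -deriv_map EN derivM derivXsubC mulr1 rootE hornerD hornerM hornerXsubC subrr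
             mulr0 add0r.
(* The roots of [N] are simple and none of them is a root of [R], so each has in [P] exactly the
   exponent [q] of [N] as multiplicity. *)
have count_q x : root N^i x -> x \in s /\ count_mem x s = q.
  move=> Nx; have xs : x \in s.
    have : root P^i x; last by rewrite P_split root_prod_XsubC.
    have /dvdpP[Q ->] : N %| P by apply: Nmin'.
    by rewrite rmorphM rootM Nx orbT.
  split=> //; rewrite -(mu_prod_XsubC x s) -P_split EP rmorphM rmorphXn /=.
  have [E -> Ex] := mult _ Nx; rewrite exprMn -mulrA mulrCA mupMl ?mup_XsubCX ?eqxx //.
  rewrite rootM negb_or (coprime_root _ _ (cop _ Rv) Nx) andbT.
  by rewrite rootE horner_exp expf_neq0.
(* The alternative [x = 0] left open by the hypothesis is excluded because [N] is coprime to ['X],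
   as [v] is nonzero. *)
have all_v x : root N^i x -> x = v.
  move=> Nx; have [xs cx] := count_q _ Nx; have [_ cv] := count_q _ Nv.
  have [//|x0] := count_v xs (etrans cx (esym cv)); move: Nx; rewrite x0 => N00.
  have /coprime_root/(_ N00) : coprimep N 'X by apply: cop; rewrite map_polyX rootX.
  by rewrite map_polyX rootX eqxx.
have [E EN Ev] := mult _ Nv.
(* The cofactor [E] also splits over [s]; a root of it would be [v] again, contradicting simplicity.
   So [N] has degree 1 and [v] is read off its coefficients. *)
have /dvdp_prod_XsubC[m Em] : E %| \prod_(x <- s) ('X - x%:P).
  rewrite -P_split; have /dvdpP[Q ->] : N %| P by apply: Nmin'.
  by rewrite rmorphM /= EN dvdp_mull // dvdp_mulr.
have sE : size E = 1%N.
  rewrite (eqp_size Em); case Es : (mask m s) => [|x r]; first by rewrite big_nil size_poly1.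
  have Ex : root E x by rewrite (eqp_root Em) Es root_prod_XsubC mem_head.
  by have := all_v x; rewrite EN rootM Ex => /(_ isT) xv; rewrite -xv Ex in Ev.
have sN : size N = 2%N.
  have E0 : E != 0 by rewrite -size_poly_gt0 sE.
  by rewrite -(size_map_poly iota) EN size_mul ?polyXsubC_eq0 // size_XsubC sE.
have N1_0 : N`_1 != 0 by rewrite -[1%N]/(2.-1) -sN -lead_coefE lead_coef_eq0.
exists (- N`_0 / N`_1); move/rootP: Nv; rewrite horner_coef size_map_poly sN.
rewrite !big_ord_recl big_ord0 /= !coef_map expr0 mulr1 expr1 addr0 => /eqP.
rewrite addrC addr_eq0 -rmorphN => /eqP E1.
by rewrite rmorphM fmorphV -E1 mulrAC mulfV ?mul1r // fmorph_eq0.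
Qed.

End ConjugateMultiplicity.

Lemma periodic_mul (T : Type) (g : nat -> T) m h k :
  (forall k, g (k + m)%N = g k) -> g (k + h * m)%N = g k.
Proof. by move=> gP; elim: h => [|h IH]; rewrite ?addn0 // mulSn addnCA addnC gP. Qed.

Lemma periodic_mod (T : Type) (g : nat -> T) m k :
  (forall k, g (k + m)%N = g k) -> g (k %% m)%N = g k.
Proof. by move=> gP; rewrite [in RHS](divn_eq k m) addnC periodic_mul. Qed.

Lemma sum_periodic (g : nat -> nat) m h : (forall k, g (k + m)%N = g k) ->
  (\sum_(k < h * m) g k = h * \sum_(k < m) g k)%N.
Proof.
move=> gP; elim: h => [|h IH]; first by rewrite mul0n big_ord0.
rewrite mulSn big_split_ord /= mulSn; congr (_ + _)%N; rewrite -IH.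
by apply: eq_bigr => k _; rewrite addnC gP.
Qed.

Section SignedConjugates.

Variables (L : fieldType) (theta : {rmorphism L -> L}) (n : nat) (u : nat -> L).
Hypothesis char0 : forall k, k.+1%:R != 0 :> L.
Hypothesis n_gt0 : (0 < n)%N.
Hypothesis theta_u : forall k, theta (u k) = u k.+1.
Hypothesis u_period : forall k, u (k + n)%N = u k.

Let Lnat0 k : (k%:R == 0 :> L) = (k == 0)%N.
Proof. by case: k => [|k]; rewrite ?mulr0n ?eqxx ?(negPf (char0 k)). Qed.

Lemma iter_theta_u m k : iter m theta (u k) = u (k + m)%N.
Proof. by elim: m => [|m IH]; rewrite ?addn0 // iterS IH theta_u addnS. Qed.

Lemma iter_thetaB m x y : iter m theta (x - y) = iter m theta x - iter m theta y.
Proof. by elim: m => [//|m IH]; rewrite !iterS IH rmorphB. Qed.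

Lemma iter_thetaN m x : theta x = - x -> iter m theta x = (-1) ^+ m * x.
Proof.
move=> tx; elim: m => [|m IH]; first by rewrite mul1r.
by rewrite iterS IH rmorphM rmorphXn rmorphN1 tx exprS mulrN mulN1r mulNr.
Qed.

(* Summing over a full period. *)
Lemma fixed_difference i j : theta (u i - u j) = u i - u j -> u i - u j = 0.
Proof.
move=> fw; have it m : u (i + m)%N - u (j + m)%N = u i - u j.
  by rewrite -!iter_theta_u -iter_thetaB; elim: m => [//|m IH]; rewrite iterS IH.
have per k : \sum_(m < n) u (k + m)%N = \sum_(m < n) u m.
  elim: k => [//|k <-]; rewrite -(prednK n_gt0) [LHS]big_ord_recr [RHS]big_ord_recl /=.
  rewrite addn0 addrC addSnnS prednK // u_period; congr (_ + _).
  by apply: eq_bigr => m _; rewrite addSnnS.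
have : \sum_(m < n) (u (i + m)%N - u (j + m)%N) = 0 by rewrite sumrB !per subrr.
rewrite (eq_bigr (fun=> u i - u j)) => [|m _]; last exact: it.
rewrite sumr_const card_ord -mulr_natr => /eqP; rewrite mulf_eq0 Lnat0 eqn0Ngt n_gt0 orbF.
by move/eqP.
Qed.

Variables (i j : nat).
Hypotheses (i_n : (i < n)%N).
Let w := u i - u j.
Hypotheses (theta_w : theta w = - w) (w0 : w != 0).

Let c := w / 2%:R.
(** The shift from [i] to [j]; adding the period [n] keeps it a natural number. *)
Let dlt := (j + n - i)%N.
Let a k := u k - (-1) ^+ (k + i) * c.

Let two0 : 2%:R != 0 :> L := char0 1.

Let c0 : c != 0. Proof. by rewrite mulf_neq0 ?invr_eq0. Qed.

Let theta_c : theta c = - c.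
Proof. by rewrite /c rmorphM fmorphV rmorph_nat theta_w mulNr. Qed.

Let wc : w = c + c. Proof. by rewrite /c; field. Qed.

(* Since [theta] negates [w = 2 c], one has [u k = a k + (-1)^(k + i) c] with [a] of odd period:
   the squares of differences are the [(a k - a l)^2] and the [(a k - a l + 2 c)^2], and among
   them [w^2 = (2 c)^2] is recognised by its multiplicity. *)
Lemma sgn_n_even : ~~ odd n.
Proof.
apply/negP => on; have : iter n theta w = w.
  by rewrite /w iter_thetaB !iter_theta_u !u_period.
rewrite (iter_thetaN _ theta_w) -signr_odd on expr1 mulN1r => /eqP.
by rewrite eq_sym -subr_eq0 opprK wc -!mulr2n -mulrnA -mulr_natr mulf_eq0 (negPf c0) Lnat0.
Qed.

Let theta_a k : theta (a k) = a k.+1.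
Proof.
by rewrite /a rmorphB theta_u rmorphM rmorphXn rmorphN1 theta_c addSn exprS mulN1r mulNr mulrN.
Qed.

Let a_period k : a (k + n)%N = a k.
Proof.
by rewrite /a u_period addnAC exprD -[(-1) ^+ n]signr_odd (negPf sgn_n_even) mulr1.
Qed.

Lemma u_shift k : u k - u (k + dlt)%N = (-1) ^+ (k + i) * w.
Proof.
have E m : u (i + m)%N - u (i + m + dlt)%N = (-1) ^+ m * w.
  rewrite -iter_thetaN // /w iter_thetaB !iter_theta_u; congr (_ - _).
  have ij : (i <= j + n)%N by rewrite (leq_trans (ltnW i_n)) ?leq_addl.
  by rewrite addnAC /dlt subnKC // addnAC u_period.
(* Apply [theta^(k - i)] to [w]. Adding [i * n] makes the exponent a natural number and does not
   change its parity, as [n] is even. *)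
have : u (k + i * n)%N - u (k + i * n + dlt)%N = (-1) ^+ (k + i) * w.
  have ik : (i <= k + i * n)%N by rewrite (leq_trans _ (leq_addl _ _)) // leq_pmulr.
  rewrite -{1 2}(subnKC ik) E; congr (_ * _); rewrite -signr_odd -[RHS]signr_odd; congr (_ ^+ _).
  congr nat_of_bool; rewrite oddB // !oddD oddM (negPf sgn_n_even) andbF addbF //.
by rewrite periodic_mul // addnAC periodic_mul.
Qed.

(** For even [dlt] the alternating sum of [u k - u (k + dlt)] over a period would cancel, whereas
    each of its terms equals [(-1)^i w], so that [n w = 0]. *)
Let dlt_odd : odd dlt.
Proof.
apply: contraT => edlt; exfalso; case/eqP: w0.
pose S := \sum_(k < n) (-1) ^+ k * u k.
have per d : \sum_(k < n) (-1) ^+ (k + d) * u (k + d)%N = S.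
  elim: d => [|d <-]; first by apply: eq_bigr => k _; rewrite addn0.
  rewrite -(prednK n_gt0) [LHS]big_ord_recr [RHS]big_ord_recl /= addrC; congr (_ + _).
    rewrite add0n addnS -addSn prednK // addnC u_period exprD -[(-1) ^+ n]signr_odd.
    by rewrite (negPf sgn_n_even) mulr1.
  by apply: eq_bigr => k _; rewrite addSnnS.
have : \sum_(k < n) (-1) ^+ k * (u k - u (k + dlt)%N) = 0.
  under eq_bigr do rewrite mulrBr; rewrite sumrB -/S -(per dlt).
  apply/eqP; rewrite subr_eq0; apply/eqP/eq_bigr => k _.
  by rewrite exprD -[(-1) ^+ dlt]signr_odd (negPf edlt) mulr1.
rewrite (eq_bigr (fun=> (-1) ^+ i * w)) => [|k _]; last first.
  by rewrite u_shift mulrA exprD mulrA -expr2 sqrr_sign mul1r.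
rewrite sumr_const card_ord -mulr_natr => /eqP.
by rewrite mulf_eq0 Lnat0 eqn0Ngt n_gt0 orbF mulf_eq0 signr_eq0 => /eqP.
Qed.

(** As [dlt] is odd, the correction [(-1)^(k + i) c] changes sign under the shift, which absorbs
    exactly the difference [(-1)^(k + i) 2c] of [u_shift]. So [a] has an odd period. *)
Let a_shift k : a (k + dlt)%N = a k.
Proof.
have := u_shift k; rewrite /a wc addnAC [(-1) ^+ (_ + dlt)]exprD -[(-1) ^+ dlt]signr_odd dlt_odd.
by rewrite expr1 mulrN1 mulNr opprK mulrDr => /eqP; rewrite subr_eq => /eqP ->; ring.
Qed.

(* [theta^dlt] fixes the [a k] and changes the sign of [c]. *)
Let sep x : iter dlt theta x = x -> forall k, x != k.+1%:R * c /\ x != - (k.+1%:R * c).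
Proof.
have H y : iter dlt theta y = y -> forall k, y != k.+1%:R * c.
  move=> ty k; apply/eqP => Ey; move: ty.
  have ty : theta y = - y by rewrite Ey rmorphM rmorph_nat theta_c mulrN.
  rewrite iter_thetaN // -signr_odd dlt_odd expr1 mulN1r => /eqP.
  rewrite eq_sym -subr_eq0 opprK -mulr2n -mulr_natr mulf_eq0 (negPf two0) orbF Ey.
  by rewrite mulf_eq0 (negPf c0) (negPf (char0 k)).
move=> tx k; split; first exact: H.
rewrite -eqr_oppLR; apply: H; rewrite -[in RHS]tx.
by elim: dlt => [//|m IH]; rewrite !iterS IH rmorphN.
Qed.

(** Apply [theta^(l - k)], with the multiple [k * n] of the period added to the exponent. *)
Let a_add k m : a k = a (k + m)%N -> forall l, a l = a (l + m)%N.
Proof.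
have it m' k' : iter m' theta (a k') = a (k' + m')%N.
  by elim: m' => [|m' IH]; rewrite ?addn0 // iterS IH theta_a addnS.
move=> akm l; have : a (k + (l + k * n - k) )%N = a (k + m + (l + k * n - k))%N.
  by rewrite -!(it (l + k * n - k)%N) akm.
have kl : (k <= l + k * n)%N by rewrite (leq_trans _ (leq_addl _ _)) // leq_pmulr.
by rewrite -addnA [(m + _)%N]addnC addnA subnKC // addnAC !periodic_mul.
Qed.

Let ex_period : exists e, (0 < e)%N && (a 0 == a e).
Proof. by exists n; rewrite n_gt0 -[n]add0n a_period eqxx. Qed.

(** By [a_add] this first return is the least period of [a]; it divides the odd [dlt] and the even
    [n], so [2 e0] divides [n]. *)
Let e0 := ex_minn ex_period.

Let e0_gt0 : (0 < e0)%N.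
Proof. by rewrite /e0; case: ex_minnP => m /andP[]. Qed.

Let a_e0 k : a (k + e0)%N = a k.
Proof.
symmetry; rewrite /e0; case: ex_minnP => m /andP[_ /eqP am] _.
by apply: (@a_add 0).
Qed.

Let e0_dvd m : a m = a 0 -> (e0 %| m)%N.
Proof.
move=> am; rewrite /dvdn; apply: contraT; rewrite -lt0n => m0.
have : (e0 <= m %% e0)%N; last by rewrite leqNgt ltn_mod e0_gt0.
rewrite {1}/e0; case: ex_minnP => m' _; apply.
by rewrite m0 (periodic_mod _ a_e0) am eqxx.
Qed.

Let e0_odd : odd e0.
Proof.
have /dvdnP[q Eq] : (e0 %| dlt)%N by apply: e0_dvd; rewrite -[dlt]add0n a_shift.
by move: dlt_odd; rewrite Eq oddM => /andP[].
Qed.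

Let e02_n : exists h, n = (h * (e0 * 2))%N.
Proof.
apply/dvdnP; rewrite Gauss_dvd ?coprimen2 // dvdn2 sgn_n_even andbT.
by apply: e0_dvd; rewrite -[n]add0n a_period.
Qed.

Let a_inj k l : (k < e0)%N -> (l < e0)%N -> a k = a l -> k = l.
Proof.
wlog kl : k l / (k <= l)%N => [H|] ke le akl.
  by case/orP: (leq_total k l) => h; [apply: H|apply/esym/H].
apply/eqP; rewrite eqn_leq kl -subn_eq0 -leqn0 leqNgt; apply/negP => lk.
have /dvdn_leq : (e0 %| l - k)%N.
  by apply: e0_dvd; rewrite -[(l - k)%N]add0n; apply/esym/(@a_add k); rewrite subnKC.
by move/(_ lk); rewrite leqNgt (leq_ltn_trans (leq_subr _ _)).
Qed.

Let count v := (\sum_(k < n) \sum_(l < n) ((u k - u l) ^+ 2 == v))%N.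
Let X v := (\sum_(k < e0) \sum_(l < e0) ((a k - a l) ^+ 2 == v))%N.
Let Y v := (\sum_(k < e0) \sum_(l < e0) ((a k - a l + 2%:R * c) ^+ 2 == v))%N.

(** Since [e0] is odd, the values of [u] over [2 e0] consecutive indices are the [a k + c] and
    [a k - c] with [k < e0]. Of the four differences of a pair, two are [a k - a l] and two have the
    form [d + 2c] up to sign, whence the factor 2; a period of length [n] contains [h] such blocks
    for each index. *)
Let count_E : exists2 h, (0 < h)%N & forall v, count v = (h * (X v + Y v))%N.
Proof.
have [h nh] := e02_n; have h_gt0 : (0 < h)%N by move: n_gt0; rewrite nh muln_gt0 => /andP[].
have ua k : u k = a k + (-1) ^+ (k + i) * c by rewrite /a subrK.
have uP k : u (k + e0 * 2)%N = u k.
  have -> : u k = a (k + e0 * 2)%N + (-1) ^+ (k + i) * c by rewrite muln2 -addnn addnA !a_e0 -ua.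
  by rewrite ua -signr_odd -[in RHS]signr_odd !oddD oddM andbF addbF.
have half (g : L -> nat) : (\sum_(k < e0 * 2) g (u k) = \sum_(k < e0) (g (a k + c)%R + g (a k - c)%R))%N.
  rewrite muln2 -addnn big_split_ord /= -big_split /=; apply: eq_bigr => k _.
  have -> : u (e0 + k)%N = a k - (-1) ^+ (k + i) * c.
    rewrite [(e0 + k)%N]addnC ua a_e0; congr (_ + _); rewrite -mulNr; congr (_ * _).
    by rewrite addnAC exprD -[(-1) ^+ e0]signr_odd e0_odd expr1 mulrN1.
  rewrite ua -signr_odd; case: (odd _); rewrite ?expr1 ?expr0 ?mulN1r ?mul1r ?opprK //.
  by rewrite addnC.
have full (g : L -> nat) : (\sum_(k < n) g (u k) = h * \sum_(k < e0) (g (a k + c)%R + g (a k - c)%R))%N.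
  by rewrite nh -half; apply: (@sum_periodic (fun k => g (u k))) => k; rewrite uP.
exists (h * h * 2)%N => [|v]; first by rewrite !muln_gt0 h_gt0.
pose G x := (\sum_(l < e0) (((x - (a l + c)) ^+ 2 == v) + ((x - (a l - c)) ^+ 2 == v)))%N.
have -> : count v = (h * (h * \sum_(k < e0) (G (a k + c)%R + G (a k - c)%R)))%N.
  rewrite -full big_distrr /=; apply: eq_bigr => k _.
  by rewrite (full (fun y => ((u k - y) ^+ 2 == v) : nat)).
rewrite -!mulnA; congr (h * (h * _))%N.
transitivity (\sum_(k < e0) (2 * (\sum_(l < e0) (((a k - a l) ^+ 2 == v) : nat))
   + \sum_(l < e0) (((a k - a l + 2%:R * c) ^+ 2 == v) : nat)
   + \sum_(l < e0) (((a l - a k + 2%:R * c) ^+ 2 == v) : nat)))%N.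
  apply: eq_bigr => k _; rewrite /G big_distrr -!big_split /=; apply: eq_bigr => l _.
  have -> : a k + c - (a l + c) = a k - a l by ring.
  have -> : a k - c - (a l - c) = a k - a l by ring.
  have -> : a k + c - (a l - c) = a k - a l + 2%:R * c by ring.
  have -> : a k - c - (a l + c) = - (a l - a k + 2%:R * c) by ring.
  rewrite sqrrN; move: (nat_of_bool ((a k - a l) ^+ 2 == v)).
  move: (nat_of_bool ((a k - a l + _) ^+ 2 == v)) (nat_of_bool ((a l - a k + _) ^+ 2 == v)).
  by move=> b1 b2 b3; lia.
rewrite !big_split /= big1_eq [X in (_ + X)%N]exchange_big /= -/(X v) -/(Y v).
by move: (X v) (Y v) => x y; lia.
Qed.

Let a_diff_fixed k l : iter dlt theta (a k - a l) = a k - a l.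
Proof.
have it k' m' : iter m' theta (a k') = a (k' + m')%N.
  by elim: m' => [|m' IH]; rewrite ?addn0 // iterS IH theta_a addnS.
by rewrite iter_thetaB !it !a_shift.
Qed.

Let fixed_add x y : iter dlt theta x = x -> iter dlt theta y = y -> iter dlt theta (x + y) = x + y.
Proof.
move=> tx ty; have D m : iter m theta (x + y) = iter m theta x + iter m theta y.
  by elim: m => [//|m IH]; rewrite !iterS IH rmorphD.
by rewrite D tx ty.
Qed.

(** If one value were a square of both kinds, [2c] would up to sign be a sum of differences of the
    [a k], hence fixed by [theta^dlt], against [sep]. *)
Let Y_pos_X0 v k l : (a k - a l + 2%:R * c) ^+ 2 = v -> X v = 0%N.
Proof.
move=> Ev; apply: big1 => p _; apply: big1 => q _; apply/eqP; rewrite eqb0.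
apply/eqP; rewrite -Ev => /eqP; rewrite eqf_sqr => /orP[] /eqP E.
  have [/eqP[]] := sep (fixed_add (a_diff_fixed p q) (a_diff_fixed l k)) 1.
  by rewrite E; ring.
have [_ /eqP[]] := sep (fixed_add (a_diff_fixed p q) (a_diff_fixed k l)) 1.
by rewrite E; ring.
Qed.

Let w_sq : w ^+ 2 = (a 0%N - a 0%N + 2%:R * c) ^+ 2.
Proof. by rewrite subrr add0r wc; ring. Qed.

(** The other square root would make [4c] up to sign a sum of differences of the [a k], which [sep]
    excludes. *)
Let Y_E v k l : (a k - a l + 2%:R * c) ^+ 2 = v ->
  forall p q, ((a p - a q + 2%:R * c) ^+ 2 == v) = (a p - a q == a k - a l).
Proof.
move=> Ev p q; apply/idP/eqP => [|->]; last by rewrite Ev.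
rewrite -Ev eqf_sqr => /orP[/eqP/addIr//|/eqP E].
have [_ /eqP[]] := sep (fixed_add (a_diff_fixed p q) (a_diff_fixed k l)) 3.
have -> : a p - a q = - (a k - a l + 2%:R * c) - 2%:R * c by rewrite -E addrK.
by ring.
Qed.

Let sum_le1 m (b : 'I_m -> bool) : (forall k l, b k -> b l -> k = l) -> (\sum_(k < m) b k <= 1)%N.
Proof.
move=> b1; case: (pickP b) => [k bk|b0]; last by rewrite big1 // => k _; rewrite b0.
rewrite (bigD1 k) //= bk big1 // => l /negP lk; apply/eqP; rewrite eqb0; apply/negP => bl.
by apply: lk; apply/eqP/b1.
Qed.

Let all1 m (r : 'I_m -> nat) : (forall k, r k <= 1)%N -> (\sum_(k < m) r k)%N = m -> forall k, r k = 1%N.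
Proof.
move=> r1 rm k; have : (\sum_(k < m) (1 - r k))%N == 0%N.
  have := big_split addn (index_enum 'I_m) xpredT r (fun k => 1 - r k)%N.
  rewrite (eq_bigr (fun=> 1%N)) => [|l _]; last by rewrite /= subnKC.
  by rewrite sum1_card card_ord rm => /eqP; rewrite -{1}[m]addn0 eqn_add2l eq_sym.
by rewrite sum_nat_eq0 => /forallP /(_ k) /=; have := r1 k; lia.
Qed.

Let Y_w : Y (w ^+ 2) = e0.
Proof.
rewrite /Y -[RHS]card_ord -sum1_card; apply: eq_bigr => k _.
rewrite (bigD1 k) //= (Y_E (esym w_sq)) subrr subrr eqxx big1 // => l /negP lk.
apply/eqP; rewrite eqb0 (Y_E (esym w_sq)) subrr subr_eq0; apply/negP => /eqP akl.
by apply: lk; apply/eqP/val_inj/esym/a_inj; rewrite ?ltn_ord.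
Qed.

(** If the count is full, every index occurs exactly once as [p] and once as [q] in a pair with
    [a p - a q = d]: translation by [d] permutes the values of [a]. Summing gives [e0 * d = 0],
    hence [d = 0]. *)
Let Y_lt v k l : (a k - a l + 2%:R * c) ^+ 2 = v -> Y v = e0 -> v = w ^+ 2.
Proof.
move=> Ev Yv; rewrite -Ev w_sq; congr ((_ + _) ^+ 2); rewrite subrr.
set d := a k - a l; pose b (p q : 'I_e0) := a p - a q == d.
have YE : Y v = (\sum_(p < e0) \sum_(q < e0) b p q)%N.
  by apply: eq_bigr => p _; apply: eq_bigr => q _; rewrite (Y_E Ev).
have row : forall p, (\sum_(q < e0) b p q)%N = 1%N.
  apply: all1; last by rewrite -YE.
  move=> p; apply: sum_le1 => q q' /eqP E /eqP E'; apply/val_inj/a_inj; rewrite ?ltn_ord //.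
  by apply: oppr_inj; apply: (@addrI _ (a p)); rewrite E E'.
have col : forall q, (\sum_(p < e0) b p q)%N = 1%N.
  apply: all1; last by rewrite exchange_big -YE.
  move=> q; apply: sum_le1 => p p' /eqP E /eqP E'; apply/val_inj/a_inj; rewrite ?ltn_ord //.
  by apply: (@addIr _ (- a q)); rewrite E E'.
have : \sum_(p < e0) \sum_(q < e0) (a p - a q - d) *+ b p q = 0.
  apply: big1 => p _; apply: big1 => q _; rewrite /b.
  by case: eqP => [->|]; rewrite ?subrr ?mulr0n.
rewrite (eq_bigr (fun p : 'I_e0 => a p - \sum_(q < e0) a q *+ b p q - d)) => [|p _]; last first.
  rewrite (eq_bigr (fun q : 'I_e0 => a p *+ b p q - a q *+ b p q - d *+ b p q)) => [|q _].
    by rewrite !sumrB !sumrMnr row !mulr1n.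
  by rewrite !mulrnBl.
rewrite sumrB sumrB exchange_big /= [X in _ - X - _](eq_bigr (fun q : 'I_e0 => a q)) => [|q _]; last first.
  by rewrite sumrMnr col mulr1n.
rewrite subrr sub0r sumr_const card_ord => /eqP; rewrite oppr_eq0 -mulr_natr mulf_eq0 Lnat0.
by rewrite eqn0Ngt e0_gt0 orbF => /eqP.
Qed.

(** Exchange [k] and [l]; the diagonal only contributes to the value 0. *)
Let X_even v : v != 0 -> ~~ odd (X v).
Proof.
move=> v0; pose b (k l : 'I_e0) := (a k - a l) ^+ 2 == v.
have -> : X v = (\sum_(k < e0) \sum_(l < e0) ((k < l)%N && b k l) +
                \sum_(k < e0) \sum_(l < e0) ((l < k)%N && b k l))%N.
  rewrite -big_split; apply: eq_bigr => k _; rewrite -big_split; apply: eq_bigr => l _.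
  rewrite /b /=; case: ltngtP => [_|_|/val_inj ->]; rewrite ?addn0 //.
  by rewrite subrr expr0n /= eq_sym (negPf v0).
rewrite [X in (_ + X)%N]exchange_big /=.
rewrite [X in (_ + X)%N](_ : _ = (\sum_(k < e0) \sum_(l < e0) ((k < l)%N && b k l))%N).
  by rewrite addnn odd_double.
by apply: eq_bigr => k _; apply: eq_bigr => l _; rewrite /b -sqrrN opprB.
Qed.

(** Equal multiplicities mean [X v + Y v = e0]. If [Y v = 0], then [X v = e0] is odd, contrary to
    [X_even]; otherwise [X v = 0], and the full count [Y v = e0] forces [v = w^2]. *)
Lemma sq_diff_count (v : L) k l : (k < n)%N -> (l < n)%N -> v = (u k - u l) ^+ 2 -> v != 0 ->
  (\sum_(k < n) \sum_(l < n) ((u k - u l) ^+ 2 == v))%N =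
  (\sum_(k < n) \sum_(l < n) ((u k - u l) ^+ 2 == w ^+ 2))%N ->
  v = w ^+ 2.
Proof.
move=> kn ln vE v0; rewrite -/(count v) -/(count (w ^+ 2)).
have cv : (0 < count v)%N.
  by rewrite /count (bigD1 (Ordinal kn)) //= (bigD1 (Ordinal ln)) //= -vE eqxx.
have [h h0 ch] := count_E; rewrite !ch Y_w (Y_pos_X0 (esym w_sq)) add0n.
move/eqP; rewrite eqn_pmul2l // => /eqP XY.
have [Y0|Y_gt0] := posnP (Y v).
  by have := X_even v0; rewrite -[X v]addn0 -Y0 XY e0_odd.
have [p [q pq]] : exists p q : 'I_e0, (a p - a q + 2%:R * c) ^+ 2 = v.
  apply: contrapT => H; move: Y_gt0; rewrite /Y big1 // => p _; apply: big1 => q _.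
  by apply/eqP; rewrite eqb0; apply/eqP => E; apply: H; exists p, q.
by apply: (Y_lt pq); rewrite -XY (Y_pos_X0 pq).
Qed.

End SignedConjugates.

(** No other nonzero root of [P] has the multiplicity of [(u i - u j)^2], so this element has no
    further conjugates over [F]. *)
Lemma sq_diff_rational (F L : fieldType) (iota : {rmorphism F -> L}) (theta : {rmorphism L -> L})
    (n : nat) (u : nat -> L) (P : {poly F}) (i j : nat) :
  (forall k, k.+1%:R != 0 :> F) ->
  (forall k, theta (u k) = u k.+1) -> (forall k, u (k + n)%N = u k) ->
  map_poly iota P = \prod_(k < n) \prod_(l < n) ('X - ((u k - u l) ^+ 2)%:P) ->
  (i < n)%N -> (j < n)%N -> theta (u i - u j) = - (u i - u j) ->
  exists c, (u i - u j) ^+ 2 = iota c.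
Proof.
move=> char0 theta_u u_period EP i_n j_n theta_w.
have [->|w0] := eqVneq (u i - u j) 0; first by exists 0; rewrite rmorph0 expr0n.
have char0L k : k.+1%:R != 0 :> L by rewrite -(rmorph_nat iota) fmorph_eq0.
pose g (p : 'I_n * 'I_n) := (u p.1 - u p.2) ^+ 2.
pose s := [seq g p | p <- enum {: 'I_n * 'I_n}].
have cnt v : count_mem v s = (\sum_(k < n) \sum_(l < n) ((u k - u l) ^+ 2 == v))%N.
  rewrite pair_big -sum1_count big_mkcond big_map big_enum /=.
  by apply: eq_bigr => p _; rewrite /g; case: eqP.
apply: (@rational_of_multiplicity _ _ iota char0 P s); last 1 first.
- move=> x /mapP[[k l] _ xE] cx; have [->|x0] := eqVneq x 0; [by right|left].
  apply: (sq_diff_count char0L (leq_ltn_trans (leq0n i) i_n) theta_u u_period i_n theta_w w0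
    (ltn_ord k) (ltn_ord l) xE x0).
  by rewrite -!cnt.
- by rewrite EP pair_big /s big_map big_enum.
- by apply/mapP; exists (Ordinal i_n, Ordinal j_n); rewrite ?mem_enum.
- by rewrite expf_neq0.
Qed.

Lemma closed_prim_root (C : closedFieldType) n :
  (forall k, k.+1%:R != 0 :> C) -> (0 < n)%N -> exists e : C, n.-primitive_root e.
Proof.
move=> char0 n_gt0; have [rs Ers] := closed_field_poly_normal ('X^n - 1 : {poly C}).
have n0 : n%:R != 0 :> C by rewrite -(prednK n_gt0) char0.
have lc : lead_coef ('X^n - 1 : {poly C}) = 1.
  by apply/eqP; rewrite -monicE monicXnsubC.
rewrite lc scale1r in Ers.
have rs_root : all n.-unity_root rs by apply/allP => x; rewrite -root_prod_XsubC -Ers.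
have sz : (n < (size rs).+1)%N by rewrite -(size_prod_XsubC rs id) -Ers size_XnsubC.
have [|z] := hasP (has_prim_root n_gt0 rs_root _ sz); last by exists z.
by rewrite -separable_prod_XsubC -Ers separable_Xn_sub_1.
Qed.

Section FractionIntegral.

Variable F : fieldType.

Lemma fraction_coprimeP (c : {fraction {poly F}}) :
  exists p q : {poly F}, [/\ q != 0, coprimep q p & c = p%:F / q%:F].
Proof.
have [p [q [q0 ->]]] := fractionP c; pose g := gcdp p q.
have g0 : g != 0 by rewrite gcdp_eq0 negb_and q0 orbT.
exists (p %/ g), (q %/ g); split.
- by apply: contraNneq q0 => E; rewrite -(divpK (dvdp_gcdr p q)) E mul0r.
- by rewrite coprimep_sym coprimep_div_gcd // q0 orbT.
have q'0 : q %/ g != 0 by apply: contraNneq q0 => E; rewrite -(divpK (dvdp_gcdr p q)) E mul0r.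
apply/eqP; rewrite eqr_div ?tofrac_eq0 // -!tofracM tofrac_eq.
have Ep := divpK (dvdp_gcdl p q); have Eq := divpK (dvdp_gcdr p q).
rewrite -[X in X * _ == _]Ep -[X in _ == _ * X]Eq -/g; set p' := p %/ g; set q' := q %/ g.
by rewrite -mulrA [g * q']mulrC.
Qed.

(** The rational root theorem: the denominator divides a power of the numerator and is coprime to
    it, hence constant. *)
Lemma fraction_integrally_closed (c : {fraction {poly F}}) (D : {poly {poly F}}) :
  D \is monic -> root (map_poly (@FracField.tofrac _) D) c -> exists q, c = q%:F.
Proof.
move=> D_monic; have [p [q [q0 cpq ->]]] := fraction_coprimeP c.
have q0' : q%:F != 0 by rewrite tofrac_eq0.
have D0 : D != 0 := monic_neq0 D_monic.
move/rootP; rewrite horner_coef size_map_poly_id0 ?tofrac_eq0 ?lead_coef_eq0 //.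
rewrite polySpred // big_ord_recr /= coef_map -lead_coefE (monicP D_monic) /= rmorph1 mul1r.
set m := (size D).-1; move/(congr1 (fun y => y * q%:F ^+ m)).
rewrite mulrDl mul0r expr_div_n divfK ?expf_neq0 // big_distrl /=.
rewrite (eq_bigr (fun i : 'I_m => (D`_i * p ^+ i * q ^+ (m - i.+1) * q)%:F)) => [|i _]; last first.
  have Em : m = (i + (m - i.+1).+1)%N by rewrite addnS -addSn subnKC.
  rewrite coef_map /= expr_div_n [in q%:F ^+ m]Em exprD exprSr !tofracM !tofracXn -!mulrA.
  by rewrite mulKf ?expf_neq0.
rewrite -raddf_sum -tofracXn -tofracD => /eqP; rewrite tofrac_eq0 addr_eq0 -big_distrl /= => /eqP E.
have : q %| p ^+ m by rewrite -dvdpNr -E dvdp_mull.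
move=> qp; have cqm : coprimep q (p ^+ m) by rewrite coprimep_expr.
have /size_poly1P[a a0 Eq] : size q == 1%N by rewrite -(eqp_size (dvdp_gcd_idl qp)).
exists (a^-1 *: p); apply: (canLR (mulfK _)); first by rewrite tofrac_eq0.
by rewrite -tofracM Eq -scalerAl mulrC mul_polyC scalerA mulVf // scale1r.
Qed.

End FractionIntegral.

(** * Puiseux series at infinity *)

Section FpsScale.

Variables (C : fieldType) (e : C).

(** The substitution of [e * X] for the variable [X]; for a root of unity [e] it describes one turn
    around infinity. *)
Definition fps_scale (a : fps C) : fps C := fun l => e ^+ l * a l.

Let fps_scale_zmod : zmod_morphism fps_scale.
Proof. by move=> a b; apply/funext => l; rewrite /fps_scale fps_addE fps_oppE mulrBr. Qed.
Let fps_scale_monoid : monoid_morphism fps_scale.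
Proof.
split=> [|a b]; apply/funext => l.
  by rewrite /fps_scale -[1]/(fps_C 1) /fps_C; case: l => [|l] /=; rewrite ?mul1r // mulr0n mulr0.
rewrite /fps_scale !fps_mulE big_distrr /=; apply: eq_bigr => i _.
by rewrite -{1}(subnKC (ltn_ord i : (i <= l)%N)) exprD mulrACA.
Qed.
HB.instance Definition _ := GRing.isZmodMorphism.Build (fps C) (fps C) fps_scale fps_scale_zmod.
HB.instance Definition _ := GRing.isMonoidMorphism.Build (fps C) (fps C) fps_scale fps_scale_monoid.

Lemma fps_scale_C x : fps_scale (fps_C x) = fps_C x.
Proof. by apply/funext => -[|l]; rewrite /fps_scale /fps_C /= ?mul1r // mulr0n mulr0. Qed.

Lemma fps_scale_Xn m : fps_scale (fps_Xn C m) = fps_C (e ^+ m) * fps_Xn C m.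
Proof.
apply/funext => l; rewrite fps_CME /fps_scale /fps_Xn.
by case: eqP => [->|]; rewrite ?mulr0.
Qed.

End FpsScale.

Lemma fps_scaleM (C : fieldType) (e e' : C) a : fps_scale e (fps_scale e' a) = fps_scale (e * e') a.
Proof. by apply/funext => l; rewrite /fps_scale mulrA exprMn. Qed.

Lemma fps_horner0 (C : fieldType) (q : {poly fps C}) a :
  q.[a] 0%N = (map_poly (@fps_coef0 C) q).[a 0%N].
Proof. exact: (esym (horner_map (@fps_coef0 C) q a)). Qed.

Section Poles.

Variables (F C : fieldType) (kappa : {rmorphism F -> C}).

Definition fps_emb : {rmorphism F -> {fraction fps C}} :=
  @FracField.tofrac (fps C) \o (@fps_C C \o kappa).

Arguments fps_emb : simpl never.

(** The local parameter at infinity: [z] will be [w^-(n+1)]. *)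
Definition fps_w : {fraction fps C} := (fps_Xn C 1)%:F.

Lemma fps_w_neq0 : fps_w != 0. Proof. by rewrite tofrac_eq0 fps_Xn_neq0. Qed.

Lemma fps_w_exp m : fps_w ^+ m = (fps_Xn C m)%:F.
Proof. by rewrite -tofracXn fps_Xn_exp mul1n. Qed.

(** After multiplication by the power of [w] only the leading term survives at [w = 0], so the order
    of the pole is exactly [d] times the degree. It is used for [z] with [d = n + 1] and for the
    root [y / w] with [d = 1]. *)
Lemma horner_pole (y : fps C) d (q : {poly F}) : y 0%N != 0 -> (0 < d)%N -> q != 0 ->
  exists a : fps C, a 0%N != 0 /\
    (map_poly fps_emb q).[y%:F / fps_w ^+ d] = a%:F / fps_w ^+ (d * (size q).-1)%N.
Proof.
move=> y0 d0 q0; set m := (size q).-1.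
exists (\sum_(j < size q) fps_C (kappa q`_j) * fps_Xn C (d * (m - j))%N * y ^+ j); split.
  rewrite fps_sumE polySpred // big_ord_recr /= big1 => [|j _].
    rewrite add0r -/m subnn muln0 !fps_mul0E -[(y ^+ m) 0%N]/(fps_coef0 (y ^+ m)) rmorphXn /=.
    rewrite /fps_C /fps_Xn /= mulr1n mulr1 mulf_neq0 ?expf_neq0 //.
    by rewrite fmorph_eq0 -lead_coefE lead_coef_eq0.
  rewrite !fps_mul0E /fps_Xn eq_sym muln_eq0 eqn0Ngt d0 subn_eq0 -/m leqNgt ltn_ord /=.
  by rewrite mulr0 mul0r.
rewrite horner_coef size_map_poly rmorph_sum /= big_distrl /=; apply: eq_bigr => j _.
rewrite coef_map /= !tofracM tofracXn -fps_w_exp expr_div_n -!mulrA; congr (_ * _).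
have jm : (j <= m)%N by rewrite -ltnS -polySpred.
rewrite mulrCA; congr (_ * _); have -> : (d * m = d * (m - j) + d * j)%N by rewrite -mulnDr subnK.
by rewrite exprD invfM mulrA mulfV ?mul1r -?exprM // expf_neq0 ?fps_w_neq0.
Qed.

Lemma pole_unique (a b : fps C) i j : a 0%N != 0 -> b 0%N != 0 ->
  a%:F / fps_w ^+ i = b%:F / fps_w ^+ j -> i = j.
Proof.
have H (a' b' : fps C) k l : b' 0%N != 0 ->
    a'%:F / fps_w ^+ k = b'%:F / fps_w ^+ l -> (l <= k)%N.
  move=> b0 /eqP; rewrite eqr_div ?expf_neq0 ?fps_w_neq0 // !fps_w_exp -!tofracM tofrac_eq.
  rewrite mulrC [X in _ == X]mulrC => /eqP/(congr1 (fun c : fps C => c k)).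
  rewrite !fps_XnME ltnn subnn leqNgt; case: ltnP => // _ /esym/eqP.
  by rewrite (negPf b0).
move=> a0 b0 E; apply/eqP; rewrite eqn_leq (H _ _ _ _ b0 E) andbT.
exact: (H _ _ _ _ a0 (esym E)).
Qed.

End Poles.

Section Puiseux.

Variables (F C : fieldType) (kappa : {rmorphism F -> C}) (n : nat) (f : {poly F}).
Hypotheses (f_monic : f \is monic) (f_size : size f = n.+2).
Hypothesis char0 : forall k, k.+1%:R != 0 :> C.

(** The ansatz [x = y / w] turns [f(x) = w^-(n+1)] into this equation after multiplication by
    [w^(n+1)]. At [w = 0] it reads [y^(n+1) = 1] because [f] is monic, and 1 is a simple root, so
    Hensel's lemma applies. *)
Lemma puiseux_series : exists y : fps C, y 0%N = 1 /\
  \sum_(j < n.+2) fps_C (kappa f`_j) * fps_Xn C (n.+1 - j)%N * y ^+ j = 1.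
Proof.
pose p := \poly_(j < n.+2) (fps_C (kappa f`_j) * fps_Xn C (n.+1 - j)%N) - 1%:P : {poly fps C}.
have Ep : map_poly (@fps_coef0 C) p = 'X^(n.+1) - 1%:P.
  apply/polyP => j; rewrite coef_map /p !coefB coef_poly coefXn !coefC /= /fps_coef0 fps_addE fps_oppE.
  congr (_ - _); last by case: (j == 0)%N.
  rewrite (fun_if (fun a : fps C => a 0%N)) fps_mul0E /fps_Xn /fps_C /= mulr1n eq_sym subn_eq0.
  case: ltnP => [|nj]; last by rewrite gtn_eqF.
  rewrite ltnS leq_eqVlt => /predU1P[->|jn]; last by rewrite ltn_eqF // leqNgt jn mulr0.
  have -> : f`_n.+1 = 1 by move/monicP: f_monic; rewrite lead_coefE f_size.
  by rewrite rmorph1 leqnn eqxx mulr1.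
have [||y [/rootP py y0]] := @hensel _ p 1.
- by rewrite fps_horner0 Ep /fps_C !hornerE /= mulr1n expr1n subrr.
- rewrite fps_horner0 -deriv_map Ep derivB derivC subr0 derivXn hornerMn hornerXn.
  by rewrite /fps_C /= mulr1n expr1n char0.
exists y; split=> //; move: py; rewrite hornerD hornerN hornerC horner_poly => /eqP.
by rewrite subr_eq0 => /eqP.
Qed.

Variables (y : fps C) (e : C).
Hypothesis y0 : y 0%N = 1.
Hypothesis y_root : \sum_(j < n.+2) fps_C (kappa f`_j) * fps_Xn C (n.+1 - j)%N * y ^+ j = 1.
Hypothesis e_prim : n.+1.-primitive_root e.

Local Notation Om := {fraction fps C}.
Local Notation emb := (fps_emb kappa).
Local Notation w := (@fps_w C).
Local Notation "p ^e" := (map_poly emb p) (at level 2, format "p ^e").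

Let e0 : e != 0.
Proof. by apply/eqP => E; have := prim_expr_order e_prim; rewrite E expr0n => /esym/eqP; rewrite oner_eq0. Qed.

Lemma tofrac_scale_inj : injective (@FracField.tofrac (fps C) \o fps_scale e).
Proof.
move=> a b /eqP; rewrite tofrac_eq => /eqP E; apply/funext => l.
by move/(congr1 (fun c : fps C => c l)): E => /mulfI -> //; rewrite expf_neq0.
Qed.

(* The monodromy at infinity. *)
Definition theta : {rmorphism Om -> Om} := frac_lift tofrac_scale_inj.

Lemma theta_tofrac a : theta a%:F = (fps_scale e a)%:F.
Proof. exact: frac_liftE. Qed.

Lemma theta_emb x : theta (emb x) = emb x.
Proof. by rewrite theta_tofrac fps_scale_C. Qed.

Lemma theta_horner q x : theta q^e.[x] = q^e.[theta x].
Proof.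
rewrite -horner_map -map_poly_comp; congr (horner _ _).
by apply: eq_map_poly => a; apply: theta_emb.
Qed.

Lemma theta_w : theta w = (fps_C e)%:F * w.
Proof. by rewrite theta_tofrac fps_scale_Xn expr1 tofracM. Qed.

(** This is [y(e^k w) / (e^k w)], the image of [y / w] under [theta^k]. *)
Definition puiseux_root k : Om := (fps_scale (e ^+ k) y)%:F / (fps_C (e ^+ k) * fps_Xn C 1)%:F.
Local Notation X := puiseux_root.

Definition puiseux_z : Om := (w ^+ n.+1)^-1.
Local Notation z := puiseux_z.

Lemma theta_z : theta z = z.
Proof.
rewrite /z fmorphV rmorphXn /= theta_w exprMn -tofracXn -rmorphXn /=.
by rewrite (prim_expr_order e_prim) !rmorph1 mul1r.
Qed.

Lemma theta_root k : theta (X k) = X k.+1.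
Proof.
rewrite /X rmorphM fmorphV !theta_tofrac fps_scaleM -exprS; congr (_ / _%:F).
by rewrite rmorphM /= fps_scale_C fps_scale_Xn expr1 mulrA -rmorphM /= -exprSr.
Qed.

Lemma root_period k : X (k + n.+1)%N = X k.
Proof. by rewrite /X exprD (prim_expr_order e_prim) mulr1. Qed.

Lemma root0E : X 0 = y%:F / w ^+ 1.
Proof.
rewrite /X expr0 rmorph1 mul1r expr1; congr (_%:F / _).
by apply/funext => l; rewrite /fps_scale expr1n mul1r.
Qed.

Lemma f_root k : f^e.[X k] = z.
Proof.
elim: k => [|k IH]; last by rewrite -theta_root -theta_horner IH theta_z.
rewrite root0E expr1 horner_coef size_map_poly f_size; have w0 := fps_w_neq0 C.
rewrite /puiseux_z -[RHS]mul1r; apply: (canRL (mulfK _)); first by rewrite expf_neq0.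
rewrite big_distrl /= -[RHS]tofrac1 -y_root rmorph_sum /=; apply: eq_bigr => j _.
rewrite coef_map /= !tofracM tofracXn -fps_w_exp expr_div_n -!mulrA; congr (_ * _).
have jn : (j <= n.+1)%N by rewrite -ltnS.
rewrite mulrC -mulrA.
have -> : w ^+ n.+1 = w ^+ j * w ^+ (n.+1 - j) by rewrite -exprD subnKC.
by rewrite -mulrA mulKf ?expf_neq0.
Qed.

(** After cross-multiplication the coefficients of [w] are [e^l] and [e^k], since [y] starts with
    1. *)
Lemma root_inj k l : (k < n.+1)%N -> (l < n.+1)%N -> X k = X l -> k = l.
Proof.
move=> kn ln /eqP; have d0 m : fps_C (e ^+ m) * fps_Xn C 1 != 0.
  by rewrite mulf_neq0 ?fps_Xn_neq0 // fmorph_eq0 expf_neq0.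
rewrite eqr_div ?tofrac_eq0 // -!tofracM tofrac_eq => /eqP.
rewrite ![_ * (_ * fps_Xn C 1)]mulrC -!mulrA ![fps_C _ * (fps_Xn _ _ * _)]mulrCA.
move/(congr1 (fun c : fps C => c 1%N)); rewrite !fps_XnME /= !fps_CME /fps_scale y0 !mulr1.
by rewrite ?expr0 ?mulr1 => /eqP; rewrite (eq_prim_root_expr e_prim) !modn_small // => /eqP.
Qed.

Lemma f_split : f^e - z%:P = \prod_(k < n.+1) ('X - (X k)%:P).
Proof.
pose s := [seq X k | k : 'I_n.+1].
have fr k : root (f^e - z%:P) (X k).
  apply/rootP; rewrite hornerD hornerN hornerC.
  apply/eqP; rewrite subr_eq0; apply/eqP; exact: f_root.
have fm : f^e \is monic by rewrite monic_map.
have sz : size (f^e - z%:P) = n.+2.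
  by rewrite size_polyDl ?size_map_poly ?f_size // size_polyN (leq_ltn_trans (size_polyC_leq1 _)).
have lc : lead_coef (f^e - z%:P) = 1.
  rewrite lead_coefDl ?(monicP fm) //.
  by rewrite size_polyN size_map_poly f_size (leq_ltn_trans (size_polyC_leq1 _)).
rewrite (@all_roots_prod_XsubC _ (f^e - z%:P) s).
- by rewrite lc scale1r /s big_map big_enum.
- by rewrite sz size_map size_enum_ord.
- by apply/allP => x /mapP[k _ ->]; apply: fr.
- rewrite uniq_rootsE map_inj_in_uniq ?enum_uniq // => k l _ _ E.
  by apply/val_inj/root_inj; rewrite ?ltn_ord.
Qed.

End Puiseux.

(** * Roots of the squared difference polynomial that are series in [1 / z] *)

Section Rigidity.

Variables (F C : fieldType) (kappa : {rmorphism F -> C}) (n : nat) (f : {poly F}).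
Hypotheses (f_monic : f \is monic) (f_size : size f = n.+2).
Hypothesis char0 : forall k, k.+1%:R != 0 :> F.
Variables (y : fps C) (e : C).
Hypothesis y0 : y 0%N = 1.
Hypothesis y_root : \sum_(j < n.+2) fps_C (kappa f`_j) * fps_Xn C (n.+1 - j)%N * y ^+ j = 1.
Hypothesis e_prim : n.+1.-primitive_root e.

Local Notation Om := {fraction fps C}.
Local Notation emb := (fps_emb kappa).
Local Notation w := (@fps_w C).
Local Notation "p ^e" := (map_poly emb p) (at level 2, format "p ^e").
Local Notation X := (puiseux_root y e).
Local Notation z := (puiseux_z C n).
Local Notation th := (theta e_prim).

Definition horner_z (q : {poly F}) : Om := q^e.[z].
HB.instance Definition _ := GRing.RMorphism.copy horner_z (horner_eval z \o map_poly emb).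

Lemma horner_zE q : horner_z q = q^e.[z]. Proof. by []. Qed.

Lemma pole_z (q : {poly F}) : q != 0 -> exists a : fps C, a 0%N != 0 /\
  horner_z q = a%:F / w ^+ (n.+1 * (size q).-1)%N.
Proof.
move=> q0; have [||//|a [a0 E]] := @horner_pole F C kappa 1 n.+1 q; rewrite ?oner_neq0 //.
by exists a; split=> //; rewrite horner_zE -E tofrac1 mul1r.
Qed.

Lemma horner_z_inj : injective horner_z.
Proof.
apply: raddf_inj => q qz; apply/eqP; apply: contraT => /pole_z[a [a0]].
move/eqP; rewrite qz eq_sym mulf_eq0 invr_eq0 expf_eq0 (negPf (fps_w_neq0 C)) andbF orbF.
by rewrite tofrac_eq0 => /eqP E; rewrite E fps_zeroE eqxx in a0.
Qed.

Variable g : {poly F}.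

Definition polyCC (a : F) : {poly {poly F}} := a%:P%:P.
HB.instance Definition _ := GRing.RMorphism.copy polyCC (polyC \o polyC).

(* [prod_(i, j) ('X - (g(x_i) - g(x_j))^2)], where the [x_i] are the roots of [f - z]
   and [z] is the variable of the coefficient ring. *)
Definition diff_poly : {poly {poly F}} :=
  diff_norm n (map_poly polyCC f - ('X%:P)%:P) (map_poly polyCC g) 'X.

Let u k : Om := g^e.[X k].

Lemma diff_poly_split :
  map_poly horner_z diff_poly = \prod_(i < n.+1) \prod_(j < n.+1) ('X - ((u i - u j) ^+ 2)%:P).
Proof.
have mapCC (q : {poly F}) : map_poly (map_poly horner_z) (map_poly polyCC q) = map_poly polyC q^e.
  rewrite -!map_poly_comp; apply: eq_map_poly => a /=.
  by rewrite map_polyC /= horner_zE map_polyC hornerC.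
rewrite /diff_poly (diff_norm_map (map_poly horner_z)) rmorphB /= !mapCC map_polyX.
rewrite !map_polyC /= map_polyC /= horner_zE map_polyX hornerX.
rewrite (@diff_norm_prod _ n _ _ _ (fun k : 'I_n.+1 => (X k)%:P)).
- apply: eq_bigr => i _; apply: eq_bigr => j _.
  by rewrite !horner_map /= -!polyCB -polyC_exp.
- rewrite -map_polyC /= -rmorphB /= (f_split f_monic f_size y0 y_root e_prim) rmorph_prod /=.
  by apply: eq_bigr => k _; rewrite rmorphB /= map_polyX map_polyC.
by move=> k l /polyC_inj/(root_inj y0 e_prim (ltn_ord k) (ltn_ord l))/val_inj.
Qed.

Lemma diff_poly_root (i j : 'I_n.+1) : root (map_poly horner_z diff_poly) ((u i - u j) ^+ 2).
Proof.
rewrite diff_poly_split rootE horner_prod; apply/prodf_eq0; exists i => //.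
by rewrite horner_prod; apply/prodf_eq0; exists j => //; rewrite hornerXsubC subr_eq0.
Qed.

Lemma diff_poly_rigid (b : fps C) : b 0%N = 0 -> th b%:F = b%:F ->
  root (map_poly horner_z diff_poly) b%:F -> b = 0.
Proof.
move=> b0 tb; rewrite diff_poly_split rootE horner_prod => /prodf_eq0[i _].
rewrite horner_prod => /prodf_eq0[j _]; rewrite hornerXsubC subr_eq0 => /eqP bE.
have char0C k : k.+1%:R != 0 :> Om by rewrite -(rmorph_nat emb) fmorph_eq0.
have tu k : th (u k) = u k.+1 by rewrite theta_horner theta_root.
have uP k : u (k + n.+1)%N = u k by rewrite /u root_period.
have w0 : u i - u j = 0 -> b = 0.
  by move=> w0; apply/eqP; rewrite -tofrac_eq0 bE w0 expr0n.
(* As [theta] fixes the square [b], it fixes or negates the difference. *)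
have : th (u i - u j) ^+ 2 == (u i - u j) ^+ 2 by rewrite -rmorphXn /= -bE tb.
rewrite eqf_sqr => /orP[/eqP/(fixed_difference char0C (ltn0Sn n) tu uP)/w0 //|/eqP tw].
pose iota := frac_lift horner_z_inj.
have iotaE q : iota q%:F = horner_z q by apply: frac_liftE.
have iota_map (D : {poly {poly F}}) :
    map_poly iota (map_poly (@FracField.tofrac _) D) = map_poly horner_z D.
  by rewrite -map_poly_comp; apply: eq_map_poly => q; apply: iotaE.
have char0Q k : k.+1%:R != 0 :> {fraction {poly F}} by rewrite -(fmorph_eq0 iota) rmorph_nat.
have [c cE] := sq_diff_rational char0Q tu uP
  (etrans (iota_map diff_poly) diff_poly_split) (ltn_ord i) (ltn_ord j) tw.
(* Monicity is read off the factorisation over [Om], since [horner_z] is injective. *)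
have D_monic : diff_poly \is monic.
  apply/eqP/horner_z_inj; rewrite rmorph1 -(lead_coef_map_inj horner_z_inj (rmorph0 _)).
  apply/eqP; rewrite -[_ == _]/(_ \is monic) diff_poly_split.
  by apply: rpred_prod => k _; apply: rpred_prod => l _; rewrite monicXsubC.
have [q qE] : exists q, c = q%:F.
  apply: (fraction_integrally_closed D_monic); rewrite -(fmorph_root iota) iota_map.
  rewrite -cE; exact: diff_poly_root.
have bq : b%:F = horner_z q by rewrite bE cE qE; apply: iotaE.
(* A nonzero polynomial in [z] has a pole at infinity or is a nonzero constant, whereas [b] vanishes
   there. *)
have [q0|/pole_z[a [a0 E]]] := eqVneq q 0.
  by apply/eqP; rewrite -tofrac_eq0 bq q0 rmorph0.
have w_exp := expf_neq0 (n.+1 * (size q).-1) (fps_w_neq0 C).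
move: bq; rewrite E => /eqP; rewrite -[b%:F]divr1 eqr_div ?oner_neq0 // mulr1 fps_w_exp -tofracM tofrac_eq.
by move/eqP/(congr1 (fun c : fps C => c 0%N)); rewrite fps_mul0E b0 mul0r => /esym/eqP; rewrite (negPf a0).
Qed.

End Rigidity.

(** * Polynomial Lueroth theorem *)

Lemma root_subC (R : idomainType) (p : {poly R}) c x : root (p - c%:P) x = (p.[x] == c).
Proof. by rewrite rootE hornerD hornerN hornerC subr_eq0. Qed.

Lemma poly_subC_coef0 (R : nzRingType) m (E : nat -> R) a :
  (\poly_(j < m.+1) E j - a%:P)`_0 = E 0%N - a.
Proof. by rewrite coefB coef_poly coefC. Qed.

Section CommonDenominator.

Variable F : fieldType.

Lemma common_denominator (p : {poly {fraction {poly F}}}) :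
  exists (d : {poly F}) (q : {poly {poly F}}),
    d != 0 /\ d%:F *: p = map_poly (@FracField.tofrac _) q.
Proof.
elim/poly_ind: p => [|p c [d [q [d0 E]]]].
  by exists 1, 0; rewrite oner_neq0 rmorph0 scaler0.
have [a [b [b0 ->]]] := fractionP c.
exists (b * d), ((b *: q) * 'X + (a * d)%:P); split; first by rewrite mulf_neq0.
rewrite tofracM [RHS]rmorphD /= [X in _ = X + _]rmorphM /= map_polyX map_polyC /= map_polyZ /= -E scalerDr tofracM.
rewrite scalerA -scalerAl; congr (_ + _).
have bf0 : b%:F != 0 by rewrite tofrac_eq0.
have cancel (L : fieldType) (x v t : L) : x != 0 -> x * v * (t / x) = t * v.
  by move=> x0; rewrite mulrCA [x * v]mulrC mulfK.
by rewrite -mul_polyC -polyCM cancel.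
Qed.

End CommonDenominator.

(* [r]-adic expansion, with the powers of ['X] and of [r] exchanged. *)
Lemma adic_expansion (F : fieldType) (r : {poly F}) d (p : {poly F}) :
  size r = d.+2 ->
  exists c : 'I_d.+1 -> {poly F}, p = \sum_(j < d.+1) (c j \Po r) * 'X^j.
Proof.
move=> sr; have r0 : r != 0 by rewrite -size_poly_gt0 sr.
elim: {p}(size p).+1 {-2}p (ltnSn (size p)) => // k IH p pk.
have sm : (size (p %% r)%R <= d.+1)%N by rewrite -ltnS -sr ltn_modp.
have Em : p %% r = \sum_(j < d.+1) ((p %% r)`_j)%:P * 'X^j.
  rewrite -{1}[p %% r]coefK (poly_def _ _) (big_ord_widen _ (fun j => (p %% r)`_j *: 'X^j) sm).
  rewrite big_mkcond /=; apply: eq_bigr => j _; rewrite mul_polyC; case: ltnP => // h.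
  by rewrite nth_default ?scale0r.
have [p0|p0] := eqVneq (p %/ r) 0.
  exists (fun j => ((p %% r)`_j)%:P).
  rewrite {1}(divp_eq p r) p0 mul0r add0r {1}Em.
  by apply: eq_bigr => j _; rewrite comp_polyC.
have [|c Ec] := IH (p %/ r).
  have ppos : (0 < size p)%N.
    by rewrite size_poly_gt0; apply: contraNneq p0 => ->; rewrite div0p.
  have sd := size_divp p r0; rewrite sr in sd.
  by rewrite sd; move: (size p) pk ppos => s; lia.
exists (fun j => c j * 'X + ((p %% r)`_j)%:P).
rewrite {1}(divp_eq p r) {1}Em {1}Ec big_distrl -big_split /=; apply: eq_bigr => j _.
by rewrite comp_polyD comp_polyM comp_polyX comp_polyC mulrDl mulrAC.
Qed.

Section Luroth.

Variables (F C : fieldType) (kappa : {rmorphism F -> C}) (n : nat) (f : {poly F}).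
Hypotheses (f_monic : f \is monic) (f_size : size f = n.+2).
Variables (y : fps C) (e : C).
Hypothesis y0 : y 0%N = 1.
Hypothesis y_root : \sum_(j < n.+2) fps_C (kappa f`_j) * fps_Xn C (n.+1 - j)%N * y ^+ j = 1.
Hypothesis e_prim : n.+1.-primitive_root e.

Local Notation Om := {fraction fps C}.
Local Notation emb := (fps_emb kappa).
Local Notation w := (@fps_w C).
Local Notation "p ^e" := (map_poly emb p) (at level 2, format "p ^e").
Local Notation X := (puiseux_root y e).
Local Notation z := (puiseux_z C n).
Local Notation th := (theta e_prim).

(** Substitution of the root [X 0] for the variable. It is injective and sends [f] to [z], so [F(x)]
    embeds into the Puiseux field. *)
Definition horner_x (q : {poly F}) : Om := q^e.[X 0].
HB.instance Definition _ := GRing.RMorphism.copy horner_x (horner_eval (X 0) \o map_poly emb).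

Lemma horner_xE q : horner_x q = q^e.[X 0]. Proof. by []. Qed.

Lemma pole_x (q : {poly F}) : q != 0 -> exists a : fps C, a 0%N != 0 /\
  horner_x q = a%:F / w ^+ (size q).-1.
Proof.
move=> q0; have [||//|a [a0 E]] := @horner_pole F C kappa y 1 q; rewrite ?y0 ?oner_neq0 //.
by exists a; split=> //; rewrite horner_xE root0E E mul1n.
Qed.

Lemma horner_x_inj : injective horner_x.
Proof.
apply: raddf_inj => q qz; apply/eqP; apply: contraT => /pole_x[a [a0]].
move/eqP; rewrite qz eq_sym mulf_eq0 invr_eq0 expf_eq0 (negPf (fps_w_neq0 C)) andbF orbF.
by rewrite tofrac_eq0 => /eqP E; rewrite E fps_zeroE eqxx in a0.
Qed.

Variable g : {poly F}.

Let u k : Om := g^e.[X k].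

Let uS k : th (u k) = u k.+1. Proof. by rewrite theta_horner theta_root. Qed.

Let iter_u k m : iter k th (u m) = u (k + m)%N.
Proof. by elim: k => [//|k IH]; rewrite iterS IH uS. Qed.

Let XmodE k : X (k %% n.+1)%N = X k.
Proof. by apply: (periodic_mod _ (g := X)) => m; apply: root_period. Qed.

Let iter_inj k : injective (iter k th).
Proof. by elim: k => [//|k IH] a b; rewrite !iterS => /fmorph_inj/IH. Qed.

(* A subgroup of the cyclic monodromy group at infinity: the fibre of [(f, g)] through [X 0]. *)
Definition same_image : pred 'I_n.+1 := [pred k : 'I_n.+1 | u k == u 0].
Local Notation H := same_image.

Let H0 : H ord0. Proof. by rewrite /same_image /= eqxx. Qed.

Let u_mod k : u (k %% n.+1)%N = u k. Proof. by rewrite /u XmodE. Qed.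

Lemma same_image_add (k h : 'I_n.+1) : H h -> H (k + h)%R = H k.
Proof.
move=> Hh; have uh : u h = u 0 by apply/eqP; exact: Hh.
rewrite -[H k]/(u k == u 0) -[LHS]/(u (k + h)%R == u 0).
have -> : u (k + h)%R = iter h th (u k) by rewrite iter_u addnC -[RHS]u_mod.
have {1}-> : u 0 = iter h th (u 0) by rewrite iter_u addn0 uh.
exact: (inj_eq (@iter_inj h)).
Qed.

Let Q := \prod_(k | H k) ('X - (X k)%:P).

Let Q_monic : Q \is monic.
Proof. apply: monic_prod => k _. apply: monicXsubC. Qed.

Let Xinj (k l : 'I_n.+1) : X k = X l -> k = l.
Proof. by move/(root_inj y0 e_prim (ltn_ord k) (ltn_ord l))/val_inj. Qed.

Let QE : Q = \prod_(x <- [seq X k | k : 'I_n.+1 <- enum H]) ('X - x%:P).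
Proof. by rewrite big_map big_enum. Qed.

Let Q_dvd (p : {poly Om}) : (forall k : 'I_n.+1, H k -> root p (X k)) -> Q %| p.
Proof.
move=> pX; rewrite QE; apply: uniq_roots_dvdp.
  by apply/allP => x /mapP[k]; rewrite mem_enum => Hk ->; apply: pX.
by rewrite uniq_rootsE map_inj_uniq ?enum_uniq // => k l /Xinj.
Qed.

Let iota : {rmorphism {fraction {poly F}} -> Om} := frac_lift horner_x_inj.

Let iotaE q : iota q%:F = horner_x q. Proof. exact: frac_liftE. Qed.

(** The polynomial [p(T) - p(x)], with [T] the outer variable and [x] that of the coefficient
    ring. *)
Definition diff_quot (p : {poly F}) : {poly {poly F}} := map_poly polyC p - p%:P.

Let map_diff_quot p : map_poly iota (map_poly (@FracField.tofrac _) (diff_quot p)) =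
  p^e - (p^e.[X 0])%:P.
Proof.
rewrite !rmorphB /= !map_polyC /= iotaE; congr (_ - _).
rewrite -!map_poly_comp; apply: eq_map_poly => a /=.
by rewrite iotaE horner_xE map_polyC hornerC.
Qed.

Local Notation tofracp p := (map_poly (@FracField.tofrac _) (diff_quot p)).

Let D := gcdp (tofracp f) (tofracp g).

Let fX (k : nat) : f^e.[X k] = z. Proof. exact: (f_root f_size y_root e_prim). Qed.

(** The polynomial [f(T) - f(X 0)] has the simple roots [X k]; the gcd keeps those at which [g] also
    takes its value at [X 0]. Hence [Q] is, up to a scalar, defined over [F(X 0)]. *)
Let D_map : map_poly iota D %= Q.
Proof.
rewrite gcdp_map !map_diff_quot fX; apply/andP; split; last first.
  rewrite dvdp_gcd; apply/andP; split; apply: Q_dvd => k Hk; rewrite root_subC; last exact: Hk.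
  by apply/eqP/fX.
rewrite (f_split f_monic f_size y0 y_root e_prim) (bigID H) /= -/Q.
set Q' := \prod_(k | ~~ H k) _; set p2 := g^e - _.
have cop : coprimep Q' p2.
  rewrite coprimep_sym; apply: (big_ind (fun q => coprimep p2 q)); first exact: coprimep1.
    by move=> a b ca cb; rewrite coprimepMr ca cb.
  by move=> k Hk; rewrite coprimep_XsubC root_subC; exact: Hk.
have := dvdp_gcdl (Q * Q') p2; rewrite Gauss_dvdpl //.
by apply: coprimep_dvdr (dvdp_gcdr _ _) _; rewrite coprimep_sym.
Qed.

(** Every [X k] is a root of [f(T) - f(X 0)], which is monic with coefficients in [F[X 0]]. *)
Let x_integral k : integralOver horner_x (X k).
Proof.
apply: (@integral_root_monic _ _ _ _ (f^e - z%:P)).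
- rewrite (f_split f_monic f_size y0 y_root e_prim).
  by apply: monic_prod => l _; apply: monicXsubC.
- by rewrite root_subC; apply/eqP/fX.
apply/integral_poly => i; rewrite coefB coef_map coefC.
apply: integral_sub.
  rewrite [X in integralOver _ X](_ : _ = horner_x (f`_i)%:P); last by rewrite horner_xE map_polyC hornerC.
  exact: integral_id.
case: (i == 0)%N; last exact: integral0.
have <- : horner_x f = z := fX 0.
exact: integral_id.
Qed.

Let D0 : D != 0.
Proof. by rewrite -(map_poly_eq0 iota) -size_poly_eq0 (eqp_size D_map) size_poly_eq0 monic_neq0. Qed.

(* Up to sign the constant term of the gcd of [f(T) - f(x)] and [g(T) - g(x)]; being integral over
   [F[x]] it is a polynomial. *)
Lemma luroth_generator : exists r : {poly F}, horner_x r = \prod_(k | H k) (- X k).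
Proof.
pose c := D`_0 / lead_coef D.
have l0 : lead_coef (map_poly iota D) != 0 by rewrite lead_coef_eq0 map_poly_eq0 D0.
have cE : iota c = \prod_(k | H k) (- X k).
  have /eqp_eq := D_map; rewrite (monicP Q_monic) scale1r => E.
  rewrite rmorphM fmorphV -coef_map -lead_coef_map /= {1}E coefZ mulrAC divff // mul1r.
  rewrite -horner_coef0 horner_prod; apply: eq_bigr => k _.
  by rewrite hornerXsubC sub0r.
have [P Pm] : integralOver horner_x (iota c).
  rewrite cE; apply: (big_ind (integralOver horner_x)).
  - exact: integral1.
  - by move=> a b; apply: integral_mul.
  - by move=> k _; apply: integral_opp; apply: x_integral.
have -> : map_poly horner_x P = map_poly iota (map_poly (@FracField.tofrac _) P).
  by rewrite -map_poly_comp; apply: eq_map_poly => q; rewrite /= iotaE.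
rewrite fmorph_root => /(fraction_integrally_closed Pm)[r rE].
by exists r; rewrite -cE rE iotaE.
Qed.

Variable r : {poly F}.
Hypothesis rE : horner_x r = \prod_(k | H k) (- X k).

(** Compare poles: every [X k] has a simple pole, so the product has order [#|H|], and the order of
    [r] at [X 0] is its degree. *)
Lemma luroth_generator_size : size r = #|H|.+1.
Proof.
have e0 : e != 0.
  by apply/eqP => E; have := prim_expr_order e_prim; rewrite E expr0n => /esym/eqP; rewrite oner_eq0.
have y0k (k : nat) : fps_scale (e ^+ k) y 0%N = 1 by rewrite /fps_scale expr0 mul1r y0.
have [a [a0 E]] : exists a : fps C, a 0%N != 0 /\ \prod_(k | H k) (- X k) = a%:F / w ^+ #|H|.
  rewrite -sum1_card.
  apply: (big_ind2 (fun (s : Om) m => exists a : fps C, a 0%N != 0 /\ s = a%:F / w ^+ m)).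
  - by exists 1; rewrite tofrac1 divr1; split=> //; apply: oner_neq0.
  - move=> s m s' m' [a [a0 ->]] [b [b0 ->]]; exists (a * b).
    by rewrite fps_mul0E mulf_neq0 // tofracM exprD mulf_div.
  move=> k _; exists (- (fps_C (e ^+ k)^-1 * fps_scale (e ^+ k) y)); split.
    by rewrite fps_oppE fps_CME y0k mulr1 oppr_eq0 invr_eq0 expf_neq0.
  rewrite /puiseux_root tofracN expr1 !tofracM mulNr invfM mulrA; congr (- (_ / _)).
  rewrite mulrC; congr (_ * _); apply: (mulfI (x := (fps_C (e ^+ k))%:F)).
    by rewrite tofrac_eq0 fmorph_eq0 expf_neq0.
  rewrite mulfV; last by rewrite tofrac_eq0 fmorph_eq0 expf_neq0.
  by rewrite -tofracM -rmorphM mulfV ?rmorph1 // expf_neq0.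
have r0 : r != 0.
  apply: contraTneq isT => r0; move: rE; rewrite r0 rmorph0 E => /esym/eqP.
  rewrite mulf_eq0 invr_eq0 expf_eq0 (negPf (fps_w_neq0 C)) andbF orbF.
  by rewrite tofrac_eq0 => /eqP a00; rewrite a00 fps_zeroE eqxx in a0.
have [b [b0]] := pole_x r0; rewrite rE E => /(pole_unique a0 b0) ->.
by rewrite prednK // size_poly_gt0.
Qed.

(** [theta^h] permutes the factors of the product, because [H] is stable under the addition of
    [h]. *)
Lemma luroth_generator_fixed (h : 'I_n.+1) : H h -> r^e.[X h] = r^e.[X 0].
Proof.
move=> Hh; have iter_r k m : iter k th r^e.[X m] = r^e.[X (k + m)%N].
  by elim: k => [//|k IH]; rewrite iterS IH theta_horner theta_root.
have iter_X k m : iter k th (X m) = X (k + m)%N.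
  by elim: k => [//|k IH]; rewrite iterS IH theta_root.
have iter_prod k : iter k th (\prod_(l | H l) (- X l)) = \prod_(l | H l) (- X (k + l)%N).
  elim: k => [//|k IH]; rewrite iterS IH rmorph_prod; apply: eq_bigr => l _.
  by rewrite rmorphN /= theta_root.
rewrite -[X in X = _](congr1 (fun k => r^e.[X k]) (addn0 h)) -iter_r -horner_xE rE iter_prod.
rewrite [RHS](reindex_inj (addIr h)) /=; apply: eq_big => [l|l _]; first by rewrite same_image_add.
by rewrite addnC XmodE.
Qed.

(** Write [p] as the sum of the [c_j(r) x^j] with [j < #|H|]. The [c_j(r)] and [p] take the same
    values at all [X h] with [h] in [H], so the polynomial with coefficients [c_j(r(X 0))], minus
    [p(X 0)], has [#|H|] roots but smaller degree. It is 0, and its constant term gives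
    [p = c_0(r)]. *)
Lemma luroth_comp (p : {poly F}) : (forall h : 'I_n.+1, H h -> p^e.[X h] = p^e.[X 0]) ->
  exists q, p = q \Po r.
Proof.
move=> pH; have sH := luroth_generator_size.
have [m mH] : exists m, #|H| = m.+1.
  by exists #|H|.-1; rewrite prednK //; apply/card_gt0P; exists ord0; apply: H0.
rewrite mH in sH; have [c cE] := adic_expansion p sH.
exists (c ord0); apply: horner_x_inj.
pose P := \poly_(j < m.+1) horner_x (c (inord j) \Po r) - (horner_x p)%:P.
have PE (h : 'I_n.+1) : H h -> root P (X h).
  move=> Hh; rewrite root_subC [horner_x p]horner_xE -(pH _ Hh).
  rewrite {1}cE horner_poly rmorph_sum horner_sum /=; apply/eqP/eq_bigr => j _.
  rewrite inord_val rmorphM /= hornerM map_polyXn hornerXn horner_xE; congr (_ * _).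
  by rewrite !map_comp_poly !horner_comp luroth_generator_fixed.
have sP : (size P <= m.+1)%N.
  rewrite (leq_trans (size_polyD _ _)) // geq_max size_poly size_polyN.
  exact: leq_trans (size_polyC_leq1 _) _.
have P0 : P = 0.
  have /dvdp_leq := Q_dvd PE; case: eqVneq => // _ /(_ isT).
  have -> : size Q = #|H|.+1 by rewrite QE (size_prod_XsubC _ id) size_map -cardE.
  by rewrite mH leqNgt ltnS sP.
have := poly_subC_coef0 m (fun j => horner_x (c (inord j) \Po r)) (horner_x p).
rewrite -/P P0 coef0 => /esym/eqP; rewrite subr_eq0 => /eqP <-.
by congr (horner_x (c _ \Po r)); apply/val_inj; rewrite /= inordK.
Qed.

(** [r(T) - r(x)] vanishes at the [X h] with [h] in [H], so the gcd [D] divides it. Clearing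
    denominators in Bezout's relation leaves a polynomial identity that can be evaluated at points,
    with [d] depending on [x] alone. *)
Lemma luroth_bezout : exists (d : {poly F}) (A B : {poly {poly F}}), d != 0 /\
  d *: diff_quot r = A * diff_quot f + B * diff_quot g.
Proof.
have Dr : D %| tofracp r.
  rewrite -(dvdp_map iota) map_diff_quot (eqp_dvdl _ D_map).
  apply: Q_dvd => h Hh.
  by rewrite root_subC luroth_generator_fixed.
have [[a b] /= ab] := Bezoutp (tofracp f) (tofracp g).
have /dvdpP[q qE] : (a * tofracp f + b * tofracp g) %| tofracp r by rewrite (eqp_dvdl _ ab).
have [da [A [da0 AE]]] := common_denominator (q * a).
have [db [B [db0 BE]]] := common_denominator (q * b).
exists (da * db), (db *: A), (da *: B); split; first by rewrite mulf_neq0.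
have inj : injective (map_poly (@FracField.tofrac {poly F})).
  by apply: map_inj_poly; [move=> x z /eqP; rewrite tofrac_eq => /eqP|apply: rmorph0].
apply: inj; rewrite rmorphD !rmorphM /= !map_polyZ /= -AE -BE qE tofracM.
rewrite mulrDr scalerDr !mulrA; set tf := tofracp f; set tg := tofracp g.
rewrite !scalerAl !scalerA; congr (_ * _ + _); by rewrite [db%:F * _]mulrC.
Qed.

End Luroth.

Lemma diff_quot_horner (F : fieldType) (p : {poly F}) a b :
  (diff_quot p).[b%:P].[a] = p.[b] - p.[a].
Proof.
rewrite hornerD hornerN hornerC hornerD hornerN; congr (_ - _).
by rewrite horner_map hornerC.
Qed.

(** The last clause is the pointwise form of the statement that [r] is a rational function of [f]
    and [g]. The closed field provides the primitive root of unity. *)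
Theorem polynomial_luroth (F : fieldType) (C : closedFieldType) (kappa : {rmorphism F -> C})
    n (f g : {poly F}) :
  (forall k, k.+1%:R != 0 :> C) -> f \is monic -> size f = n.+2 ->
  exists r ft gt d : {poly F}, [/\ f = ft \Po r, g = gt \Po r, d != 0, (1 < size r)%N &
    forall a b, f.[a] = f.[b] -> g.[a] = g.[b] -> d.[a] != 0 -> r.[a] = r.[b]].
Proof.
move=> char0 f_monic f_size.
have [y [y0 y_root]] := puiseux_series kappa f_monic f_size char0.
have [e e_prim] := closed_prim_root char0 (ltn0Sn n).
have [r rE] := luroth_generator f_monic f_size y0 y_root e_prim g.
have sr := luroth_generator_size y0 e_prim rE.
have comp := luroth_comp y0 e_prim rE.
have [ft fE] : exists q, f = q \Po r.
  by apply: comp => h _; rewrite !(f_root f_size y_root e_prim).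
have [gt gE] : exists q, g = q \Po r.
  by apply: comp => h /eqP.
have [d [A [B [d0 E]]]] := luroth_bezout f_monic f_size y0 y_root e_prim rE.
exists r, ft, gt, d; split=> //.
  by rewrite sr ltnS; apply/card_gt0P; exists ord0; rewrite unfold_in /same_image /=.
move=> a b fab gab da; move: E (diff_quot_horner f a b) (diff_quot_horner g a b) (diff_quot_horner r a b).
move: (diff_quot f) (diff_quot g) (diff_quot r) => P Q S E; rewrite fab gab !subrr => PE QE SE.
have := congr1 (fun q : {poly {poly F}} => q.[b%:P].[a]) E.
rewrite /= !(hornerZ, hornerD, hornerM) PE QE SE !mulr0 addr0 => /eqP.
by rewrite mulf_eq0 (negPf da) subr_eq0 /= => /eqP.
Qed.

(** * From convergent to formal power series *)

Lemma sum_multiples (V : nmodType) d m (G : nat -> V) : (0 < d)%N ->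
  (forall i, ~~ (d %| i)%N -> G i = 0) ->
  \sum_(i < (d * m).+1) G i = \sum_(i < m.+1) G (d * i)%N.
Proof.
move=> d0 G0; elim: m => [|m IH]; first by rewrite muln0 !big_ord1 muln0.
rewrite big_ord_recr [RHS]big_ord_recr -IH /=; congr (_ + _).
rewrite -!(big_mkord xpredT) mulnS addnC (@big_cat_nat _ _ _ (d * m).+1) //=; last first.
  by rewrite -addn1 leq_add2l.
rewrite [X in _ + X = _](_ : _ = 0) ?addr0 // big_nat_cond big1 // => i /andP[/andP[i1 i2] _].
apply: G0; apply/negP => /dvdnP[k ik]; move: i1 i2; rewrite ik [(k * d)%N]mulnC ltn_mul2l d0 /= => mk.
by rewrite addnC -mulnS ltn_mul2l d0 /= ltnS leqNgt mk.
Qed.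

Section FpsSubst.

Variables (F C : fieldType) (kappa : {rmorphism F -> C}) (c : C) (n : nat).

(* The substitution of [c * 'X^(n.+1)] for the variable. *)
Definition fps_subst (a : fps F) : fps C := fun l =>
  if (n.+1 %| l)%N then kappa (a (l %/ n.+1)%N) * c ^+ (l %/ n.+1) else 0.

Let subst_zmod : zmod_morphism fps_subst.
Proof.
move=> a b; apply/funext => l; rewrite fps_addE fps_oppE /fps_subst.
by case: ifP; rewrite ?subr0 // fps_addE fps_oppE rmorphB mulrBl.
Qed.
Let subst_monoid : monoid_morphism fps_subst.
Proof.
split=> [|a b]; apply/funext => l.
  rewrite -[1]/(fps_C 1) -[RHS]/(fps_C 1 l) /fps_subst /fps_C; case: l => [|l].
    by rewrite dvdn0 div0n rmorph1 mulr1.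
  case: ifP => // dl; case: eqP => [E|]; last by rewrite mulr0n rmorph0 mul0r.
  by move/divnK: dl; rewrite E.
rewrite fps_mulE /fps_subst; case: ifPn => [/dvdnP[m ->]|nl]; last first.
  rewrite big1 // => i _; case: ifPn => [ni|]; last by rewrite mul0r.
  case: ifPn => [ni2|]; last by rewrite mulr0.
  by move: (dvdn_add ni ni2); rewrite (subnKC (ltn_ord i : (i <= l)%N)) (negPf nl).
pose G i := (if (n.+1 %| i)%N then kappa (a (i %/ n.+1)%N) * c ^+ (i %/ n.+1) else 0) *
  (if (n.+1 %| m * n.+1 - i)%N then kappa (b ((m * n.+1 - i) %/ n.+1)%N) * c ^+ ((m * n.+1 - i) %/ n.+1) else 0).
have G0 i : ~~ (n.+1 %| i)%N -> G i = 0 by rewrite /G => /negPf ->; rewrite mul0r.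
rewrite -[RHS]/(\sum_(i < (m * n.+1).+1) G i) [(m * n.+1)%N in RHS]mulnC (sum_multiples _ _ G0) //.
rewrite mulnK // fps_mulE rmorph_sum big_distrl /=; apply: eq_bigr => i _.
have im : (i <= m)%N by rewrite -ltnS.
rewrite /G [(m * _)%N]mulnC -mulnBr !dvdn_mulr // !mulKn // rmorphM mulrACA -exprD.
by rewrite subnKC.
Qed.
HB.instance Definition _ := GRing.isZmodMorphism.Build (fps F) (fps C) fps_subst subst_zmod.
HB.instance Definition _ := GRing.isMonoidMorphism.Build (fps F) (fps C) fps_subst subst_monoid.

Lemma fps_subst_C x : fps_subst (fps_C x) = fps_C (kappa x).
Proof.
apply/funext => -[|l]; rewrite /fps_subst /fps_C; first by rewrite dvdn0 div0n !mulr1n mulr1.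
case: ifP => // dl; case: eqP => [E|]; last by rewrite !mulr0n rmorph0 mul0r.
by move/divnK: dl; rewrite E.
Qed.

Lemma fps_subst_Xn k : fps_subst (fps_Xn F k) = fps_C (c ^+ k) * fps_Xn C (n.+1 * k)%N.
Proof.
apply/funext => l; rewrite fps_CME /fps_subst /fps_Xn; case: ifPn => [/dvdnP[m ->]|nl].
  rewrite mulnK // mulnC eqn_mul2l /=; case: eqP => [->|]; first by rewrite rmorph1 mul1r mulr1.
  by rewrite rmorph0 mul0r mulr0.
by case: eqP nl => [->|]; rewrite ?mulr0 // dvdn_mulr.
Qed.

Lemma fps_subst_eq0 a : c != 0 -> fps_subst a = 0 -> a = 0.
Proof.
move=> c0 a0; apply/funext => m; move/(congr1 (fun b : fps C => b (n.+1 * m)%N)): a0.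
rewrite /fps_subst dvdn_mulr // mulKn // => /eqP.
by rewrite mulf_eq0 expf_eq0 (negPf c0) andbF orbF fmorph_eq0 => /eqP.
Qed.

End FpsSubst.

(** With [s = k w^m] and [z = w^-m = k / s] this is [s^l (p z^i) = p k^i s^(l - i)]. *)
Lemma pole_shift (L : fieldType) (k w p : L) m i l : w != 0 -> (i <= l)%N ->
  k ^+ l * w ^+ (m * l) * (p * (w ^+ m)^-1 ^+ i) = p * k ^+ i * (k ^+ (l - i) * w ^+ (m * (l - i))).
Proof.
move=> w0 il; rewrite -{1 2}(subnK il) mulnDr !exprD exprVn -exprM.
have : w ^+ (m * i) != 0 by rewrite expf_neq0.
move: (w ^+ _) (w ^+ _) (k ^+ _) (k ^+ _) => a b c d a0.
by field.
Qed.

Section FormalVanishing.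

Variables (F : fieldType) (C : closedFieldType) (kappa : {rmorphism F -> C}) (n : nat).
Variables f g : {poly F}.
Hypotheses (f_monic : f \is monic) (f_size : size f = n.+2).
Hypothesis char0 : forall k, k.+1%:R != 0 :> F.

(** The hypothesis is [D(c / s, b(s)) = 0] for [D = diff_poly], multiplied by [s^L] to stay among
    power series. Substituting [s = c w^(n+1)] turns [c / s] into [z], and [b] into a series in
    [w^(n+1)], which [theta] fixes; then [diff_poly_rigid] applies. *)
Lemma formal_vanishing (c : F) (b : fps F) L :
  c != 0 -> b 0%N = 0 -> (forall j, size ((diff_poly n f g)`_j)%R <= L.+1)%N ->
  \sum_(j < size (diff_poly n f g)) (\sum_(i < L.+1)
    fps_C ((diff_poly n f g)`_j`_i * c ^+ i) * fps_Xn F (L - i)%N) * b ^+ j = 0 ->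
  b = 0.
Proof.
move=> c0 b0 sL E.
have char0C k : k.+1%:R != 0 :> C by rewrite -(rmorph_nat kappa) fmorph_eq0.
have [y [y0 y_root]] := puiseux_series kappa f_monic f_size char0C.
have [e e_prim] := closed_prim_root char0C (ltn0Sn n).
have kc0 : kappa c != 0 by rewrite fmorph_eq0.
apply: (@fps_subst_eq0 _ _ kappa (kappa c) n) => //.
apply: (diff_poly_rigid f_monic f_size char0 y0 y_root (e_prim := e_prim) (g := g)).
- by rewrite /fps_subst dvdn0 div0n b0 rmorph0 mul0r.
- rewrite theta_tofrac; congr (_%:F); apply/funext => l; rewrite /fps_scale /fps_subst.
  case: ifP => [/dvdnP[m ->]|]; last by rewrite mulr0.
  by rewrite mulnC exprM (prim_expr_order e_prim) expr1n mul1r.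
move/(congr1 (fps_subst kappa (kappa c) n)): E; rewrite rmorph0 rmorph_sum /=.
move: (diff_poly n f g) sL => D sL; set B := fps_subst _ _ _ b => E.
have T0 : (fps_C (kappa c ^+ L))%:F * fps_w C ^+ (n.+1 * L) != 0.
  by rewrite mulf_neq0 ?expf_neq0 ?fps_w_neq0 // tofrac_eq0 fmorph_eq0 expf_neq0.
rewrite rootE -(mulrI_eq0 _ (mulfI T0)).
rewrite (@horner_coef_wide _ (size D)) ?size_poly //.
apply/eqP; rewrite -[RHS]tofrac0 -E raddf_sum big_distrr /=; apply: eq_bigr => j _.
rewrite coef_map /= !rmorphM !rmorphXn /= mulrA; congr (_ * _).
rewrite horner_zE (@horner_coef_wide _ L.+1); last by rewrite (leq_trans (size_poly _ _)).
rewrite !rmorph_sum big_distrr /=; apply: eq_bigr => i _.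
have iL : (i <= L)%N by rewrite -ltnS.
rewrite coef_map /= rmorphM /= fps_subst_C fps_subst_Xn [kappa (_ * _)]rmorphM rmorphXn /=.
rewrite !(rmorphM (@fps_C C)) !(rmorphXn (@fps_C C)) /= !tofracM !tofracXn -fps_w_exp.
by rewrite /puiseux_z pole_shift // fps_w_neq0.
Qed.

End FormalVanishing.

(** * Evaluation of convergent series as a ring operation *)

Section PSeriesEval.

Local Open Scope R_scope.

Variable r : R.

Definition disk_analytic (a : nat -> R) := forall x, Rabs x < r -> Rbar_lt (Rabs x) (CV_radius a).

Lemma disk_analytic_ext (a b : nat -> R) : (forall n, a n = b n) -> disk_analytic a -> disk_analytic b.
Proof. by move=> ab h x xr; rewrite -(CV_radius_ext _ _ ab); apply: h. Qed.

Lemma ex_pseries_disk_analytic a : (forall x, Rabs x < r -> ex_pseries a x) -> disk_analytic a.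
Proof.
move=> h x xr; set y := (Rabs x + r) / 2.
have y0 : 0 <= y by rewrite /y; have := Rabs_pos x; lra.
have yr : Rabs y < r by rewrite Rabs_pos_eq // /y; lra.
apply: (Rbar_lt_le_trans _ y); first by rewrite /= /y; lra.
apply: Rbar_not_lt_le => lt; apply: (CV_disk_outside a y); first by rewrite Rabs_pos_eq.
have := ex_series_lim_0 _ (h y yr); apply: is_lim_seq_ext => n.
by rewrite /scal /= /mult /= pow_n_pow Rmult_comm.
Qed.

(** Convergence on the whole disk is carried along with the value at [s]: products need it, and so
    does the identity theorem in the end. *)
Definition ps_eval s (a : nat -> R) v := [/\ Rabs s < r, disk_analytic a & PSeries a s = v].

End PSeriesEval.

Section EvalRing.

Variables r s : R.
Hypothesis sr : Rlt (Rabs s) r.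
Implicit Types (a b : fps R).

Local Notation evals := (ps_eval r s).

Lemma ps_evalD a b u v : evals a u -> evals b v -> evals (a + b) (u + v).
Proof.
case=> _ ha <- [_ hb <-]; split=> //.
  apply: ex_pseries_disk_analytic => x xr.
  exact: (ex_pseries_plus _ _ _ (CV_radius_inside _ _ (ha x xr)) (CV_radius_inside _ _ (hb x xr))).
exact: (PSeries_plus _ _ _ (CV_radius_inside _ _ (ha s sr)) (CV_radius_inside _ _ (hb s sr))).
Qed.

Lemma fps_mul_PS_mult a b n : (a * b) n = PS_mult a b n.
Proof.
rewrite fps_mulE /PS_mult.
have E (g : nat -> R) m : \sum_(i < m.+1) g i = sum_f_R0 g m.
  by elim: m => [|m IH]; [rewrite big_ord1|rewrite big_ord_recr /= IH].
by rewrite (E (fun i => a i * b (n - i)%N)).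
Qed.

Lemma ps_evalM a b u v : evals a u -> evals b v -> evals (a * b) (u * v).
Proof.
case=> _ ha <- [_ hb <-]; split=> //.
  apply: (disk_analytic_ext (a := PS_mult a b)) => [n|]; first by rewrite fps_mul_PS_mult.
  by apply: ex_pseries_disk_analytic => x xr; apply: ex_pseries_mult; [apply: ha|apply: hb].
rewrite (PSeries_ext _ _ s (fps_mul_PS_mult a b)); apply: PSeries_mult; [exact: ha|exact: hb].
Qed.

Lemma ps_eval_decr a : disk_analytic r (PS_decr_1 a) -> disk_analytic r a.
Proof. by move=> h x xr; rewrite -CV_radius_decr_1; apply: h. Qed.

Lemma ps_eval_decrE a v : evals (PS_decr_1 a) v -> evals a (a 0%N + s * v).
Proof.
case=> _ h <-; split=> //; first exact: ps_eval_decr.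
by rewrite (PSeries_decr_1 a) //; apply/CV_radius_inside/ps_eval_decr.
Qed.

Lemma ps_evalC c : evals (fps_C c) c.
Proof.
have {2}-> : c = fps_C c 0%N + s * 0 by rewrite mulr0 addr0.
apply: ps_eval_decrE; split=> //; last exact: (PSeries_const_0 s).
by move=> x _; rewrite (CV_radius_ext _ (fun=> 0%R)) // CV_radius_const_0.
Qed.

Lemma ps_evalX : evals (fps_Xn R 1) s.
Proof.
have {2}-> : s = fps_Xn R 1 0%N + s * 1 by rewrite mulr1 add0r.
apply: ps_eval_decrE; have -> : PS_decr_1 (fps_Xn R 1) = fps_C 1 by apply/funext => -[].
exact: ps_evalC.
Qed.

Lemma ps_evalXn a v k : evals a v -> evals (a ^+ k) (v ^+ k).
Proof.
move=> h; elim: k => [|k IH]; first exact: ps_evalC.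
by rewrite !exprS; apply: ps_evalM.
Qed.

Lemma ps_eval_sum n (a : 'I_n -> fps R) (v : 'I_n -> R) :
  (forall i, evals (a i) (v i)) -> evals (\sum_i a i) (\sum_i v i).
Proof.
move=> h; apply: (big_ind2 (fun (a : fps R) v => evals a v)) => [|a1 v1 a2 v2|i _].
- have := ps_evalC 0; by rewrite rmorph0.
- exact: ps_evalD.
- exact: h.
Qed.

End EvalRing.

(** Specialise the coefficient variable to [z] and the outer variable to [(g(x) - g(y))^2]; the norm
    then vanishes by [diff_norm_root]. *)
Lemma diff_poly_eval (F : fieldType) n (f g : {poly F}) z x y :
  f \is monic -> size f = n.+2 -> f.[x] = z -> f.[y] = z ->
  \sum_(j < size (diff_poly n f g)) ((diff_poly n f g)`_j).[z] * ((g.[x] - g.[y]) ^+ 2) ^+ j = 0.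
Proof.
move=> f_monic f_size fx fy; set v := (g.[x] - g.[y]) ^+ 2.
pose psi : {rmorphism {poly {poly F}} -> F} := horner_eval v \o map_poly (horner_eval z).
have psiCC p : map_poly psi (map_poly (@polyCC F) p) = p.
  rewrite -map_poly_comp map_poly_id // => a _ /=.
  by rewrite /psi /= /polyCC map_polyC /= /horner_eval !hornerC.
have E : psi (diff_poly n f g) = 0.
  rewrite /diff_poly diff_norm_map rmorphB /= !psiCC !map_polyC /= map_polyC map_polyX.
  rewrite /horner_eval hornerC hornerX -[X in _ - X%:P]/('X.[z]) hornerX.
  have sz : size (f - z%:P) = n.+2.
    by rewrite size_polyDl ?f_size // size_polyN (leq_ltn_trans (size_polyC_leq1 _)).
  apply: diff_norm_root => //; last 2 first.
  - by rewrite rootE hornerD hornerN hornerC fx subrr.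
  - by rewrite rootE hornerD hornerN hornerC fy subrr.
  rewrite monicE lead_coefDl ?(monicP f_monic) //.
  by rewrite size_polyN f_size (leq_ltn_trans (size_polyC_leq1 _)).
move: (diff_poly n f g) E => D E; rewrite -[RHS]E -[RHS]/((map_poly (horner_eval z) D).[v]).
rewrite (@horner_coef_wide _ (size D)) ?size_poly //.
by apply: eq_bigr => j _; rewrite coef_map.
Qed.

(** The series [W] below is [s^L D(c / s, s e(s)^2)]. It is 0 on a real interval, hence formally,
    and [formal_vanishing] gives [s e^2 = 0]. *)
Lemma expansion_vanishes n (f g : {poly R}) (c r al be : R) (e : nat -> R) (x1 x2 : R -> R) :
  f \is monic -> size f = n.+2 -> c != 0 ->
  Rlt 0 al -> Rlt al be -> Rlt be r -> Rbar_lt r (CV_radius e) ->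
  (forall s, Rle al s -> Rle s be -> [/\ f.[x1 s] * s = c, f.[x2 s] * s = c &
    (g.[x1 s] - g.[x2 s]) ^+ 2 = s * PSeries e s ^+ 2]) ->
  forall k, e k = 0.
Proof.
move=> f_monic f_size c0 al0 albe ber re h k.
set D := diff_poly n f g; pose L := (\max_(j < size D) size (D`_j)%R)%N.
pose b : fps R := fps_Xn R 1 * (e : fps R) ^+ 2.
have sL j : (size (D`_j)%R <= L.+1)%N.
  rewrite leqW //; case: (ltnP j (size D)) => [jD|Dj]; last by rewrite nth_default ?size_poly0.
  exact: (leq_bigmax (F := fun j : 'I_(size D) => size (D`_j)%R) (Ordinal jD)).
pose W : fps R := \sum_(j < size D) (\sum_(i < L.+1) fps_C (D`_j`_i * c ^+ i) * fps_Xn R (L - i)%N) * b ^+ j.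
have e_an : disk_analytic r e.
  by move=> x xr; apply: (Rbar_lt_trans _ r).
have W_eval s : Rle al s -> Rle s be -> ps_eval r s W 0.
  move=> als sbe; have sr : Rlt (Rabs s) r by rewrite Rabs_pos_eq; lra.
  have s0 : s != 0 by apply/eqP => E; move: als; rewrite E; apply/Rlt_not_le.
  have [fx1 fx2 ge] := h s als sbe.
  have Eb : ps_eval r s b ((g.[x1 s] - g.[x2 s]) ^+ 2).
    rewrite ge; apply: ps_evalM => //; first exact: ps_evalX.
    by apply: ps_evalXn => //; split.
  pose z := c / s.
  have fz x : f.[x] * s = c -> f.[x] = z by rewrite /z => <-; rewrite mulfK.
  pose v : R := \sum_(j < size D) (\sum_(i < L.+1) (D`_j`_i * c ^+ i) * s ^+ (L - i)) *
      ((g.[x1 s] - g.[x2 s]) ^+ 2) ^+ j.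
  suff : ps_eval r s W v.
    have -> // : v = 0.
    rewrite -[RHS](mulr0 (s ^+ L)) -(diff_poly_eval g f_monic f_size (fz _ fx1) (fz _ fx2)).
    symmetry; rewrite -/D big_distrr; apply: eq_bigr => j _; rewrite /= mulrA; congr (_ * _).
    rewrite (@horner_coef_wide _ L.+1) // big_distrr; apply: eq_bigr => i _ /=.
    rewrite mulrCA -mulrA; congr (_ * _); have iL : (i <= L)%N by rewrite -ltnS.
    rewrite /z expr_div_n mulrCA; congr (_ * _).
    by rewrite -{1}(subnK iL) exprD mulfK // expf_neq0.
  apply: (ps_eval_sum sr) => j; apply: (ps_evalM sr); last exact: (ps_evalXn sr).
  apply: (ps_eval_sum sr) => i; apply: (ps_evalM sr); first exact: (ps_evalC sr).
  have -> : fps_Xn R (L - i)%N = fps_Xn R 1 ^+ (L - i) by rewrite fps_Xn_exp mul1n.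
  apply: (ps_evalXn sr); exact: (ps_evalX sr).
have [_ W_an _] := W_eval al (Rle_refl _) (Rlt_le _ _ albe).
(* The convergence of [W] is known at points of the open disk, so a radius strictly between [be] and
   [r] is used. *)
have [q beq qr] : exists2 q, Rlt be q & Rlt q r by exists (Rdiv (Rplus be r) 2); lra.
have W0 : W = 0.
  apply/funext; apply: (@PSeries_identity W al be q).
  - by split=> //; apply: Rlt_le.
  - exact: beq.
  - by have := W_an q; rewrite Rabs_pos_eq; [apply|lra].
  - by move=> x [alx xbe]; have [] := W_eval x alx xbe.
have char0 m : m.+1%:R != 0 :> R by rewrite pnatr_eq0.
have b0 : b 0%N = 0 by rewrite /b fps_mul0E mul0r.
have := formal_vanishing (real_complex R : {rmorphism R -> complex R}) f_monic f_size char0 c0 b0 sL W0.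
move/eqP; by rewrite /b mulf_eq0 (negPf (fps_Xn_neq0 _ _)) expf_eq0 /= => /eqP ->.
Qed.

(** * Common right factors *)

Section Primitives.

Variable F : numFieldType.
Implicit Types p q r : {poly F}.

Lemma poly_primitive p : exists q, q^`() = p.
Proof.
(* At [i = 0] the division by zero yields 0, the constant of integration. *)
exists (\poly_(i < (size p).+1) (p`_i.-1 / i%:R)); apply/polyP => i.
rewrite coef_deriv coef_poly ltnS; case: ltnP => [_|pi]; last by rewrite mul0rn nth_default.
by rewrite -[LHS]mulr_natr divfK // pnatr_eq0.
Qed.

Lemma deriv_neq0 p : (1 < size p)%N -> p^`() != 0.
Proof.
case E : (size p) => [|[|m]] // _; apply/eqP => /(congr1 (fun q : {poly F} => q`_m)).
rewrite coef_deriv coef0 => /eqP; rewrite mulrn_eq0 /=.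
have -> : p`_m.+1 = lead_coef p by rewrite lead_coefE E.
by rewrite lead_coef_eq0 -size_poly_eq0 E.
Qed.

(** After cancelling [r'] one has [K * f'(r) = g'(r)]. Dividing [g'] by [f'] with remainder [s], the
    nonzero case of [(K - q(r)) f'(r) = s(r)] is impossible by degrees. *)
Lemma comp_poly_of_deriv (K f g r : {poly F}) :
  (1 < size f)%N -> (1 < size r)%N ->
  (g \Po r)^`() = K * (f \Po r)^`() -> exists q, K = q \Po r.
Proof.
move=> f1 r1 E; exists (g^`() %/ f^`()); apply/eqP; rewrite -subr_eq0.
have r'0 := deriv_neq0 r1; have f'0 := deriv_neq0 f1.
set q := _ %/ _; set s := g^`() %% f^`().
move: E; rewrite !deriv_comp mulrA => /(mulIf r'0); rewrite (divp_eq g^`() f^`()) -/q -/s.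
rewrite comp_polyD comp_polyM => E.
have {}E : (K - (q \Po r)) * (f^`() \Po r) = s \Po r by rewrite mulrBl -E addrC addKr.
apply: contraT => Kq; have s0 : s != 0.
  by rewrite -(comp_poly_eq0 _ r1) -E mulf_neq0 ?comp_poly_eq0.
have s_lt : (size s < size f^`())%N by rewrite ltn_modp.
have := congr1 (fun p : {poly F} => (size p).-1) E.
rewrite /= size_comp_poly size_mul ?comp_poly_eq0 //.
have := size_comp_poly f^`() r; move: Kq s0; rewrite -!size_poly_gt0.
move: (size (K - _)) (size (_ \Po r)) (size s) (size f^`()) (size r) s_lt r1 => a b c d e; nia.
Qed.

End Primitives.

Lemma is_derive_horner (p : {poly R}) x : is_derive (horner p : R -> R) x p^`().[x].
Proof.
elim/poly_ind: p x => [|p c IH] x.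
  apply: (is_derive_ext (fun=> IZR 0)) => [t|]; first by rewrite horner0.
  rewrite deriv0 horner0; exact: is_derive_const.
apply: (is_derive_ext (fun x => Rplus (Rmult p.[x] x) c)) => [t|]; first by rewrite hornerMXaddC.
have -> : (p * 'X + c%:P)^`().[x] = Rplus (Rplus (Rmult p^`().[x] x) (Rmult p.[x] 1)) 0.
  rewrite derivMXaddC hornerD hornerMX -[LHS]/(Rplus p.[x] (Rmult p^`().[x] x)); lra.
apply: (is_derive_plus (K := R_AbsRing) (V := R_NormedModule)); last exact: is_derive_const.
apply: (is_derive_mult (K := R_AbsRing)); [exact: IH|exact: is_derive_id|].
by move=> n m; apply: Rmult_comm.
Qed.

Lemma continuous_horner (p : {poly R}) x : continuous (horner p : R -> R) x.
Proof. by apply: ex_derive_continuous; exists p^`().[x]; apply: is_derive_horner. Qed.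

(** * Vanishing of [Psi] over a segment of levels *)

Section Oval.

Variables (f K : {poly R}) (x1 x2 : R -> R) (v0 v1 : R).
Hypotheses (f_size : (1 < size f)%N) (v01 : Rlt v0 v1).
Let I v := Rle v0 v /\ Rle v v1.
Hypothesis x1_cont : forall u, I u -> limit1_in x1 I (x1 u) u.
Hypothesis x2_cont : forall u, I u -> limit1_in x2 I (x2 u) u.
Hypothesis x12 : forall u, I u -> Rlt (x1 u) (x2 u).
Hypothesis fx1 : forall u, I u -> f.[x1 u] = u.
Hypothesis fx2 : forall u, I u -> f.[x2 u] = u.
Hypothesis f_gt : forall u, I u -> forall x, Rlt (x1 u) x /\ Rlt x (x2 u) -> Rlt u f.[x].
Hypothesis vanish : forall u, I u ->
  RInt (fun x => Rmult K^`().[x] (sqrt (Rminus f.[x] u))) (x1 u) (x2 u) = 0.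

Lemma primitive_values_eq (G : {poly R}) u : G^`() = K * f^`() -> Rle v0 u -> Rlt u v1 ->
  G.[x1 u] = G.[x2 u].
Proof.
move=> GE v0u uv1.
have [|M [e [v1M [Me exp]]]] := @oval_family_expansion (horner f) (horner f^`()) (horner K^`()) (horner K) (horner G)
  x1 x2 v0 v1 (is_derive_horner f) (is_derive_horner K) _ (fun x => @continuous_horner K^`() x) v01 x1_cont x2_cont x12
  fx1 fx2 f_gt vanish.
  by move=> x; have := is_derive_horner G x; rewrite GE hornerM.
(* The identity theorem needs a proper interval strictly inside the disk: the levels of [[v0, u1]]
   provide it, and [u2 < v1] leaves the margin. *)
have [u1 [u2 [v0u1 uu1 u12 u2v]]] : exists u1 u2, [/\ Rlt v0 u1, Rle u u1, Rlt u1 u2 & Rlt u2 v1].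
  by exists (Rdiv (Rplus u v1) 2), (Rdiv (Rplus u (Rmult 3 v1)) 4); split; lra.
have [n f_sz] : exists n, size f = n.+2 by case: (size f) f_size => [|[|n]] // _; exists n.
set a := lead_coef f; have a0 : a != 0 by rewrite lead_coef_eq0 -size_poly_gt0 f_sz.
have fM_sz : size (f - M%:P) = n.+2.
  by rewrite size_polyDl ?f_sz // size_polyN (leq_ltn_trans (size_polyC_leq1 _)).
have fM_lead : lead_coef (f - M%:P) = a.
  by rewrite lead_coefDl // size_polyN f_sz (leq_ltn_trans (size_polyC_leq1 _)).
have inv_lt w w' : Rlt w w' -> Rlt w' M -> Rlt (Rinv (Rminus M w)) (Rinv (Rminus M w')).
  by move=> ww' wM; apply: Rinv_lt_contravar; [apply: Rmult_lt_0_compat|]; lra.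
have e0 k : e k = 0.
  (* For [f(x) = w] and [s = 1 / (M - w)] the monic polynomial [(f - M) / a] takes the value
     [- 1 / (a s)], whence [c = - 1 / a]. *)
  apply: (@expansion_vanishes n (a^-1 *: (f - M%:P)) G (- a^-1) (Rinv (Rminus M u2))
    (Rinv (Rminus M v0)) (Rinv (Rminus M u1)) e (fun s => x1 (Rminus M (Rinv s))) (fun s => x2 (Rminus M (Rinv s)))).
  - by rewrite monicE lead_coefZ fM_lead mulVf.
  - by rewrite size_scale ?invr_eq0.
  - by rewrite oppr_eq0 invr_eq0.
  - by apply: Rinv_0_lt_compat; lra.
  - by apply: inv_lt; lra.
  - by apply: inv_lt; lra.
  - by apply: (Rbar_lt_le_trans _ (Rinv (Rminus M v1))) => //; apply: inv_lt; lra.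
  move=> s s1 s2; have s0 : Rlt 0 s.
    by apply: (Rlt_le_trans _ _ _ _ s1); apply: Rinv_0_lt_compat; lra.
  have sM : Rle (Rinv s) (Rminus M v0).
    by rewrite -[Rminus M v0]Rinv_inv; apply: Rinv_le_contravar => //; apply: Rinv_0_lt_compat; lra.
  have Ms : Rle (Rminus M u1) (Rinv s).
    by rewrite -[Rminus M u1]Rinv_inv; apply: Rinv_le_contravar.
  set w := Rminus M (Rinv s).
  have Iw : I w by rewrite /I /w; lra.
  have wE : Rinv (Rminus M w) = s.
    by rewrite -[RHS]Rinv_inv; congr Rinv; rewrite /w; lra.
  have scaled x : f.[x] = w -> (a^-1 *: (f - M%:P)).[x] * s = - a^-1.
    move=> fx; rewrite hornerZ hornerD hornerN hornerC fx -mulrA -[RHS]mulrN1; congr (_ * _).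
    rewrite -[LHS]/(Rmult (Rminus w M) s) -[RHS]/(Ropp (IZR 1)).
    have : Rmult (Rinv s) s = IZR 1 by apply: Rinv_l; lra.
    by rewrite /w; lra.
  split; [exact/scaled/fx1|exact/scaled/fx2|].
  have [v0w wv1] : Rle v0 w /\ Rlt w v1 by rewrite /w; lra.
  have := exp w (conj v0w wv1); rewrite wE -!RpowE; exact.
have := exp u (conj v0u uv1); rewrite (PSeries_ext _ (fun=> IZR 0)) ?PSeries_const_0 //.
rewrite -[LHS]/((G.[x1 u] - G.[x2 u]) * ((G.[x1 u] - G.[x2 u]) * 1)).
rewrite mulr1 => h; have /eqP : (G.[x1 u] - G.[x2 u]) * (G.[x1 u] - G.[x2 u]) = 0 by rewrite h /= Rmult_0_l Rmult_0_r.
by rewrite mulf_eq0 orbb subr_eq0 => /eqP.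
Qed.

End Oval.

Lemma filterlim_limit1_in (g : R -> R) D l x0 :
  limit1_in g D l x0 -> filterlim g (within D (locally x0)) (locally l).
Proof.
move=> h P [eps Peps]; have [alp [alp0 halp]] := h eps (cond_pos eps).
exists (mkposreal alp alp0) => x xalp Dx; apply: Peps.
by apply: halp; split.
Qed.

Lemma neq_near (r : {poly R}) (x1 x2 : R -> R) (J : R -> Prop) t0 :
  limit1_in x1 J (x1 t0) t0 -> limit1_in x2 J (x2 t0) t0 -> r.[x1 t0] <> r.[x2 t0] ->
  exists alp, Rlt 0 alp /\ forall t, J t -> Rlt (Rabs (Rminus t t0)) alp -> r.[x1 t] <> r.[x2 t].
Proof.
move=> c1 c2 ne.
have lim (x : R -> R) : limit1_in x J (x t0) t0 ->
    filterlim (fun t => r.[x t]) (within J (locally t0)) (locally r.[x t0]).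
  move=> c; apply: (filterlim_comp _ _ _ x (horner r)); first exact: filterlim_limit1_in c.
  exact: continuous_horner.
pose eps := Rdiv (Rabs (Rminus r.[x1 t0] r.[x2 t0])) 2.
have eps0 : Rlt 0 eps by rewrite /eps; have := Rabs_pos_lt (Rminus r.[x1 t0] r.[x2 t0]); lra.
have nb (y : R) : locally y (fun z => Rlt (Rabs (Rminus z y)) eps) by exists (mkposreal _ eps0).
have [[a1 a10] h1] := lim x1 c1 _ (nb _); have [[a2 a20] h2] := lim x2 c2 _ (nb _).
exists (Rmin a1 a2); split; first exact: Rmin_pos.
move=> t Jt tl E.
have l1 := h1 t (Rlt_le_trans _ _ _ tl (Rmin_l _ _)) Jt.
have l2 := h2 t (Rlt_le_trans _ _ _ tl (Rmin_r _ _)) Jt.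
have := Rabs_triang (Rminus r.[x2 t] r.[x2 t0]) (Ropp (Rminus r.[x1 t] r.[x1 t0])).
rewrite Rabs_Ropp E in l1 *.
have -> : Rplus (Rminus r.[x2 t] r.[x2 t0]) (Ropp (Rminus r.[x2 t] r.[x1 t0])) = Rminus r.[x1 t0] r.[x2 t0] by lra.
by move: l1 l2; rewrite /eps; lra.
Qed.

(** * From the vanishing of [Psi] to a common right factor *)

Section Ovals.

Variables (f K : {poly R}) (J : R -> Prop) (x1 x2 : R -> R).
Hypotheses (f_size : (1 < size f)%N) (J_int : is_interval J) (J_ne : nondegenerate J).
Hypotheses (x1_cont : Defs.continuous_on x1 J) (x2_cont : Defs.continuous_on x2 J).
Hypothesis x12 : forall t, J t -> Rlt (x1 t) (x2 t).
Hypothesis fx1 : forall t, J t -> f.[x1 t] = - t.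
Hypothesis fx2 : forall t, J t -> f.[x2 t] = - t.
Hypothesis f_gt : forall t, J t -> forall x, Rlt (x1 t) x -> Rlt x (x2 t) -> Rlt (Ropp t) f.[x].

(** [t0] may be an endpoint of [J], so the subinterval is taken on the side of some other point [c]
    of [J]. *)
Lemma small_subinterval t0 alp : J t0 -> Rlt 0 alp ->
  exists p q, [/\ J p, J q, Rlt p q & forall t, Rle p t -> Rle t q -> Rlt (Rabs (Rminus t t0)) alp].
Proof.
move=> Jt0 alp0; have [a [b [Ja [Jb ab]]]] := J_ne.
have [c [Jc ct0]] : exists c, J c /\ c <> t0.
  by have [E|?] := pselect (a = t0 :> R); [exists b; split=> //; lra|exists a].
have [lt|gt] := Rdichotomy _ _ ct0.
  exists (Rmax c (Rminus t0 (Rdiv alp 2))), t0; split=> //.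
  - apply: (J_int Jc Jt0); split; first exact: Rmax_l.
    by apply: Rmax_lub; lra.
  - by apply: Rmax_lub_lt; lra.
  move=> t pt tt0; have := Rmax_r c (Rminus t0 (Rdiv alp 2)) => m.
  by apply: Rabs_def1; lra.
exists t0, (Rmin c (Rplus t0 (Rdiv alp 2))); split=> //.
- apply: (J_int Jt0 Jc); split; last exact: Rmin_l.
  by apply: Rmin_glb; lra.
- by apply: Rmin_glb_lt; lra.
move=> t pt tt0; have := Rmin_r c (Rplus t0 (Rdiv alp 2)) => m.
by apply: Rabs_def1; lra.
Qed.

(** [x1] is injective because [f(x1 t) = - t]. Hence the [size d] parameters [p + (q - p) / (i + 1)]
    give distinct points, more than [d] has roots. *)
Lemma finite_exceptions (d : {poly R}) p q : d != 0 -> J p -> J q -> Rlt p q ->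
  exists t, [/\ Rlt p t, Rle t q & d.[x1 t] != 0].
Proof.
move=> d0 Jp Jq pq; apply: contrapT => no.
pose s i : R := Rplus p (Rdiv (Rminus q p) (INR i.+1)).
have s_in i : Rlt p (s i) /\ Rle (s i) q.
  have i1 : Rle 1 (INR i.+1) by rewrite S_INR; have := pos_INR i; lra.
  have i0 : Rlt 0 (INR i.+1) by lra.
  have x0 : Rlt 0 (Rdiv (Rminus q p) (INR i.+1)) by apply: Rdiv_lt_0_compat; lra.
  have xq : Rle (Rdiv (Rminus q p) (INR i.+1)) (Rminus q p).
    by apply/Rle_div_l => //; rewrite -{1}[Rminus q p]Rmult_1_r; apply: Rmult_le_compat_l; lra.
  by rewrite /s; lra.
have Js i : J (s i) by apply: (J_int Jp Jq); have := s_in i; lra.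
have := @max_poly_roots _ d [seq x1 (s i) | i <- iota 0 (size d)] d0.
rewrite size_map size_iota ltnn => abs; suff: false by [].
apply: abs.
  apply/allP => _ /mapP[i _ ->]; apply/eqP; apply: contrapT => /eqP di.
  by apply: no; exists (s i); have [? ?] := s_in i.
rewrite map_inj_uniq ?iota_uniq // => i j /(congr1 (horner f)); rewrite !fx1 // => /oppr_inj.
rewrite /s => /Rplus_eq_reg_l/Rmult_eq_reg_l E.
have : Rinv (INR i.+1) = Rinv (INR j.+1) by apply: E; lra.
by move/Rinv_eq_reg/INR_eq => [].
Qed.

Hypothesis vanish : forall t, J t ->
  RInt (fun x => Rmult K^`().[x] (sqrt (Rplus f.[x] t))) (x1 t) (x2 t) = 0.

Lemma primitive_values_on_J (G : {poly R}) p q t : G^`() = K * f^`() -> J p -> J q ->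
  Rlt p t -> Rle t q -> G.[x1 t] = G.[x2 t].
Proof.
move=> GE Jp Jq pt tq; rewrite -[t]Ropp_involutive.
have Jv v : Rle (Ropp q) v /\ Rle v (Ropp p) -> J (Ropp v) by move=> ?; apply: (J_int Jp Jq); lra.
have lim (x : R -> R) u : Defs.continuous_on x J -> Rle (Ropp q) u /\ Rle u (Ropp p) ->
    limit1_in (fun v => x (Ropp v)) (fun v => Rle (Ropp q) v /\ Rle v (Ropp p)) (x (Ropp u)) u.
  move=> c /Jv Ju eps eps0; have [alp [alp0 h]] := c _ Ju eps eps0.
  exists alp; split=> // v [vI vu]; apply: h; split; first exact: Jv.
  by move: vu; rewrite /= /R_dist -Rabs_Ropp; congr (Rlt (Rabs _) _); lra.
apply: (@primitive_values_eq f K (fun v => x1 (Ropp v)) (fun v => x2 (Ropp v)) (Ropp q) (Ropp p)) => //.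
- by apply: Ropp_lt_contravar; lra.
- by move=> u; apply: lim.
- by move=> u; apply: lim.
- by move=> u /Jv/x12.
- by move=> u /Jv/fx1 ->; apply: Ropp_involutive.
- by move=> u /Jv/fx2 ->; apply: Ropp_involutive.
- move=> u /Jv Ju x [xl xr]; rewrite -[u]Ropp_involutive; exact: (f_gt Ju).
- by move=> u /Jv Ju; have := vanish Ju.
- by lra.
- by lra.
Qed.

Lemma common_right_factor : exists r ft Kt : {poly R},
  [/\ f = ft \Po r, K = Kt \Po r & forall t, J t -> r.[x1 t] = r.[x2 t]].
Proof.
have [G GE] := poly_primitive (K * f^`()).
have [n f_sz] : exists n, size f = n.+2 by case: (size f) f_size => [|[|n]] // _; exists n.
set a := lead_coef f; have a0 : a != 0 by rewrite lead_coef_eq0 -size_poly_gt0 f_sz.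
have f1_monic : a^-1 *: f \is monic by rewrite monicE lead_coefZ mulVf.
have f1_size : size (a^-1 *: f) = n.+2 by rewrite size_scale ?invr_eq0.
have char0 k : k.+1%:R != 0 :> complex R.
  by rewrite -(rmorph_nat (real_complex R)) fmorph_eq0 pnatr_eq0.
have [r [ft [gt [d [fE gE d0 r1 h]]]]] :=
  polynomial_luroth (real_complex R : {rmorphism R -> complex R}) G char0 f1_monic f1_size.
have fE' : f = (a *: ft) \Po r by rewrite comp_polyZ -fE scalerA divff // scale1r.
have ft_size : (1 < size (a *: ft))%N.
  rewrite ltnNge; apply/negP => ft1; move: f_size.
  by rewrite fE' (size1_polyC ft1) comp_polyC ltnNge size_polyC_leq1.
have [Kt KE] : exists Kt, K = Kt \Po r.
  by apply: (@comp_poly_of_deriv _ K (a *: ft) gt) => //; rewrite -gE -fE'.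
(* If [r] separated the endpoints at [t0], it would do so nearby by continuity; but arbitrarily near
   there is a parameter [t] with [d(x1 t)] nonzero, where equal values of [f] and [G] force equal
   values of [r]. *)
exists r, (a *: ft), Kt; split=> // t0 Jt0; apply: contrapT => ne.
have [alp [alp0 far]] := neq_near (x1_cont Jt0) (x2_cont Jt0) ne.
have [p [q [Jp Jq pq near]]] := small_subinterval Jt0 alp0.
have [t [pt tq dt]] := finite_exceptions d0 Jp Jq pq.
have Jt : J t by apply: (J_int Jp Jq); lra.
apply: (far t Jt); first by apply: near => //; lra.
apply: h => //; first by rewrite !hornerZ fx1 // fx2.
exact: (primitive_values_on_J GE Jp Jq).
Qed.

End Ovals.

(** * The converse, and the passage from coefficient lists to polynomials *)

Lemma continuous_mul_sqrt (f k : {poly R}) t x :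
  continuous (fun x => Rmult k.[x] (sqrt (Rplus f.[x] t))) x.
Proof.
apply: (continuous_mult (K := R_AbsRing)); first exact: continuous_horner.
apply: (continuous_comp _ sqrt); last exact/continuity_pt_filterlim/continuous_sqrt_pt.
by apply: (continuous_plus (V := R_NormedModule)); [apply: continuous_horner|apply: continuous_const].
Qed.

(** The substitution [v = r(x)] yields an integral whose two limits coincide; [r] need not be
    monotone for this. *)
Lemma RInt_comp_vanish (f K r : {poly R}) a b t : r.[a] = r.[b] ->
  RInt (fun x => Rmult (K \Po r)^`().[x] (sqrt (Rplus (f \Po r).[x] t))) a b = 0.
Proof.
move=> rab; pose F v := Rmult K^`().[v] (sqrt (Rplus f.[v] t)).
transitivity (RInt (fun x => scal r^`().[x] (F r.[x])) a b).
  apply: RInt_ext => x _; rewrite deriv_comp hornerM !horner_comp /F /scal /= /mult /=.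
  by rewrite -Rmult_assoc; congr Rmult; apply: mulrC.
rewrite (RInt_comp F (horner r)) => [|x _|x _].
- by rewrite rab RInt_point.
- exact: continuous_mul_sqrt.
by split; [apply: is_derive_horner|apply: continuous_horner].
Qed.

Lemma pevalE (p : list R) x : peval p x = (Poly p).[x].
Proof.
elim: p => [|a p IH]; first by rewrite /= horner0.
by rewrite [LHS]/= IH /= horner_cons mulrC addrC.
Qed.

Lemma peval_polyseq (p : {poly R}) x : peval (polyseq p) x = p.[x].
Proof. by rewrite pevalE polyseqK. Qed.

Lemma Poly_eq (p q : {poly R}) : (forall x, p.[x] = q.[x]) -> p = q.
Proof.
move=> pq; apply/eqP; rewrite -subr_eq0; apply: contraT => d0.
have := @max_poly_roots _ (p - q) [seq i%:R | i <- iota 0 (size (p - q))] d0.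
rewrite size_map size_iota ltnn => abs; suff: false by [].
apply: abs; first by apply/allP => x _; rewrite rootE hornerD hornerN pq subrr.
by rewrite map_inj_uniq ?iota_uniq // => i j /eqP; rewrite eqr_nat => /eqP.
Qed.

Lemma nonlinear_size (f : list R) : nonlinear f -> (1 < size (Poly f))%N.
Proof.
move=> hf; rewrite ltnNge; apply/negP => f1; apply: hf; exists 0, (Poly f)`_0 => x.
by rewrite pevalE (size1_polyC f1) hornerC coefC eqxx -[RHS]/(0 * x + _) mul0r add0r.
Qed.

Open Scope R_scope.

Theorem theorem8 (f k K : list R) (J : R -> Prop) (x1 x2 : R -> R)
  (hf : nonlinear f)
  (hK : forall x, derivable_pt_lim (peval K) x (peval k x))
  (hJ : is_interval J) (hJne : nondegenerate J)
  (hc1 : continuous_on x1 J) (hc2 : continuous_on x2 J)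
  (hlt : forall t, J t -> x1 t < x2 t)
  (hr1 : forall t, J t -> peval f (x1 t) + t = 0)
  (hr2 : forall t, J t -> peval f (x2 t) + t = 0)
  (hpos : forall t, J t -> forall x, x1 t < x -> x < x2 t -> 0 < peval f x + t) :
  (forall t, J t -> oval_integral_vanishes k f x1 x2 t) <->
  exists r ft Kt : list R,
    (forall x, peval f x = peval ft (peval r x)) /\
    (forall x, peval K x = peval Kt (peval r x)) /\
    (forall t, J t -> peval r (x1 t) = peval r (x2 t)).
Proof.
(* [k] is given through the derivative of [K] as a function; uniqueness of the derivative identifies
   its values with those of the formal derivative, whatever zeros end the lists. *)
have kE x : peval k x = ((Poly K)^`()%R).[x]%R.
  apply: (uniqueness_limite (peval K) x); first exact: hK.
  apply/is_derive_Reals; apply: (is_derive_ext (horner (Poly K))) => [t|]; first by rewrite pevalE.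
  exact: is_derive_horner.
split=> [vanish|[r [ft [Kt [fE [KE rE]]]]] t Jt].
  have [r [ft [Kt [fE KE rE]]]] : exists r ft Kt : {poly R},
      [/\ Poly f = (ft \Po r)%R, Poly K = (Kt \Po r)%R & forall t, J t -> r.[x1 t]%R = r.[x2 t]%R].
    apply: (@common_right_factor _ _ J x1 x2 (nonlinear_size hf) hJ hJne hc1 hc2 hlt).
    - by move=> t Jt; apply: Rplus_opp_r_uniq; rewrite Rplus_comm -pevalE; apply: hr1.
    - by move=> t Jt; apply: Rplus_opp_r_uniq; rewrite Rplus_comm -pevalE; apply: hr2.
    - by move=> t Jt x xl xr; apply: (Rplus_lt_reg_r t); rewrite Rplus_opp_l -pevalE; apply: hpos.
    move=> t Jt; have [pr E] := vanish t Jt; rewrite -[RHS]E -RInt_Reals.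
    by apply: RInt_ext => x _; rewrite kE pevalE.
  exists (polyseq r), (polyseq ft), (polyseq Kt); split; [|split].
  - by move=> x; rewrite !peval_polyseq pevalE fE horner_comp.
  - by move=> x; rewrite !peval_polyseq pevalE KE horner_comp.
  - by move=> t Jt; rewrite !peval_polyseq rE.
have fP : Poly f = (Poly ft \Po Poly r)%R.
  by apply: Poly_eq => x; rewrite horner_comp -!pevalE.
have KP : Poly K = (Poly Kt \Po Poly r)%R.
  by apply: Poly_eq => x; rewrite horner_comp -!pevalE.
have intE x : peval k x * sqrt (peval f x + t) =
    ((Poly Kt \Po Poly r)^`()%R).[x]%R * sqrt ((Poly ft \Po Poly r).[x]%R + t).
  by rewrite kE (pevalE f) fP KP.
have ex : ex_RInt (fun x => peval k x * sqrt (peval f x + t)) (x1 t) (x2 t).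
  apply: (ex_RInt_continuous (V := R_CompleteNormedModule)) => x _.
  apply: (continuous_ext (fun x => (((Poly Kt \Po Poly r)^`()%R).[x]%R * sqrt ((Poly ft \Po Poly r).[x]%R + t)))).
    by move=> y; rewrite intE.
  exact: continuous_mul_sqrt.
exists (ex_RInt_Reals_0 _ _ _ ex); rewrite -RInt_Reals.
have rx : (Poly r).[x1 t]%R = (Poly r).[x2 t]%R by rewrite -!pevalE; apply: rE.
rewrite -[RHS](@RInt_comp_vanish (Poly ft) (Poly Kt) (Poly r) (x1 t) (x2 t) t rx).
by apply: RInt_ext => x _; apply: intE.
Qed.
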